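(* Let $\{\mu_n,\psi_j^{(n)},\phi_j^{(n)},J^{(n)}\}_{n\in\mathbb N}$ be a sequence of biorthogonal ensembles with a recurrence (see context) with $\phi_j^{(n)}=\psi_j^{(n)}$ for all $j,n$ (so $J^{(n)}$ is symmetric). Suppose there exists a compact set $E\subset\mathbb R$ such that for every $k\in\mathbb N$, $$\sum_{j=0}^{n-1}\int_{\mathbb R\setminus E}x^k\phi_j^{(n)}(x)\psi_j^{(n)}(x)\,d\mu_n(x)=o(1/n)\quad(n\to\infty).$$ Let $Q$ be a polynomial with real coefficients such that $\{Q(J^{(n)})\}_n$ has a right limit along a subsequence $\{n_j\}_j$ equal to the Laurent matrix with symbol $s_Q(w)=\sum_{l=-q}^ps_lw^l$. Then for every real-valued $f\in C^1(\mathbb R)$ such that $|f(x)|\le C(1+|x|)^m$ for all $x$, for some $C>0$, $m\in\mathbb N$, $$X_{f\circ Q}^{(n_j)}-\mathbb E X_{f\circ Q}^{(n_j)}\to N\Big(0,\sum_{k=1}^\infty k\,\widehat{(f\circ Q)}_k\widehat{(f\circ Q)}_{-k}\Big)$$ in distribution as $j\to\infty$, where $\widehat{(f\circ Q)}_k=\frac{1}{2\pi i}\oint_{|w|=1}f(s_Q(w))\,w^k\frac{dw}{w}$ (note $s_Q(w)\in\mathbb R$ for $|w|=1$). In particular (taking $Q(x)=x$) the same holds with $X_f^{(n_j)}$ when $\{J^{(n)}\}$ has a Laurent right limit with symbol $s$, with coefficients $\frac{1}{2\pi i}\oint_{|w|=1}f(s(w))w^k\frac{dw}{w}$.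
   Context: For each $n\in\mathbb N$ let $\mu_n$ be a Borel measure on $\mathbb R$ and let $\{\psi_j^{(n)}\}_{j\ge0}$, $\{\phi_j^{(n)}\}_{j\ge0}$ be real functions on $\mathbb R$ with $\int\psi_j^{(n)}\phi_k^{(n)}\,d\mu_n=\delta_{jk}$. The biorthogonal ensemble of size $n$ is the probability measure on $\mathbb R^n$ proportional to $\det(\psi^{(n)}_{j-1}(x_i))_{i,j=1}^n\det(\phi^{(n)}_{j-1}(x_i))_{i,j=1}^n\,d\mu_n(x_1)\cdots d\mu_n(x_n)$. It is ''with a recurrence'' if there is a banded infinite matrix $J^{(n)}=(J^{(n)}_{jk})_{j,k\ge0}$ with $x\psi^{(n)}_j(x)=\sum_k J^{(n)}_{jk}\psi^{(n)}_k(x)$ for all $x\in\mathbb R$, $j\ge0$, the band structure being independent of $n$. The linear statistic is $X_f^{(n)}=\sum_{i=1}^nf(x_i)$. A two-sided matrix $B^R=(B^R_{r,s})_{r,s\in\mathbb Z}$ is a right limit of $\{B^{(n)}\}$ along $\{n_j\}$ if $B^R_{r,s}=\lim_jB^{(n_j)}_{n_j+r,n_j+s}$ for all $r,s\in\mathbb Z$ and $B^R$ is bounded on $\ell^2(\mathbb Z)$. The Laurent matrix with symbol $s(w)=\sum_ls_lw^l$ is $(s_{j-k})_{j,k\in\mathbb Z}$. *)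

(* Defs.v *)
From HB Require Import structures.
From mathcomp Require Import all_boot all_order all_algebra.
From mathcomp Require Import all_classical all_reals all_analysis.
From mathcomp Require Import complex.
Set Implicit Arguments. Unset Strict Implicit. Unset Printing Implicit Defensive.
Import Order.TTheory GRing.Theory Num.Theory.
Import numFieldNormedType.Exports.
Local Open Scope classical_set_scope.
Local Open Scope ring_scope.

Section Defs.
Variable R : realType.

(* Iterated integral over R^n of F : (nat -> R) -> \bar R with respect to the
   n-fold product of mu (only coordinates 0..n-1 of the point are used):
   iint mu n F = \int dmu(x_{n-1}) ... \int dmu(x_0) F(x). *)
Fixpoint iint (mu : {measure set R -> \bar R}) (n : nat)
    (F : (nat -> R) -> \bar R) : \bar R :=
  match n with
  | 0 => F (fun _ => 0)
  | m.+1 => (\int[mu]_t iint mu m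
               (fun x => F (fun i => if i == m then t else x i)))%E
  end.

Definition ens_det (n : nat) (psi : nat -> R -> R) (x : nat -> R) : R :=
  \det (\matrix_(i < n, j < n) psi j (x i)).

(* Expectation, under the orthogonal ensemble of size n (density proportional
   to det(psi_{j-1}(x_i))^2 w.r.t. mu^n), of the observable G : R^n -> R. *)
Definition ens_expect (mu : {measure set R -> \bar R}) (n : nat)
    (psi : nat -> R -> R) (G : (nat -> R) -> R) : R :=
  fine (iint mu n (fun x => ((ens_det n psi x) ^+ 2 * G x)%:E)) /
  fine (iint mu n (fun x => ((ens_det n psi x) ^+ 2)%:E)).

Definition linstat (n : nat) (f : R -> R) (x : nat -> R) : R :=
  \sum_(i < n) f (x i).

(* Powers of a banded infinite matrix J (band width b: J j k = 0 if |j-k|>b);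
   for such J the sum below is the full matrix product. *)
Fixpoint bpow (b : nat) (J : nat -> nat -> R) (i : nat) : nat -> nat -> R :=
  match i with
  | 0 => fun j k => (j == k)%:R
  | i'.+1 => fun j k => \sum_(l < j + b + 1) J j l * bpow b J i' l k
  end.

Definition polyJ (b : nat) (Q : {poly R}) (J : nat -> nat -> R) : nat -> nat -> R :=
  fun j k => \sum_(i < size Q) Q`_i * bpow b J i j k.

(* entry of a one-sided matrix A at the (integer) index (n + r, n + s);
   only used for n large, when n + r, n + s >= 0. *)
Definition shifted (A : nat -> nat -> R) (n : nat) (r s : int) : R :=
  A (absz (n%:Z + r)) (absz (n%:Z + s)).

(* symbol s(w) = sum_{l=-q}^{p} s_l w^l evaluated at w = e^{i theta}; its real part *)
Definition symbol_re (p q : nat) (s : int -> R) (theta : R) : R :=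
  \sum_(0 <= i < p + q + 1) s (i%:Z - q%:Z) * cos ((i%:Z - q%:Z)%:~R * theta).
Definition symbol_im (p q : nat) (s : int -> R) (theta : R) : R :=
  \sum_(0 <= i < p + q + 1) s (i%:Z - q%:Z) * sin ((i%:Z - q%:Z)%:~R * theta).

(* Fourier coefficient  (1/2 pi i) \oint_{|w|=1} g(w) w^k dw/w
   = (1/2pi) \int_0^{2pi} G(theta) e^{i k theta} d theta, with w = e^{i theta}. *)
Definition fourier_coef (G : R -> R) (k : int) : complex.complex R :=
  complex.Complex
    ((2 * pi)^-1 * Rintegral lebesgue_measure `[0, 2 * pi]%classic
        (fun t => G t * cos (k%:~R * t)))
    ((2 * pi)^-1 * Rintegral lebesgue_measure `[0, 2 * pi]%classic
        (fun t => G t * sin (k%:~R * t))).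

Definition gauss_pdf (y : R) : R := (Num.sqrt (2 * pi))^-1 * expR (- (y ^+ 2) / 2).

Definition gauss_expect (v : R) (h : R -> R) : R :=
  Rintegral lebesgue_measure setT (fun y => h (Num.sqrt v * y) * gauss_pdf y).

End Defs.

(* Main.v *)
Require Import Defs.
From HB Require Import structures.
From mathcomp Require Import all_boot all_order all_algebra.
From mathcomp Require Import fingroup perm zify ring lra.
From mathcomp Require Import all_classical all_reals all_analysis.
From mathcomp Require Import measurable_realfun complex.
Import Order.TTheory GRing.Theory Num.Theory.
Import numFieldNormedType.Exports.
Local Open Scope classical_set_scope.
Local Open Scope ring_scope.
Set Implicit Arguments. Unset Strict Implicit. Unset Printing Implicit Defensive.

(* Multiplying det(psi_{t_a}(x_i)) by the linear statistic of p o Q replaces one column psi_{t_a}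
   by sum_k F_{t_a,k} psi_k with F = p(Q(J)). The moments of that statistic are therefore obtained
   by applying powers of the second quantization d F to the vacuum functional t |-> det(delta_{b,t_a})
   and evaluating at t = (0, ..., n-1). Only entries of F near (n, n) matter there, where F is close
   to a Laurent matrix; with T the strictly upper part of the latter, d F - tr F and d T agree at the
   vacuum up to a small error, d T kills the vacuum, and [d T, d F] is close to the scalar
   v = sum_(l > 0) l s_l s_{-l} (the Schwinger term). Hence the centered moments satisfy
   M_{m+1} ~ m v M_{m-1}, as Gaussian moments do.

   A C^1 function f is approximated by polynomials p in C^1 norm on a compact interval: since
   Var X_g is half the double integral of (g(x) - g(y))^2 K(x,y)^2, the variance of X_{(f-p) o Q} is
   at most the squared Lipschitz constant times Var X_Q plus a tail from outside E, and passing to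
   the limit the same inequality controls sum_k k |c_k|^2. For bounded continuous h, the bound
   h(Y) <= P(Z) + eps + A Z^2 + K (Y - Z)^2, with P a polynomial majorant of h of nearly the same
   Gaussian mean, reduces everything to the moments of Z = X_{p o Q} - E X_{p o Q} and the variance
   of Y - Z, so only integrands that are sums of products of one-variable functions occur. *)

(** Entries of [F] converge only near (n, n), while traces grow with [n], so every estimate needs
    constants that do not see [n]. Antisymmetry provides them: a column deep below n can only move
    onto an occupied label, which gives zero, so once the trace is removed a bounded number of
    columns act. Functionals on label tuples are therefore estimated on windows around n, whose
    radius grows with each operator applied. The scalar v is not visible in d [T, F] as an operator.
    It is the sum of the first n diagonal entries of [T, F], which would vanish for n by n matrices
    and here reduces to pairs a < n <= k; the l pairs at distance l are the weights in the variance.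
    Polynomial majorants with nearly the right Gaussian mean exist because the 2N-th moment over
    (2N)! equals (v/2)^N / N!: Taylor polynomials of waves converge in Gaussian mean with a
    polynomial error term. So [h] is first replaced, on a long interval, by a polynomial in a sine.
    The case v = 0 is included. The integral of an arbitrary function is monotone but need not be
    additive, hence [h] enters only through a sandwich between functions whose averages are
    certified. *)

(** * Second quantization acting on functions of column labels *)

Section FermionOperators.
Variables (R : realFieldType) (n : nat).
Implicit Types (t : 'I_n -> nat) (V : ('I_n -> nat) -> R) (G T F : nat -> nat -> R).

Definition upd t (a : 'I_n) (k : nat) : 'I_n -> nat := fun b => if b == a then k else t b.

Definition alternating V :=
  forall t (a b : 'I_n), a != b -> V (fun c => t (tperm a b c)) = - V t.

Definition banded (B : nat) G := forall j k, (j + B < k)%N || (k + B < j)%N -> G j k = 0.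

(* The second quantization of G, acting on functions of the column labels. *)
Definition dop (B : nat) G V t : R :=
  \sum_(a < n) \sum_(k < t a + B + 1) G (t a) k * V (upd t a k).

Lemma alternating_eq0 V t (a b : 'I_n) :
  alternating V -> a != b -> t a = t b -> V t = 0.
Proof.
move=> altV ab tab; have := altV t a b ab.
have -> : (fun c => t (tperm a b c)) = t.
  by apply/funext => c; case: tpermP => // ->.
lra.
Qed.

Lemma sum_ord_widen (h : nat -> R) (M N : nat) :
  (M <= N)%N -> (forall k, (M <= k)%N -> h k = 0) ->
  \sum_(k < M) h k = \sum_(k < N) h k.
Proof.
move=> MN h0; rewrite -!(big_mkord xpredT) (big_cat_nat (n := M) (p := N))//=.
rewrite [X in _ + X]big_nat_cond [X in _ + X]big1 ?addr0// => i.
by rewrite andbT => /andP[/h0].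
Qed.

Lemma dopE B G V t N : banded B G -> (forall a, (t a + B < N)%N) ->
  dop B G V t = \sum_(a < n) \sum_(k < N) G (t a) k * V (upd t a k).
Proof.
move=> bG tN; apply: eq_bigr => a _.
apply: (sum_ord_widen (h := fun k => G (t a) k * V (upd t a k))).
  by have := tN a; lia.
by move=> k hk; rewrite bG ?mul0r//; apply/orP; left; lia.
Qed.

Lemma upd_same t a k l : upd (upd t a k) a l = upd t a l.
Proof. by apply/funext => b; rewrite /upd; case: (b == a). Qed.

Lemma updC t a b k l : a != b -> upd (upd t a k) b l = upd (upd t b l) a k.
Proof.
move=> ab; apply/funext => c; rewrite /upd.
by case: eqVneq => // ->; rewrite eq_sym (negbTE ab).
Qed.

Lemma upd_id t a : upd t a (t a) = t.
Proof. by apply/funext => b; rewrite /upd; case: eqVneq => // ->. Qed.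

Lemma alternating_dop B G V : alternating V -> alternating (dop B G V).
Proof.
move=> altV t a b ab; rewrite /dop (reindex_inj (@perm_inj _ (tperm a b)))/=.
rewrite -sumrN; apply: eq_bigr => c _; rewrite tpermK -sumrN.
apply: eq_bigr => k _; rewrite -mulrN -(altV _ a b ab); congr (_ * V _).
apply/funext => d; rewrite /upd.
by rewrite -(inj_eq (@perm_inj _ (tperm a b))) tpermK.
Qed.

Lemma alternatingD V W : alternating V -> alternating W -> alternating (fun t => V t + W t).
Proof. by move=> hV hW t a b ab; rewrite hV// hW// opprD. Qed.

Lemma alternatingZ (c : R) V : alternating V -> alternating (fun t => c * V t).
Proof. by move=> hV t a b ab; rewrite hV// mulrN. Qed.

Lemma dopD B G V W t : dop B G (fun t => V t + W t) t = dop B G V t + dop B G W t.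
Proof.
rewrite /dop -big_split; apply: eq_bigr => a _; rewrite -big_split/=.
by apply: eq_bigr => k _; rewrite mulrDr.
Qed.

Lemma dopZ B G (c : R) V t : dop B G (fun t => c * V t) t = c * dop B G V t.
Proof.
rewrite /dop mulr_sumr; apply: eq_bigr => a _; rewrite mulr_sumr.
by apply: eq_bigr => k _; rewrite mulrCA.
Qed.

(** For [T] and [F] of bandwidth [B] row [j] ends at column [j + B], so the finite sum is the full
    entry of T F - F T. *)
Definition commut (B : nat) T F (j l : nat) : R :=
  \sum_(k < j + B + 1) (T j k * F k l - F j k * T k l).

Lemma banded_commut B T F : banded B T -> banded B F -> banded (2 * B) (commut B T F).
Proof.
move=> bT bF j l jl; apply: big1 => k _.
have [kj|kj] := boolP ((j + B < k)%N || (k + B < j)%N).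
  by rewrite (bT j k kj) (bF j k kj) !mul0r subr0.
rewrite (bF k l) ?(bT k l) ?mulr0 ?subr0//; move: jl kj; lia.
Qed.

(** Swapping the two columns turns the sum over distinct columns into the same sum with [T] and [F]
    exchanged, so it will cancel in a commutator. The margin [2 * B] keeps all labels below [N]
    after two moves. *)
Lemma dop_dop B T F V t N : banded B T -> banded B F ->
  (forall a, (t a + 2 * B < N)%N) ->
  dop B T (dop B F V) t =
    (\sum_(a < n) \sum_(k < N) \sum_(l < N) T (t a) k * F k l * V (upd t a l)) +
    (\sum_(a < n) \sum_(b < n | b != a) \sum_(k < N) \sum_(l < N)
        T (t a) k * F (t b) l * V (upd (upd t a k) b l)).
Proof.
move=> bT bF tN.
rewrite (@dopE B T (dop B F V) t N)//; last by move=> a; have := tN a; lia.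
rewrite -big_split; apply: eq_bigr => a _ /=.
rewrite [X in _ = _ + X]exchange_big -big_split; apply: eq_bigr => k _ /=.
have [hk|hk] := leqP (t a + B).+1 k.
  rewrite bT ?hk// mul0r big1 ?add0r => [|l _]; last by rewrite !mul0r.
  by rewrite big1// => b _; rewrite big1// => l _; rewrite !mul0r.
rewrite (@dopE B F V (upd t a k) N)//; last first.
  by move=> b; rewrite /upd; case: eqVneq => _; [have := tN a|have := tN b]; lia.
rewrite (bigD1 a)//= mulrDr; congr (_ + _).
  rewrite mulr_sumr; apply: eq_bigr => l _.
  by rewrite upd_same /upd eqxx mulrA.
rewrite mulr_sumr; apply: eq_bigr => b ba; rewrite mulr_sumr.
by apply: eq_bigr => l _; rewrite {1}/upd (negbTE ba) mulrA.
Qed.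

(** Second quantization respects brackets: only the terms in which both operators hit the same
    column survive. The scalar part becomes visible later, in the trace of the commutator over the
    first [n] labels. *)
Lemma dop_commutator B T F V t : banded B T -> banded B F ->
  dop B T (dop B F V) t = dop B F (dop B T V) t + dop (2 * B) (commut B T F) V t.
Proof.
move=> bT bF; pose N := (\sum_(a < n) t a + 2 * B).+1.
have tN a : (t a + 2 * B < N)%N by rewrite /N (bigD1 a)//=; lia.
rewrite (@dop_dop B T F V t N)// (@dop_dop B F T V t N)//.
rewrite (@dopE _ _ V t N (banded_commut bT bF))//.
rewrite [X in _ + X = _](_ : _ = \sum_(a < n) \sum_(b < n | b != a)
   \sum_(k < N) \sum_(l < N) F (t a) k * T (t b) l * V (upd (upd t a k) b l)); last first.
  rewrite (exchange_big_dep xpredT)//=; apply: eq_bigr => a _.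
  apply: eq_big => [b|b ba]; first by rewrite eq_sym.
  rewrite exchange_big; apply: eq_bigr => k _; apply: eq_bigr => l _ /=.
  by rewrite updC 1?eq_sym 1?[T _ _ * _]mulrC// eq_sym.
rewrite [RHS]addrAC; congr (_ + _); rewrite -big_split; apply: eq_bigr => a _ /=.
rewrite exchange_big [X in X + _]exchange_big -big_split; apply: eq_bigr => l _ /=.
rewrite /commut (sum_ord_widen (h := fun k => T (t a) k * F k l - F (t a) k * T k l) (N := N)).
- rewrite mulr_suml -big_split; apply: eq_bigr => k _ /=; ring.
- by have := tN a; lia.
- move=> k hk; have kj : (t a + B < k)%N || (k + B < t a)%N by lia.
  by rewrite (bT _ _ kj) (bF _ _ kj) !mul0r subr0.
Qed.

End FermionOperators.

(** * Label configurations that differ from 0, ..., n-1 only near n *)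

Section NearVacuum.
Variables (R : realFieldType) (n : nat).
Implicit Types (t : 'I_n -> nat) (V : ('I_n -> nat) -> R) (G F : nat -> nat -> R).

Definition near_edge (r x : nat) := (n <= x + r)%N && (x < n + r)%N.

(** A Fermi sea that is undisturbed below depth [r], with all remaining labels within distance [r]
    of the edge [n]. *)
Definition window (r : nat) t :=
  forall a : 'I_n, if (a + r < n)%N then t a = a else near_edge r (t a).

Lemma window_mono (r r' : nat) t : (r <= r')%N -> window r t -> window r' t.
Proof.
move=> rr wt a; have := wt a; rewrite /near_edge.
have := ltn_ord a; case: (ltnP (a + r') n); case: (ltnP (a + r) n) => //; lia.
Qed.

Lemma window_id r : window r (fun a => a).
Proof. by move=> a; rewrite /near_edge; case: ifPn => // h; have := ltn_ord a; lia. Qed.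

Lemma window_ltn r t (a : 'I_n) : window r t -> (t a < n + r)%N.
Proof.
move=> /(_ a); have := ltn_ord a; case: ifP => [_ ? ->|_ _ /andP[]//]; lia.
Qed.

Lemma window_near r B t (a : 'I_n) : window r t -> (n <= a + r + B)%N -> near_edge (r + B) (t a).
Proof.
move=> /(_ a); rewrite /near_edge; have := ltn_ord a.
case: ifP => _; [move=> ? ->|]; lia.
Qed.

(** One [B] pays for columns down to depth [r + B], whose labels are near the edge with radius
    [r + B]; the other [B] pays for the move itself. *)
Lemma window_upd r B t (a : 'I_n) k : window r t -> (n <= a + r + B)%N ->
  (k <= t a + B)%N -> (t a <= k + B)%N -> window (r + 2 * B) (upd t a k).
Proof.
move=> wt ar kt tk b; rewrite /upd; case: eqVneq => [->|ba].
  have := window_near wt ar; rewrite /near_edge.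
  by case: ifPn; lia.
have rr : (r <= r + 2 * B)%N by lia.
exact: (window_mono rr wt b).
Qed.

(** At most [N + r - n] indices lie above depth [r]. This count is what makes the constants of the
    later estimates independent of [n]. *)
Lemma sum_near (N r M : nat) (h : 'I_N -> R) (c : R) :
  (forall k : 'I_N, h k <= (n <= k + r)%N%:R * c) -> 0 <= c ->
  (N + r - n <= M)%N -> \sum_(k < N) h k <= M%:R * c.
Proof.
move=> hc c0 NM; apply: le_trans (ler_sum _ (fun k _ => hc k)) _.
rewrite -mulr_suml ler_wpM2r// -natr_sum ler_nat; apply: leq_trans NM.
elim: N {h hc} => [|N IH]; first by rewrite big_ord0.
by rewrite big_ord_recr/=; case: leqP => h; move: IH => /=; lia.
Qed.

(** Exclusion principle: a column [a] with [a + r + B < n] carries its own label, and a move by at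
    most [B] reaches some [k] with [k + r < n], already carried by column [k]. Two equal labels make
    an alternating [V] vanish. *)
Lemma dop_window B G V t N r : banded B G -> alternating V -> window r t ->
  (n + r + B <= N)%N ->
  dop B G V t = (\sum_(a < n) G (t a) (t a)) * V t +
    \sum_(a < n | (n <= a + r + B)%N) \sum_(k < N | k != t a :> nat)
       G (t a) k * V (upd t a k).
Proof.
move=> bG altV wt nN.
have tN a : (t a + B < N)%N by have := window_ltn a wt; lia.
rewrite (dopE _ bG tN) mulr_suml [X in _ + X]big_mkcond -big_split/=.
apply: eq_bigr => a _.
have taN : (t a < N)%N by have := tN a; lia.
rewrite (bigD1 (Ordinal taN))//= upd_id; congr (_ + _).
case: leqP => // ar; apply: big1 => k /= ka.
have [kj|kj] := boolP ((t a + B < k)%N || (k + B < t a)%N); first by rewrite (bG _ _ kj) mul0r.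
have ta : t a = a by have := wt a; case: ifP => //; lia.
have kn : (k < n)%N by lia.
have ck : t (Ordinal kn) = k by have := wt (Ordinal kn); case: ifP => //=; lia.
have ca : a != Ordinal kn.
  by apply/eqP => e; move: ka; rewrite -val_eqE/= ta e/= eqxx.
rewrite (alternating_eq0 altV ca) ?mulr0// /upd eqxx.
by rewrite eq_sym (negbTE ca) ck.
Qed.

Lemma dop_est B G V t r rr g K : banded B G -> alternating V -> window r t ->
  (r + 2 * B <= rr)%N -> 0 <= g -> 0 <= K ->
  (forall x y, near_edge rr x -> near_edge rr y -> `|G x y| <= g) ->
  (forall t, window rr t -> `|V t| <= K) ->
  `|dop B G V t - (\sum_(a < n) G (t a) (t a)) * V t| <= rr%:R * ((2 * rr)%:R * (g * K)).
Proof.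
move=> bG altV wt rB g0 K0 Gg VK.
have nN : (n + r + B <= n + rr)%N by lia.
rewrite (dop_window bG altV wt nN) addrAC subrr add0r.
rewrite big_mkcond; apply: le_trans (ler_norm_sum _ _ _) _.
have gK0 : 0 <= (2 * rr)%:R * (g * K) by rewrite mulr_ge0// mulr_ge0.
apply: (sum_near (r := rr)) => //; last by lia.
move=> a; case: ifPn => ar; last by rewrite normr0 mulr_ge0.
have -> : (n <= a + rr)%N by lia.
rewrite mul1r big_mkcond; apply: le_trans (ler_norm_sum _ _ _) _.
apply: (sum_near (r := rr)); [move=> k|exact: mulr_ge0|lia].
case: ifPn => [_|_]; last by rewrite normr0 !mulr_ge0.
have [kj|kj] := boolP ((t a + B < k)%N || (k + B < t a)%N).
  by rewrite (bG _ _ kj) mul0r normr0 !mulr_ge0.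
have nta := window_near wt ar; move: (nta); rewrite {1}/near_edge => nta'.
have hk : (k <= t a + B)%N by lia.
have hk' : (t a <= k + B)%N by lia.
have -> : (n <= k + rr)%N by lia.
rewrite mul1r normrM ler_pM//; last by apply/VK/(window_mono rB)/window_upd.
by apply: Gg; rewrite /near_edge; have := ltn_ord k; lia.
Qed.

Lemma diag_est G t r g : window r t -> 0 <= g ->
  (forall x, near_edge r x -> `|G x x| <= g) ->
  `|\sum_(a < n) G (t a) (t a) - \sum_(a < n) G a a| <= r%:R * (2 * g).
Proof.
move=> wt g0 Gg; rewrite -sumrB; apply: le_trans (ler_norm_sum _ _ _) _.
apply: (sum_near (r := r)); [move=> a|by rewrite mulr_ge0|lia].
have := wt a; case: ifPn => [_ ->|ar nt]; first by rewrite subrr normr0 !mulr_ge0.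
have -> : (n <= a + r)%N by lia.
rewrite mul1r; apply: le_trans (ler_normB _ _) _.
have -> : 2 * g = g + g by ring.
apply: lerD; apply: Gg => //.
by rewrite /near_edge; have := ltn_ord a; lia.
Qed.

(** The subtracted trace runs over 0, ..., n-1 and not over the labels [t], so the centered operator
    is the same everywhere and can be iterated. Exchanging one trace for the other costs a bounded
    number of diagonal entries. *)
Lemma dop_diag_est B G V t r rr g K : banded B G -> alternating V -> window r t ->
  (r + 2 * B <= rr)%N -> 0 <= g -> 0 <= K ->
  (forall x y, near_edge rr x -> near_edge rr y -> `|G x y| <= g) ->
  (forall t, window rr t -> `|V t| <= K) ->
  `|dop B G V t - (\sum_(a < n) G a a) * V t| <= (rr%:R * (2 * rr)%:R + rr%:R * 2) * (g * K).
Proof.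
move=> bG altV wt rB g0 K0 Gg VK.
have h1 := dop_est bG altV wt rB g0 K0 Gg VK.
have wt' : window rr t by apply: window_mono wt; lia.
have h2 := diag_est (G := G) wt' g0 (fun x hx => Gg x x hx hx).
have -> : dop B G V t - (\sum_(a < n) G a a) * V t =
  (dop B G V t - (\sum_(a < n) G (t a) (t a)) * V t) +
  (\sum_(a < n) G (t a) (t a) - \sum_(a < n) G a a) * V t by ring.
apply: le_trans (ler_normD _ _) _; rewrite [leRHS]mulrDl; apply: lerD.
  by rewrite -mulrA.
by rewrite normrM mulrA -[_ * 2 * g]mulrA ler_pM// VK.
Qed.

End NearVacuum.

(** * The upper Toeplitz part of a Laurent matrix and the Schwinger term *)

Section ToeplitzSymbol.
Variables (R : realFieldType) (B : nat) (s : int -> R) (S : R).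
Hypothesis s_supp : forall l : int, (B < absz l)%N -> s l = 0.
Hypothesis s_bound : forall l, `|s l| <= S.

Definition upper_toeplitz (j k : nat) : R := if (j < k)%N then s (j%:Z - k%:Z) else 0.
Local Notation T := upper_toeplitz.

(** The Schwinger term in the shape in which the trace produces it: [c] numbers the row n - 1 - c
    below the edge and [i] the column n + i above it, at distance l = c + i + 1. Collecting equal
    distances gives the sum of l s_l s_{-l}, see [laurent_variance_sum]. *)
Definition laurent_variance : R :=
  \sum_(c < B) \sum_(i < B.+1) s (- (c + i + 1)%N%:Z) * s (c + i + 1)%N%:Z.

Lemma banded_upper_toeplitz : banded B T.
Proof.
move=> j k jk; rewrite /T; case: ifP => // h; apply: s_supp; lia.
Qed.

Lemma S_ge0 : 0 <= S. Proof. exact: le_trans (s_bound 0). Qed.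

Lemma upper_toeplitz_bound j k : `|T j k| <= S.
Proof. by rewrite /T; case: ifP; rewrite ?normr0 ?S_ge0. Qed.

(** The reflection [k |-> j + l - k] matches the two sums term by term, as for two Laurent matrices.
    Nonzero terms have [k <= j + B], and [B <= l] keeps them inside the reflected range. *)
Lemma toeplitz_commute (j l N : nat) : (B <= j)%N -> (B <= l)%N -> (j + B < N)%N ->
  \sum_(k < N) T j k * s (k%:Z - l%:Z) = \sum_(k < N) s (j%:Z - k%:Z) * T k l.
Proof.
move=> Bj Bl jN.
pose h1 k := T j k * s (k%:Z - l%:Z); pose h2 k := s (j%:Z - k%:Z) * T k l.
have z1 k : (j + B < k)%N -> h1 k = 0.
  by move=> h; rewrite /h1 banded_upper_toeplitz ?mul0r// h.
have z2 k : (j + B < k)%N -> h2 k = 0.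
  by move=> h; rewrite /h2 s_supp ?mul0r//; lia.
rewrite -(sum_ord_widen (h := h1) (M := (j + B).+1))//.
rewrite -(sum_ord_widen (h := h2) (M := (j + B).+1))//.
have jl : (j + B < (j + l).+1)%N by lia.
rewrite (sum_ord_widen jl z1) (sum_ord_widen jl z2) (reindex_inj rev_ord_inj)/=.
apply: eq_bigr => k _; rewrite /h1 /h2 /T mulrC; have := ltn_ord k => kl.
have -> : ((j + l).+1 - k.+1)%N%:Z - l%:Z = j%:Z - k%:Z by lia.
have -> : (j < (j + l).+1 - k.+1)%N = (k < l)%N by lia.
case: ifP => // h; congr (_ * s _); lia.
Qed.

Section FixedSize.
Variables (n : nat) (F : nat -> nat -> R).

Definition near_laurent (r : nat) (eps : R) :=
  forall x y, near_edge n r x -> near_edge n r y -> `|F x y - s (x%:Z - y%:Z)| <= eps.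

Hypothesis bF : banded B F.

(** Subtracting the commutator of [T] with the exact Laurent matrix, which is zero here, leaves only
    differences [F] minus Laurent, each of size [eps]. The radius [(r + B).+1] covers the
    intermediate index [k]. *)
Lemma commut_est r eps j l : near_laurent (r + B).+1 eps -> 0 <= eps ->
  (r + 2 * B < n)%N -> near_edge n r j -> near_edge n r l ->
  `|commut B T F j l| <= (2 * (r + B).+1)%:R * (2 * (S * eps)).
Proof.
move=> nF e0 rn nj nl; have bT := banded_upper_toeplitz.
have Bj : (B <= j)%N by move: nj; rewrite /near_edge; lia.
have Bl : (B <= l)%N by move: nl; rewrite /near_edge; lia.
pose N := (n + (r + B).+1)%N.
have jN : (j + B < N)%N by move: nj; rewrite /near_edge; lia.
have -> : commut B T F j l = \sum_(k < N)
   (T j k * (F k l - s (k%:Z - l%:Z)) - (F j k - s (j%:Z - k%:Z)) * T k l).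
  rewrite /commut (sum_ord_widen (h := fun k => T j k * F k l - F j k * T k l) (N := N)).
  - rewrite -[LHS]subr0 -[X in _ - X](subrr (\sum_(k < N) T j k * s (k%:Z - l%:Z))).
    rewrite {2}(toeplitz_commute Bj Bl jN) -!sumrB.
    by apply: eq_bigr => k _; ring.
  - by lia.
  - move=> k hk; have kj : (j + B < k)%N || (k + B < j)%N by lia.
    by rewrite (bT _ _ kj) (bF kj) !mul0r subr0.
apply: le_trans (ler_norm_sum _ _ _) _.
have Se0 : 0 <= S * eps by rewrite mulr_ge0// S_ge0.
apply: (sum_near (n := n) (r := (r + B).+1)); [|by rewrite mulr_ge0|by rewrite /N; lia].
move=> k; have kN : (k < n + (r + B).+1)%N := ltn_ord k.
have nr x : near_edge n r x -> near_edge n (r + B).+1 x by rewrite /near_edge; lia.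
have [nk|nk] := leqP n (k + (r + B).+1); rewrite ?mul1r ?mul0r.
  have hk : near_edge n (r + B).+1 k by rewrite /near_edge; lia.
  apply: le_trans (ler_normB _ _) _; have -> : 2 * (S * eps) = S * eps + S * eps by ring.
  rewrite !normrM; apply: lerD; last rewrite mulrC.
    by apply: ler_pM => //; [exact: upper_toeplitz_bound|apply: nF => //; exact: nr].
  by apply: ler_pM => //; [exact: upper_toeplitz_bound|apply: nF => //; exact: nr].
have -> : T j k = 0 by rewrite /T ifF//; move: nj; rewrite /near_edge; lia.
have -> : T k l = 0.
  by apply: bT; move: nl; rewrite /near_edge; lia.
by rewrite mul0r mulr0 subr0 normr0.
Qed.

(* Only the pairs across the edge survive in the trace of the commutator. *)
Lemma trace_commut_est eps : near_laurent (2 * B).+1 eps -> 0 <= eps -> (2 * B < n)%N ->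
  `|\sum_(a < n) commut B T F a a - laurent_variance|
     <= (2 * B).+1%:R * ((B.+1)%:R * (S * eps)).
Proof.
move=> nF e0 rn; have bT := banded_upper_toeplitz.
have Se0 : 0 <= S * eps by rewrite mulr_ge0// S_ge0.
pose cr (f : nat -> nat -> R) := \sum_(a < n) \sum_(i < B.+1) T a (n + i)%N * f (n + i)%N a.
have -> : \sum_(a < n) commut B T F a a = cr F.
  transitivity (\sum_(a < n) \sum_(k < n + B.+1) (T a k * F k a - F a k * T k a)).
    apply: eq_bigr => a _; rewrite /commut.
    apply: (sum_ord_widen (h := fun k => T a k * F k a - F a k * T k a)).
      by have := ltn_ord a; lia.
    move=> k hk; have kj : (a + B < k)%N || (k + B < a)%N by lia.
    by rewrite (bT _ _ kj) (bF kj) !mul0r subr0.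
  under eq_bigr do rewrite big_split_ord/=.
  rewrite big_split/=.
  have -> : \sum_(a < n) \sum_(k < n) (T a k * F k a - F a k * T k a) = 0.
    under eq_bigr do rewrite sumrB.
    rewrite sumrB exchange_big/=; apply/eqP; rewrite subr_eq0; apply/eqP.
    by apply: eq_bigr => a _; apply: eq_bigr => k _; rewrite mulrC.
  rewrite add0r; apply: eq_bigr => a _; apply: eq_bigr => i _.
  rewrite [T (n + i)%N a]/T ifF ?mulr0 ?subr0//.
  by have := ltn_ord a; lia.
have -> : laurent_variance = cr (fun x y => s (x%:Z - y%:Z)).
  rewrite /cr (reindex_inj rev_ord_inj)/= /laurent_variance.
  rewrite (sum_ord_widen (h := fun c => \sum_(i < B.+1) s (- (c + i + 1)%N%:Z) * s (c + i + 1)%N%:Z) (N := n)).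
  - apply: eq_bigr => c _; apply: eq_bigr => i _; have := ltn_ord c => cn.
    rewrite /T ifT; last by lia.
    by congr (s _ * s _); lia.
  - by lia.
  - by move=> c hc; apply: big1 => i _; rewrite s_supp ?mul0r//; lia.
rewrite -sumrB; apply: le_trans (ler_norm_sum _ _ _) _.
apply: (sum_near (n := n) (r := (2 * B).+1)); [|by rewrite mulr_ge0|lia].
move=> a; rewrite -sumrB; apply: le_trans (ler_norm_sum _ _ _) _.
have [na|na] := leqP n (a + (2 * B).+1); rewrite ?mul1r ?mul0r; last first.
  rewrite big1// => i _; rewrite /T ifT ?s_supp ?mul0r ?subrr ?normr0//; lia.
apply: le_trans (_ : \sum_(i < B.+1) S * eps <= _); last first.
  by rewrite sumr_const card_ord mulr_natl.
apply: ler_sum => i _; rewrite -mulrBr normrM ler_pM ?upper_toeplitz_bound//.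
by have := ltn_ord a; have := ltn_ord i => *; apply: nF; rewrite /near_edge; lia.
Qed.

End FixedSize.
End ToeplitzSymbol.

(** * The vacuum functional and its moments under a centered operator *)

Section VacuumMoments.
Variables (R : realFieldType) (n : nat).

Definition vacuum (t : 'I_n -> nat) : R := \det (\matrix_(b < n, a < n) ((b : nat) == t a)%:R).

Lemma alternating_vacuum : alternating vacuum.
Proof.
move=> t a b ab; rewrite /vacuum.
have -> : (\matrix_(i, j) ((i : nat) == t (tperm a b j))%:R : 'M[R]_n) =
   col_perm (tperm a b) (\matrix_(i, j) ((i : nat) == t j)%:R).
  by apply/matrixP => i j; rewrite !mxE.
by rewrite col_permE det_mulmx det_perm odd_permV odd_tperm ab expr1 mulrN1.
Qed.

Lemma vacuum_id : vacuum (fun a => a) = 1.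
Proof.
rewrite /vacuum -[RHS](det1 _ n); congr (\det _).
by apply/matrixP => i j; rewrite !mxE.
Qed.

Lemma vacuum_out t a : (n <= t a)%N -> vacuum t = 0.
Proof.
move=> nt; rewrite /vacuum (expand_det_col _ a) big1// => i _.
by rewrite mxE ltn_eqF ?mul0r//; apply: leq_trans nt.
Qed.

(** [T] only raises a label, from [t a] to some [k > t a]. If the result is to use labels below [n]
    only, then so does [t]; an injective [t] is then onto 0, ..., n-1, so another column already
    carries [k] and the vacuum vanishes. *)
Lemma dop_upper_vacuum B (s : int -> R) t : dop B (upper_toeplitz s) vacuum t = 0.
Proof.
have altV := alternating_vacuum.
have [inj_t|] := pselect (injective t); last first.
  move=> /existsNP[a /existsNP[b /not_implyP[tab ab]]].
  by apply: (alternating_eq0 (alternating_dop _ _ altV) _ tab); exact/eqP.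
apply: big1 => a _; apply: big1 => k _; rewrite /upper_toeplitz.
case: ifP => [tak|_]; last by rewrite mul0r.
have [[b nb]|out] := pselect (exists b, (n <= upd t a k b)%N).
  by rewrite (vacuum_out nb) mulr0.
have kn : (k < n)%N.
  by rewrite ltnNge; apply/negP => nk; apply: out; exists a; rewrite /upd eqxx.
have tn b : (t b < n)%N.
  have [->|ba] := eqVneq b a; first exact: ltn_trans tak kn.
  by rewrite ltnNge; apply/negP => nk; apply: out; exists b; rewrite /upd (negbTE ba).
pose f b : 'I_n := Ordinal (tn b).
have inj_f : injective f by move=> x y [] /inj_t.
pose b := invF inj_f (Ordinal kn).
have tb : t b = k by have /(congr1 val) := f_invF inj_f (Ordinal kn).
have ab : a != b by apply/eqP => /(congr1 t) e; move: tak e; rewrite tb; lia.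
by rewrite (alternating_eq0 altV ab) ?mulr0// /upd eqxx eq_sym (negbTE ab) tb.
Qed.

Definition centered_dop (B : nat) (F : nat -> nat -> R) (V : ('I_n -> nat) -> R) t : R :=
  dop B F V t - (\sum_(a < n) F a a) * V t.

Fixpoint vacuum_moment (B : nat) (F : nat -> nat -> R) (m : nat) : ('I_n -> nat) -> R :=
  if m is m'.+1 then centered_dop B F (vacuum_moment B F m') else vacuum.

Lemma alternating_centered_dop B F V : alternating V -> alternating (centered_dop B F V).
Proof.
move=> hV t a b ab; rewrite /centered_dop (alternating_dop _ _ hV)// hV//.
by rewrite mulrN opprB opprK addrC.
Qed.

Lemma alternating_vacuum_moment B F m : alternating (vacuum_moment B F m).
Proof.
by elim: m => [|m IH] /=; [exact: alternating_vacuum|exact: alternating_centered_dop].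
Qed.

(** For injective [t] at most one permutation contributes to the Leibniz sum; otherwise two columns
    coincide. *)
Lemma norm_vacuum_le1 t : `|vacuum t| <= 1.
Proof.
have altV := alternating_vacuum.
have [inj_t|] := pselect (injective t); last first.
  move=> /existsNP[a /existsNP[b /not_implyP[tab ab]]].
  by rewrite (alternating_eq0 altV _ tab) ?normr0//; exact/eqP.
pose M : 'M[R]_n := \matrix_(b, a) ((b : nat) == t a)%:R.
have M0 (s : 'S_n) (i : 'I_n) : i != t (s i) :> nat -> \prod_i M i (s i) = 0.
  by move=> h; rewrite (bigD1 i)//= mxE (negbTE h) mul0r.
have M1 (s : 'S_n) : `|\prod_i M i (s i)| <= 1.
  rewrite normr_prod prodr_ile1// => i _; rewrite normr_ge0/= mxE.
  by case: (_ == _); rewrite ?normr1 ?normr0.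
rewrite /vacuum -/M /determinant.
have [[s0 hs0]|hs] := pselect (exists s : 'S_n, forall i : 'I_n, i = t (s i) :> nat).
  rewrite (bigD1 s0)//= [X in _ + X]big1 ?addr0 => [|s ss0].
    by rewrite normrM normrX normrN1 expr1n mul1r.
  have [i si] : exists i, s i != s0 i.
    apply/existsP; rewrite -negb_forall; apply: contra ss0 => /forallP ss0.
    by apply/eqP/permP => i; exact/eqP.
  rewrite (M0 s i) ?mulr0//; apply: contra si => /eqP e.
  by apply/eqP/inj_t; rewrite -e -hs0.
rewrite big1 ?normr0// => s _.
have /existsNP[i /eqP hi] : ~ forall i : 'I_n, i = t (s i) :> nat.
  by move=> h; apply: hs; exists s.
by rewrite (M0 s i)// mulr0.
Qed.

End VacuumMoments.

(** * The Gaussian recursion for the vacuum moments *)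

Section MomentRecursion.
Variables (R : realFieldType) (B : nat) (s : int -> R) (S : R).
Hypothesis s_supp : forall l : int, (B < absz l)%N -> s l = 0.
Hypothesis s_bound : forall l, `|s l| <= S.
Local Notation T := (upper_toeplitz s).
Local Notation v := (laurent_variance B s).

(** The bound [eps <= 1] makes the entries near the edge at most [S + 1], and [rr <= n] keeps the
    window away from index 0. In the lemmas below the radius and the constant are chosen before [n],
    [F] and [eps], which gives uniformity in all three. *)
Definition edge_control (rr n : nat) (F : nat -> nat -> R) (eps : R) :=
  [/\ banded B F, 0 <= eps, eps <= 1, (rr <= n)%N & near_laurent s n F rr eps].

Lemma edge_control_mono r r' n F eps : (r <= r')%N ->
  edge_control r' n F eps -> edge_control r n F eps.
Proof.
move=> rr [bF e0 e1 rn nF]; split => //; first exact: leq_trans rn.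
by move=> x y; rewrite /near_edge => hx hy; apply: nF; rewrite /near_edge; lia.
Qed.

Lemma centered_dop_est r : exists rr (K : R), 0 <= K /\ forall n F eps (V : ('I_n -> nat) -> R) (k : R) t,
  edge_control rr n F eps -> alternating V -> 0 <= k ->
  (forall t, window rr t -> `|V t| <= k) -> window r t ->
  `|centered_dop B F V t| <= K * k.
Proof.
have S0 := S_ge0 s_bound.
pose rr := (r + 2 * B)%N; exists rr, ((rr%:R * (2 * rr)%:R + rr%:R * 2) * (S + 1)).
split; first by rewrite mulr_ge0// ?addr_ge0// ?mulr_ge0.
move=> n F eps V k t [bF e0 e1 rn nF] altV k0 Vk wt.
rewrite -mulrA; apply: (dop_diag_est bF altV wt) => //; first exact: addr_ge0.
move=> x y hx hy; rewrite -[F x y](subrK (s (x%:Z - y%:Z))) addrC.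
apply: le_trans (ler_normD _ _) _; apply: lerD => //.
by apply: le_trans (nF _ _ hx hy) _.
Qed.

(** Near the edge the entries of the commutator are O([eps]), so its second quantization acts as its
    trace up to O([eps]), and the trace is [v] up to O([eps]). *)
Lemma commut_dop_est r : exists rr (K : R), 0 <= K /\ forall n F eps (V : ('I_n -> nat) -> R) (k : R) t,
  edge_control rr n F eps -> alternating V -> 0 <= k ->
  (forall t, window rr t -> `|V t| <= k) -> window r t ->
  `|dop (2 * B) (commut B T F) V t - v * V t| <= K * (eps * k).
Proof.
have S0 := S_ge0 s_bound.
(* The commutator has bandwidth [2 * B], so one application widens the window by [4 * B]; the rest
   of [rr] is room for [commut_est]. *)
pose r1 := (r + 4 * B)%N; pose rr := (r1 + 2 * B).+1.
pose K1 := (r1%:R * (2 * r1)%:R + r1%:R * 2) * ((2 * (r1 + B).+1)%:R * (2 * S)) : R.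
pose K2 := (2 * B).+1%:R * ((B.+1)%:R * S) : R.
exists rr, (K1 + K2); split; first by rewrite /K1 /K2 !(addr_ge0, mulr_ge0).
move=> n F eps V k t ec altV k0 Vk wt; have [bF e0 e1 rn nF] := ec.
have bC := banded_commut (banded_upper_toeplitz s_supp) bF.
have r1rr : (r1 <= rr)%N by rewrite /rr; lia.
have wt1 : window r1 t by apply: window_mono wt; rewrite /r1; lia.
have -> : dop (2 * B) (commut B T F) V t - v * V t =
  (dop (2 * B) (commut B T F) V t - (\sum_(a < n) commut B T F a a) * V t) +
  (\sum_(a < n) commut B T F a a - v) * V t by ring.
apply: le_trans (ler_normD _ _) _; rewrite [leRHS]mulrDl; apply: lerD.
  have -> : K1 * (eps * k) = (r1%:R * (2 * r1)%:R + r1%:R * 2) *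
     (((2 * (r1 + B).+1)%:R * (2 * (S * eps))) * k) by rewrite /K1; ring.
  apply: (dop_diag_est bC altV wt) => //; first by rewrite /r1; lia.
  - by rewrite !mulr_ge0.
  - move=> x y hx hy; have r1n : (r1 + 2 * B < n)%N by exact: rn.
    apply: (commut_est (n := n) (r := r1) s_supp s_bound bF) => //.
    have ec' : edge_control (r1 + B).+1 n F eps by apply: edge_control_mono ec; rewrite /rr; lia.
    by case: ec'.
  - by move=> t' wt'; apply: Vk; apply: window_mono wt'.
rewrite normrM; have -> : K2 * (eps * k) = (2 * B).+1%:R * ((B.+1)%:R * (S * eps)) * k.
  by rewrite /K2; ring.
apply: ler_pM => //; last by apply: Vk; apply: window_mono wt1.
apply: (trace_commut_est (n := n) s_supp s_bound bF) => //; last by move: rn; rewrite /rr /r1; lia.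
have ec' : edge_control (2 * B).+1 n F eps by apply: edge_control_mono ec; rewrite /rr; lia.
by case: ec'.
Qed.

(* Write d G for the second quantization of G and Xh for the centered d F. Then [d T, Xh] is
   d [T, F], which acts near the vacuum as the scalar v up to O(eps); as d T
   kills the vacuum, it acts on the m-th moment functional as m v times the (m-1)-st one. *)
Lemma upper_dop_moment m r : exists rr (K : R), 0 <= K /\ forall n F eps t,
  edge_control rr n F eps -> @window n r t ->
  `|vacuum_moment B F m t| <= K /\
  `|dop B T (vacuum_moment B F m) t - m%:R * v * vacuum_moment B F m.-1 t| <= K * eps.
Proof.
elim: m r => [|m IH] r.
  exists 0%N, 1; split=> // n F eps t [bF e0 e1 rn nF] wt /=.
  by rewrite norm_vacuum_le1 dop_upper_vacuum !mul0r subr0 normr0 mul1r.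
have [r1 [K1 [K10 H1]]] := centered_dop_est r.
have [r2 [K2 [K20 H2]]] := commut_dop_est r.
pose r3 := maxn r1 r2; have [r4 [K [K0 IHm]]] := IH r3.
exists (maxn r3 r4), (K1 * K + K2 * K); split; first by rewrite addr_ge0// mulr_ge0.
move=> n F eps t ec wt.
have [r31 r32 r33 r34] : [/\ r1 <= r3, r2 <= r3, r3 <= maxn r3 r4 & r4 <= maxn r3 r4]%N.
  by rewrite /r3; split; lia.
have ec1 : edge_control r1 n F eps by apply: edge_control_mono ec; lia.
have ec2 : edge_control r2 n F eps by apply: edge_control_mono ec; lia.
have ec4 : edge_control r4 n F eps by apply: edge_control_mono ec; lia.
have [bF e0 e1 _ _] := ec.
have altM := @alternating_vacuum_moment R n B F.
have bV (w : 'I_n -> nat) : window r3 w -> `|vacuum_moment B F m w| <= K.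
  by move=> hw; have [] := IHm n F eps w ec4 hw.
pose U (w : 'I_n -> nat) := dop B T (vacuum_moment B F m) w - m%:R * v * vacuum_moment B F m.-1 w.
have bU (w : 'I_n -> nat) : window r3 w -> `|U w| <= K * eps.
  by move=> hw; have [] := IHm n F eps w ec4 hw.
have UE : U = fun w => dop B T (vacuum_moment B F m) w + (- (m%:R * v)) * vacuum_moment B F m.-1 w.
  by apply/funext => w; rewrite /U mulNr.
have altU : alternating U.
  by rewrite UE; apply: alternatingD; [exact: alternating_dop|exact: alternatingZ].
split.
  apply: le_trans (H1 n F eps _ K t ec1 (altM m) K0 _ wt) _.
    by move=> w hw; apply: bV; apply: window_mono hw.
  by rewrite lerDl mulr_ge0.
pose VM : ('I_n -> nat) -> R := vacuum_moment B F m.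
have -> : dop B T (vacuum_moment B F m.+1) t - m.+1%:R * v * vacuum_moment B F m.+1.-1 t =
   centered_dop B F U t + (dop (2 * B) (commut B T F) VM t - v * VM t).
  have XU : centered_dop B F U t = dop B F (dop B T VM) t - (\sum_(a < n) F a a) * dop B T VM t
      - m%:R * v * centered_dop B F (vacuum_moment B F m.-1) t.
    rewrite UE /centered_dop dopD dopZ -/VM; ring.
  (* For [m = 0] the convention [0.-1 = 0] is harmless: the coefficient [m%:R] is zero. *)
  have XmE : m%:R * v * centered_dop B F (vacuum_moment B F m.-1) t = m%:R * v * VM t.
    by rewrite /VM; case: (m) => [|m'] //=; rewrite !mul0r.
  rewrite XU XmE -/VM /=.
  have -> : dop B T (centered_dop B F VM) t =
      dop B T (dop B F VM) t - (\sum_(a < n) F a a) * dop B T VM t.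
    rewrite -mulNr -dopZ -dopD; congr (dop B T _ t).
    by apply/funext => w; rewrite /centered_dop mulNr.
  rewrite (dop_commutator _ _ (banded_upper_toeplitz s_supp) bF) -/VM -[m.+1]addn1 natrD.
  ring.
apply: le_trans (ler_normD _ _) _; rewrite [leRHS]mulrDl; apply: lerD.
  rewrite -mulrA; apply: (H1 n F eps) => //; first exact: mulr_ge0.
  by move=> w hw; apply: bU; apply: window_mono hw.
rewrite -mulrA [K * eps]mulrC; apply: (H2 n F eps) => //; first exact: altM.
by move=> w hw; apply: bV; apply: window_mono hw.
Qed.

(** At the labels 0, ..., n-1 a move onto another [k < n] is excluded and the diagonal cancels the
    trace, so centered d F involves only the entries (a, k) with a < n <= k. There [F] is
    [eps]-close to [T]; replacing it by [T] reduces the claim to [upper_dop_moment]. *)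
Lemma vacuum_moment_rec m : exists rr (K : R), 0 <= K /\ forall n F eps,
  edge_control rr n F eps ->
  `|vacuum_moment B F m.+1 (@nat_of_ord n) - m%:R * v * vacuum_moment B F m.-1 (@nat_of_ord n)|
    <= K * eps.
Proof.
have [r1 [K1 [K10 H1]]] := upper_dop_moment m (2 * B).+1.
pose rr := maxn r1 (2 * B).+1; pose K2 : R := rr%:R * (rr + B.+1)%:R * K1.
exists rr, (K2 + K1); split; first by rewrite /K2 !(addr_ge0, mulr_ge0).
move=> n F eps ec; have [bF e0 e1 rn nF] := ec.
have ec1 : edge_control r1 n F eps by apply: edge_control_mono ec; rewrite /rr; lia.
set V : ('I_n -> nat) -> R := vacuum_moment B F m; set idn := @nat_of_ord n.
have altV : alternating V by exact: alternating_vacuum_moment.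
have wid r : window r idn by exact: window_id.
have [_ h1] := H1 n F eps idn ec1 (wid _).
have VK (w : 'I_n -> nat) : window (2 * B).+1 w -> `|V w| <= K1.
  by move=> hw; have [] := H1 n F eps w ec1 hw.
apply: le_trans (ler_distD (dop B T V idn) _ _) _.
rewrite [leRHS]mulrDl; apply: lerD => //.
pose N := (n + B.+1)%N.
have tN (a : 'I_n) : (a + B < N)%N by have := ltn_ord a; rewrite /N; lia.
rewrite /= /centered_dop -/V (dopE V bF tN) (dopE V (banded_upper_toeplitz s_supp) tN).
rewrite mulr_suml -!sumrB; apply: le_trans (ler_norm_sum _ _ _) _.
have -> : K2 * eps = rr%:R * ((rr + B.+1)%:R * (eps * K1)) by rewrite /K2; ring.
apply: (sum_near (n := n) (r := rr)); [|by rewrite !mulr_ge0|lia].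
move=> a; have an := ltn_ord a.
(* Labels [k < n] other than [a] are occupied, and [T a a = 0], so the trace term removes exactly
   the diagonal entry of [F]. *)
have -> : \sum_(k < N) F (idn a) k * V (upd idn a k) - F a a * V idn -
   \sum_(k < N) T (idn a) k * V (upd idn a k) =
   \sum_(k < N) (if (n <= k)%N then (F a k - T a k) * V (upd idn a k) else 0).
  have aN : (a < N)%N by rewrite /N; lia.
  rewrite addrAC -sumrB (bigD1 (Ordinal aN))//= [RHS](bigD1 (Ordinal aN))//=.
  rewrite upd_id /T ltnn mul0r subr0 leqNgt an/= add0r addrAC subrr add0r.
  apply: eq_bigr => k ka; have [kn|kn] := leqP n k; first by rewrite mulrBl.
  have ak : a != Ordinal kn.
    by apply: contra ka => /eqP e; rewrite -val_eqE /= {1}e.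
  by rewrite (alternating_eq0 altV ak) ?mulr0 ?subrr// /upd eqxx eq_sym (negbTE ak).
apply: le_trans (ler_norm_sum _ _ _) _.
have [na|na] := leqP n (a + rr); rewrite ?mul1r ?mul0r; last first.
  rewrite big1// => k _; case: ifP => nk; rewrite ?normr0//.
  have kj : (a + B < k)%N || (k + B < a)%N by move: na; rewrite /rr; lia.
  by rewrite (bF _ _ kj) (banded_upper_toeplitz s_supp kj) subrr mul0r normr0.
apply: (sum_near (n := n) (r := rr)); [|by rewrite mulr_ge0|by rewrite /N; lia].
move=> k; case: ifP => nk; last by rewrite normr0 !mulr_ge0.
have kN : (k < n + B.+1)%N := ltn_ord k.
have -> : (n <= k + rr)%N by lia.
rewrite mul1r; have [kj|kj] := boolP ((a + B < k)%N || (k + B < a)%N).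
  by rewrite (bF _ _ kj) (banded_upper_toeplitz s_supp kj) subrr mul0r normr0 mulr_ge0.
rewrite normrM ler_pM//.
  rewrite /T ifT; last by lia.
  by apply: nF; rewrite /near_edge /rr; lia.
apply: VK; apply: (window_mono (r := 0 + 2 * B)); first lia.
by apply: window_upd => //=; rewrite /idn; lia.
Qed.

End MomentRecursion.

(** * Iterated integrals of sums of products, and determinants under them *)

Section IteratedIntegral.
Variables (R : realType) (mu : {measure set R -> \bar R}).
Implicit Types (F G : (nat -> R) -> R).
Local Notation integ g := (mu.-integrable setT (EFin \o g)).
Local Notation Rint g := (Rintegral mu setT g).

Lemma integrable_scale c (g : R -> R) : integ g -> integ (fun t => c * g t).
Proof. by move=> ig; exact: (integrableZl measurableT c ig). Qed.

Lemma integrable_add (f g : R -> R) : integ f -> integ g -> integ (fun t => f t + g t).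
Proof. by move=> ig ih; exact: (integrableD measurableT ig ih). Qed.

Import HBNNSimple.

(* No measurability is involved: the integral of any function is defined as a difference of
   suprema over simple functions. *)
Lemma le_integral_total (f g : R -> \bar R) :
  (forall x, (f x <= g x)%E) -> (\int[mu]_x f x <= \int[mu]_x g x)%E.
Proof.
move=> fg; rewrite /integral !patch_setT.
have le_sup (u v : R -> \bar R) : (forall x, (u x <= v x)%E) ->
  (ereal_sup [set sintegral mu h | h in [set h : {nnsfun R >-> R} | forall x, (h x)%:E <= u x]] <=
   ereal_sup [set sintegral mu h | h in [set h : {nnsfun R >-> R} | forall x, (h x)%:E <= v x]])%E.
  move=> uv; apply: ge_ereal_sup => _ [h hh <-]; apply: ereal_sup_ubound; exists h => // x.
  exact: le_trans (hh x) (uv x).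
apply: leeB; apply: le_sup => x.
  by rewrite !funeposE le_max2.
by rewrite !funenegE le_max2// leeN2.
Qed.

Lemma iint_mono n (F G : (nat -> R) -> \bar R) :
  (forall x, (F x <= G x)%E) -> (iint mu n F <= iint mu n G)%E.
Proof.
elim: n F G => [|n IH] F G FG /=; first exact: FG.
by apply: le_integral_total => t; apply: IH => x; exact: FG.
Qed.

(** A certificate that each partial integral is an integrable function of the next variable.
    Linearity is proved for this relation, whereas [iint] applied to arbitrary functions is only
    monotone. *)
Fixpoint iterated n F (v : R) : Prop :=
  match n with
  | 0 => F (fun _ => 0) = v
  | m.+1 => exists w : R -> R, [/\ integ w, Rint w = v &
      forall t, iterated m (fun x => F (fun i => if i == m then t else x i)) (w t)]
  end.

Lemma iint_iterated n F v : iterated n F v -> iint mu n (fun x => (F x)%:E) = v%:E.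
Proof.
elim: n F v => [F v /= ->//|n IH F v /= [w [iw <- hw]]].
under eq_integral => t _ do rewrite (IH _ _ (hw t)).
by rewrite /Rintegral fineK//; apply: integrable_fin_num.
Qed.

Lemma iterated_lin n c F v G w : iterated n F v -> iterated n G w ->
  iterated n (fun x => c * F x + G x) (c * v + w).
Proof.
elim: n F v G w => [F v G w /= -> ->//|n IH F v G w /= [p [ip <- hp]] [q [iq <- hq]]].
exists (fun t => c * p t + q t).
have icp : integ (fun t => c * p t).
  exact: integrable_scale.
split; [|by rewrite RintegralD// RintegralZl|by move=> t; exact: IH].
exact: integrable_add.
Qed.

Lemma iterated_prod n c (g : nat -> R -> R) : (forall i, (i < n)%N -> integ (g i)) ->
  iterated n (fun x => c * \prod_(i < n) g i (x i)) (c * \prod_(i < n) Rint (g i)).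
Proof.
elim: n c => [|n IH] c ig /=; first by rewrite !big_ord0.
have ign : integ (g n) by exact: ig.
exists (fun t => c * (\prod_(i < n) Rint (g i)) * g n t); split.
- exact: integrable_scale.
- by rewrite RintegralZl// big_ord_recr/= mulrA.
- move=> t; rewrite mulrAC.
  have -> : (fun x : nat -> R => c * \prod_(i < n.+1) g i (if (i : nat) == n then t else x i)) =
            (fun x => c * g n t * \prod_(i < n) g i (x i)).
    apply/funext => x; rewrite big_ord_recr/= eqxx mulrAC mulrA; congr (_ * _ * _).
    by apply: eq_bigr => i _; rewrite ltn_eqF.
  by apply: IH => i ni; apply: ig; exact: ltnW.
Qed.

Lemma iterated0 n : iterated n (fun=> 0) 0.
Proof.
elim: n => //= n IH; exists (fun=> 0); split => //; last by rewrite Rintegral_cst// mul0r.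
exact: integrable0.
Qed.

Lemma iterated_scale n c F v : iterated n F v -> iterated n (fun x => c * F x) (c * v).
Proof.
move=> h; have := iterated_lin c h (iterated0 n); rewrite addr0.
by congr (iterated n); apply/funext => x; rewrite addr0.
Qed.

Lemma iterated_add n F v G w : iterated n F v -> iterated n G w ->
  iterated n (fun x => F x + G x) (v + w).
Proof.
move=> h1 h2; have := iterated_lin 1 h1 h2; rewrite mul1r.
by congr (iterated n); apply/funext => x; rewrite mul1r.
Qed.

Lemma iterated_sum n (I : Type) (r : seq I) (P : pred I) (F : I -> (nat -> R) -> R) v :
  (forall i, P i -> iterated n (F i) (v i)) ->
  iterated n (fun x => \sum_(i <- r | P i) F i x) (\sum_(i <- r | P i) v i).
Proof.
move=> h; elim: r => [|i r IH].
  by rewrite big_nil; under eq_fun do rewrite big_nil; exact: iterated0.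
rewrite big_cons; under eq_fun do rewrite big_cons.
by case: ifP => // Pi; apply: iterated_add => //; exact: h.
Qed.

Lemma iterated_prod_ord n (g : 'I_n -> R -> R) : (forall i, integ (g i)) ->
  iterated n (fun x => \prod_(i < n) g i (x i)) (\prod_(i < n) Rint (g i)).
Proof.
move=> ig; pose g' (i : nat) := if insub i is Some i' then g i' else cst 0.
have g'E (i : 'I_n) : g' i = g i by rewrite /g' valK.
have ig' i : (i < n)%N -> integ (g' i) by move=> hi; rewrite (g'E (Ordinal hi)).
have := iterated_prod 1 ig'; rewrite mul1r.
congr (iterated n); first apply/funext => x; rewrite ?mul1r.
  by apply: eq_bigr => i _; rewrite g'E.
by apply: eq_bigr => i _; rewrite g'E.
Qed.

Definition fdet n (phi : 'I_n -> R -> R) (x : nat -> R) : R :=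
  \det (\matrix_(i < n, a < n) phi a (x i)).

(** Expand both determinants into Leibniz sums and integrate each product coordinatewise. For each
    permutation of the first factor the remaining sum is the same determinant with its rows
    permuted, with matching sign; this repetition is the factor [n!]. *)
Lemma andreief n (phi chi : 'I_n -> R -> R) :
  (forall a b, integ (fun x => phi a x * chi b x)) ->
  iterated n (fun x => fdet phi x * fdet chi x)
    (n`!%:R * \det (\matrix_(a < n, b < n) Rint (fun x => phi a x * chi b x))).
Proof.
move=> ipc; set M := \matrix_(a, b) _.
have -> : n`!%:R * \det M = \sum_(s : 'S_n) \sum_(t : 'S_n)
   ((-1) ^+ s * (-1) ^+ t) * \prod_(i < n) Rint (fun x => phi (s i) x * chi (t i) x).
  transitivity (\sum_(s : 'S_n) \det M); first by rewrite sumr_const card_Sn mulr_natl.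
  apply: eq_bigr => s _; have -> : \det M = (-1) ^+ s * \det (row_perm s M).
    by rewrite row_permE det_mulmx det_perm mulrA -signr_addb addbb mul1r.
  rewrite /determinant mulr_sumr; apply: eq_bigr => t _; rewrite -mulrA; congr (_ * (_ * _)).
  by apply: eq_bigr => i _; rewrite !mxE.
have -> : (fun x => fdet phi x * fdet chi x) = (fun x => \sum_(s : 'S_n) \sum_(t : 'S_n)
   ((-1) ^+ s * (-1) ^+ t) * \prod_(i < n) (phi (s i) (x i) * chi (t i) (x i))).
  apply/funext => x; rewrite /fdet /determinant mulr_suml; apply: eq_bigr => s _.
  rewrite mulr_sumr; apply: eq_bigr => t _; rewrite big_split/= mulrACA; congr (_ * (_ * _)).
    by apply: eq_bigr => i _; rewrite mxE.
  by apply: eq_bigr => i _; rewrite mxE.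
apply: iterated_sum => s _; apply: iterated_sum => t _; apply: iterated_scale.
exact: (iterated_prod_ord (g := fun i x => phi (s i) x * chi (t i) x)).
Qed.

Definition updf n (phi : 'I_n -> R -> R) (a : 'I_n) (h : R -> R) : 'I_n -> R -> R :=
  fun b => if b == a then h else phi b.

(** In the Leibniz term of a permutation s, the summand g(x_i) is absorbed by the factor of row i,
    which belongs to column s(i). Thus multiplication by a linear statistic acts as a derivation on
    columns. *)
Lemma linstat_fdet n (phi : 'I_n -> R -> R) (g : R -> R) x :
  linstat n g x * fdet phi x = \sum_(a < n) fdet (updf phi a (fun y => g y * phi a y)) x.
Proof.
rewrite /fdet /determinant mulr_sumr exchange_big; apply: eq_bigr => s _ /=.
have -> : linstat n g x = \sum_(a < n) g (x ((s^-1)%g a)).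
  by rewrite /linstat (reindex_inj (@perm_inj _ (s^-1)%g)).
rewrite mulr_suml; apply: eq_bigr => a _; rewrite mulrCA; congr (_ * _).
rewrite (bigD1 ((s^-1)%g a))//= [RHS](bigD1 ((s^-1)%g a))//= mulrA; congr (_ * _).
  by rewrite !mxE permKV /updf eqxx.
apply: eq_bigr => i ia; rewrite !mxE /updf ifF//.
by apply/negbTE; apply: contra ia => /eqP <-; rewrite permK.
Qed.

End IteratedIntegral.

(** * Determinants of matrices that equal the identity outside one or two columns *)

Section ReplacedColumns.
Variables (R : comRingType) (n : nat) (M : 'M[R]_n).

Lemma det_one_column a : (forall i j, j != a -> M i j = (i == j)%:R) -> \det M = M a a.
Proof.
move=> hM; rewrite -det_tr /determinant (bigD1 1%g)//= odd_perm1 mul1r.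
under [X in X + _]eq_bigr do rewrite perm1 mxE.
rewrite (bigD1 a)//= [X in _ * X]big1 ?mulr1 => [|i ia]; last by rewrite hM ?eqxx.
rewrite [X in _ + X]big1 ?addr0// => s s1.
have [i ia isi] : exists2 i, i != a & s i != i.
  have [//|h] := pselect (exists2 i, i != a & s i != i); exfalso; move/eqP: s1; apply.
  have hi i : i != a -> s i = i.
    by move=> ia; apply/eqP; apply: contrapT => /negP si; apply: h; exists i.
  apply/permP => i; rewrite perm1; have [->|] := eqVneq i a; last exact: hi.
  by have [//|saa] := eqVneq (s a) a; have /perm_inj := hi _ saa.
by rewrite (bigD1 i)//= !mxE hM// (negbTE isi) mul0r mulr0.
Qed.

(** A permutation moving an index other than [a] and [b] meets a zero of an identity column, which
    leaves only the identity and the transposition. *)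
Lemma det_two_columns a b : a != b ->
  (forall i j, j != a -> j != b -> M i j = (i == j)%:R) ->
  \det M = M a a * M b b - M a b * M b a.
Proof.
move=> ab hM; have ba : b != a by rewrite eq_sym.
have t1 : tperm a b != 1%g.
  by apply/eqP => /permP/(_ a); rewrite tpermL perm1 => e; rewrite e eqxx in ab.
rewrite -det_tr /determinant (bigD1 1%g)//= odd_perm1 mul1r (bigD1 (tperm a b))//=.
rewrite odd_tperm ab expr1 mulN1r (bigD1 a)//= (bigD1 b)//= [X in - X](bigD1 a)//= [X in - (_ * X)](bigD1 b)//=.
rewrite !mxE !perm1 tpermL tpermR.
rewrite [X in _ * (_ * X)]big1 ?mulr1; last first.
  by move=> i /andP[ia ib]; rewrite mxE perm1 hM// eqxx.
rewrite [X in - (_ * (_ * X))]big1 ?mulr1; last first.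
  by move=> i /andP[ia ib]; rewrite mxE tpermD 1?eq_sym// hM// eqxx.
rewrite [X in _ + (_ + X)]big1 ?addr0; first by rewrite [M b a * _]mulrC.
move=> s /andP[s1 st].
have [i [ia ib isi]] : exists i, [/\ i != a, i != b & s i != i].
  have [//|h] := pselect (exists i, [/\ i != a, i != b & s i != i]); exfalso.
  have hi i : i != a -> i != b -> s i = i.
    by move=> ia ib; apply/eqP; apply: contrapT => /negP si; apply: h; exists i.
  have hab c : s c != a -> s c != b -> s c = c by move=> h1 h2; have /perm_inj := hi _ h1 h2.
  have [saa|saa] := eqVneq (s a) a.
    move/eqP: s1; apply; apply/permP => i; rewrite perm1.
    have [->//|ia] := eqVneq i a; have [->|ib] := eqVneq i b; last exact: hi.
    have [//|sbb] := eqVneq (s b) b; apply: hab => //.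
    by apply: contra ab => /eqP sba; apply/eqP/(@perm_inj _ s); rewrite saa sba.
  have sab : s a = b.
    have [//|sab] := eqVneq (s a) b.
    by move: (saa); rewrite (hab _ saa sab) eqxx.
  move/eqP: st; apply; apply/permP => i.
  case: tpermP => [->//|->|/eqP ia /eqP ib]; last exact: hi.
  have sbb : s b != b.
    by apply: contra ab => /eqP sbb; apply/eqP/(@perm_inj _ s); rewrite sab sbb.
  have [//|sba] := eqVneq (s b) a.
  by move: (sbb); rewrite (hab _ sba sbb) eqxx.
by rewrite (bigD1 i)//= !mxE hM// (negbTE isi) mul0r mulr0.
Qed.

End ReplacedColumns.

Lemma fdet_updf_sum (R : realType) n (phi : 'I_n -> R -> R) a N (c : 'I_N -> R)
    (h : 'I_N -> R -> R) x :
  fdet (updf phi a (fun y => \sum_(k < N) c k * h k y)) x =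
  \sum_(k < N) c k * fdet (updf phi a (h k)) x.
Proof.
rewrite /fdet (expand_det_col _ a).
under [RHS]eq_bigr do rewrite (expand_det_col _ a) mulr_sumr.
rewrite exchange_big; apply: eq_bigr => i _; rewrite mxE /updf eqxx mulr_suml.
apply: eq_bigr => k _; rewrite mxE eqxx -[LHS]mulrA; congr (_ * (_ * _)).
rewrite /cofactor; congr (_ * _); congr determinant; apply/matrixP => p q; rewrite !mxE.
by rewrite eq_sym (negbTE (neq_lift _ _)).
Qed.

Lemma sum_delta (R : pzSemiRingType) n (h : 'I_n -> R) a :
  \sum_(b < n) h b * (a == b)%:R = h a.
Proof.
rewrite (bigD1 a)//= eqxx mulr1 big1 ?addr0// => b /negbTE.
by rewrite eq_sym => ->; rewrite mulr0.
Qed.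

(** * Ensemble averages, variances and moments of linear statistics *)

Section Ensemble.
Variables (R : realType) (mu : {measure set R -> \bar R}) (psi : nat -> R -> R).
Local Notation integ g := (mu.-integrable setT (EFin \o g)).
Local Notation Rint g := (Rintegral mu setT g).

Definition moment_fun (g : R -> R) := forall j k, integ (fun x => g x * (psi j x * psi k x)).

Definition mxelt (g : R -> R) (j k : nat) : R := Rint (fun x => g x * (psi j x * psi k x)).

Hypothesis int1 : forall j k, integ (fun x => psi j x * psi k x).
Hypothesis orth : forall j k, Rint (fun x => psi j x * psi k x) = (j == k)%:R.

Lemma mxelt_sym g j k : mxelt g j k = mxelt g k j.
Proof. by rewrite /mxelt; congr Rintegral; apply/funext => x; rewrite [psi j x * _]mulrC. Qed.

Variable n : nat.
Local Notation psin := (fun a : 'I_n => psi a).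

(* v is the ensemble average of G; the factor n! is the partition function. *)
Definition averages_to (G : (nat -> R) -> R) (v : R) :=
  iterated mu n (fun x => (ens_det n psi x) ^+ 2 * G x) (n`!%:R * v).

Lemma averages_to1 : averages_to (fun=> 1) 1.
Proof.
have := @andreief _ mu n psin psin (fun a b => int1 a b).
have -> : \matrix_(a < n, b < n) Rint (fun x => psin a x * psin b x) = 1%:M :> 'M[R]_n.
  by apply/matrixP => a b; rewrite !mxE orth.
by rewrite det1 /averages_to; congr iterated; apply/funext => x; rewrite mulr1 expr2.
Qed.

Lemma averages_to_lin c G v H w : averages_to G v -> averages_to H w ->
  averages_to (fun x => c * G x + H x) (c * v + w).
Proof.
move=> hG hH; have := iterated_lin c hG hH; rewrite /averages_to.
have -> : c * (n`!%:R * v) + n`!%:R * w = n`!%:R * (c * v + w) by ring.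
by congr iterated; apply/funext => x; ring.
Qed.

Lemma averages_to_const c : averages_to (fun=> c) c.
Proof.
have := averages_to_lin (c - 1) averages_to1 averages_to1; rewrite mulr1 subrK.
by congr averages_to; apply/funext => x; rewrite mulr1 subrK.
Qed.

Lemma averages_to_scale c G v : averages_to G v -> averages_to (fun x => c * G x) (c * v).
Proof.
move=> h; have := averages_to_lin c h (averages_to_const 0); rewrite addr0.
by congr averages_to; apply/funext => x; rewrite addr0.
Qed.

Lemma averages_to_add G v H w : averages_to G v -> averages_to H w ->
  averages_to (fun x => G x + H x) (v + w).
Proof.
move=> h1 h2; have := averages_to_lin 1 h1 h2; rewrite mul1r.
by congr averages_to; apply/funext => x; rewrite mul1r.
Qed.

Lemma averages_to_sum N (G : 'I_N -> (nat -> R) -> R) v :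
  (forall i, averages_to (G i) (v i)) ->
  averages_to (fun x => \sum_(i < N) G i x) (\sum_(i < N) v i).
Proof.
move=> h; rewrite /averages_to mulr_sumr.
under eq_fun do rewrite mulr_sumr.
by apply: iterated_sum => i _; exact: h.
Qed.

Lemma fact_gt0R : 0 < n`!%:R :> R.
Proof. by rewrite ltr0n fact_gt0. Qed.

Lemma partition_function : fine (iint mu n (fun x => ((ens_det n psi x) ^+ 2)%:E)) = n`!%:R.
Proof.
have := iint_iterated averages_to1; rewrite mulr1.
by under eq_fun do rewrite mulr1; move=> ->.
Qed.

Lemma averages_to_expect G v : averages_to G v -> ens_expect mu n psi G = v.
Proof.
move=> h; rewrite /ens_expect partition_function (iint_iterated h)/=.
by rewrite mulrAC divff ?mul1r// gt_eqF// fact_gt0R.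
Qed.

(** [H] need not be measurable or integrable here. The iterated integral is monotone on all
    functions, and two finite bounds exclude infinite values, so [fine] loses nothing. *)
Lemma ens_expect_between G1 v1 H G2 v2 : averages_to G1 v1 -> averages_to G2 v2 ->
  (forall x, G1 x <= H x) -> (forall x, H x <= G2 x) ->
  v1 <= ens_expect mu n psi H <= v2.
Proof.
move=> h1 h2 G1H HG2; rewrite /ens_expect partition_function.
set I := iint mu n (fun x => (_ * H x)%:E).
have l1 : ((n`!%:R * v1)%:E <= I)%E.
  rewrite -(iint_iterated h1); apply: iint_mono => x.
  by rewrite lee_fin ler_wpM2l// sqr_ge0.
have l2 : (I <= (n`!%:R * v2)%:E)%E.
  rewrite -(iint_iterated h2); apply: iint_mono => x.
  by rewrite lee_fin ler_wpM2l// sqr_ge0.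
move: I l1 l2 => [r| |]//=; rewrite !lee_fin => l1 l2.
by rewrite ler_pdivlMr ?fact_gt0R// ler_pdivrMr ?fact_gt0R// ![_ * n`!%:R]mulrC l1.
Qed.

Lemma averages_to_fdet G v :
  iterated mu n (fun x => fdet psin x * (G x * fdet psin x)) (n`!%:R * v) -> averages_to G v.
Proof.
by congr iterated; apply/funext => x; rewrite expr2 mulrAC mulrA.
Qed.

Lemma average_linstat g : moment_fun g ->
  averages_to (linstat n g) (\sum_(a < n) mxelt g a a).
Proof.
move=> mg; apply: averages_to_fdet; rewrite mulr_sumr.
under eq_fun do rewrite linstat_fdet mulr_sumr.
apply: iterated_sum => a _.
have ig (p q : 'I_n) : integ (fun x => psi p x * updf psin a (fun y => g y * psi a y) q x).
  rewrite /updf; case: eqVneq => [_|_]; last exact: int1.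
  by under eq_fun do rewrite mulrCA; exact: mg.
have := andreief ig; rewrite (det_one_column (a := a)).
  rewrite mxE /updf eqxx; congr (iterated _ _ _ (_ * _)).
  by rewrite /mxelt; congr Rintegral; apply/funext => x; rewrite mulrCA.
by move=> i j ja; rewrite mxE /updf (negbTE ja) orth.
Qed.

(** Two replaced columns occur. If they coincide, the column carries [g ^+ 2]; if they differ, a 2
    by 2 minor of the matrix of [g] remains. The minors with [a = b] vanish, so they may be added
    freely to form the full sums. *)
Lemma average_linstat_sqr g : moment_fun g -> moment_fun (fun x => g x ^+ 2) ->
  averages_to (fun x => linstat n g x ^+ 2)
    (\sum_(a < n) mxelt (fun x => g x ^+ 2) a a + (\sum_(a < n) mxelt g a a) ^+ 2 -
     \sum_(a < n) \sum_(b < n) mxelt g a b ^+ 2).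
Proof.
move=> mg mg2; apply: averages_to_fdet.
have -> : \sum_(a < n) mxelt (fun x => g x ^+ 2) a a + (\sum_(a < n) mxelt g a a) ^+ 2 -
     \sum_(a < n) \sum_(b < n) mxelt g a b ^+ 2 =
  \sum_(a < n) \sum_(b < n) (if b == a then mxelt (fun x => g x ^+ 2) a a
     else mxelt g a a * mxelt g b b - mxelt g a b * mxelt g b a).
  rewrite expr2 mulr_suml -addrA -sumrB -big_split; apply: eq_bigr => a _ /=.
  rewrite mulr_sumr -sumrB (bigD1 a)//= [RHS](bigD1 a)//= eqxx expr2 subrr add0r; congr (_ + _).
  by apply: eq_bigr => b /negbTE ->; rewrite expr2 [mxelt g b a]mxelt_sym.
rewrite mulr_sumr; under eq_fun do rewrite expr2 -mulrA linstat_fdet !mulr_sumr.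
apply: iterated_sum => a _; rewrite mulr_sumr.
under eq_fun do rewrite linstat_fdet mulr_sumr.
apply: iterated_sum => b _.
set phi := updf _ a _.
have ig (p q : 'I_n) : integ (fun x => psi p x * updf phi b (fun y => g y * phi b y) q x).
  rewrite /updf /phi /updf; case: eqVneq => [_|_].
    case: eqVneq => _; last by under eq_fun do rewrite mulrCA; exact: mg.
    by under eq_fun do rewrite mulrCA [psi p _ * _]mulrCA mulrA -expr2; exact: mg2.
  case: eqVneq => [_|_]; last exact: int1.
  by under eq_fun do rewrite mulrCA; exact: mg.
have := andreief ig; case: eqVneq => [ba|ba].
  rewrite (det_one_column (a := a)).
    rewrite mxE /phi /updf ba eqxx; congr (iterated _ _ _ (_ * _)).
    rewrite /mxelt; congr Rintegral; apply/funext => x; ring.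
  by move=> i j ja; rewrite mxE /phi /updf ba (negbTE ja) orth.
have ab : a != b by rewrite eq_sym.
rewrite (det_two_columns ab).
  rewrite !mxE /phi /updf eqxx (negbTE ab) (negbTE ba); congr (iterated _ _ _ (_ * (_ * _ - _ * _)));
    rewrite /mxelt ?eqxx; congr Rintegral; apply/funext => x; ring.
by move=> i j ja jb; rewrite mxE /phi /updf (negbTE ja) (negbTE jb) orth.
Qed.

Definition linstat_mean g := \sum_(a < n) mxelt g a a.
(** This is tr(P g^2 P) - tr(P g P g P), with P the projection onto the first [n] functions
    [psi]. *)
Definition linstat_var g :=
  \sum_(a < n) mxelt (fun x => g x ^+ 2) a a - \sum_(a < n) \sum_(b < n) mxelt g a b ^+ 2.

Lemma average_variance g : moment_fun g -> moment_fun (fun x => g x ^+ 2) ->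
  averages_to (fun x => (linstat n g x - linstat_mean g) ^+ 2) (linstat_var g).
Proof.
move=> mg mg2; set m := linstat_mean g.
have := averages_to_lin (- 2 * m) (average_linstat mg)
  (averages_to_add (average_linstat_sqr mg mg2) (averages_to_const (m ^+ 2))).
congr averages_to; first by apply/funext => x; ring.
rewrite /linstat_var -/(linstat_mean g) -/m; ring.
Qed.

Lemma iterated_pair (u v : R -> R) : integ u -> integ v ->
  iterated mu 2 (fun x => u (x 0%N) * v (x 1%N)) (Rint u * Rint v).
Proof.
move=> iu iv; pose g (i : nat) := if i is 0%N then u else v.
have ig i : (i < 2)%N -> integ (g i) by case: i.
have := iterated_prod 1 ig; rewrite mul1r !big_ord_recl big_ord0 mulr1.
by congr iterated; apply/funext => x; rewrite mul1r !big_ord_recl big_ord0 mulr1.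
Qed.

(** The squared Christoffel-Darboux kernel K(x_0, x_1)^2, kept expanded so that every term is a
    product of one-variable functions. *)
Definition kernel2 (x : nat -> R) : R := \sum_(a < n) \sum_(b < n)
  (psi a (x 0%N) * psi b (x 0%N)) * (psi a (x 1%N) * psi b (x 1%N)).

Lemma kernel2_ge0 x : 0 <= kernel2 x.
Proof.
have -> : kernel2 x = (\sum_(a < n) psi a (x 0%N) * psi a (x 1%N)) ^+ 2.
  rewrite expr2 mulr_suml; apply: eq_bigr => a _; rewrite mulr_sumr.
  by apply: eq_bigr => b _; rewrite mulrACA.
exact: sqr_ge0.
Qed.

(** By orthonormality, integrating [kernel2] in one variable leaves the diagonal K(x, x); this
    produces the two [g ^+ 2] terms. The cross term gives the squared entries of [g]. *)
Lemma kernel2_difference g : moment_fun g -> moment_fun (fun x => g x ^+ 2) ->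
  iterated mu 2 (fun x => kernel2 x * (g (x 0%N) - g (x 1%N)) ^+ 2) (2 * linstat_var g).
Proof.
move=> mg mg2.
have -> : 2 * linstat_var g = \sum_(a < n) \sum_(b < n)
    (mxelt (fun x => g x ^+ 2) a b * (a == b)%:R +
     (-2 * (mxelt g a b * mxelt g a b) + (a == b)%:R * mxelt (fun x => g x ^+ 2) a b)).
  rewrite /linstat_var -sumrB mulr_sumr; apply: eq_bigr => a _.
  rewrite big_split big_split/= -mulr_sumr.
  rewrite sum_delta; under [X in _ = _ + (_ + X)]eq_bigr do rewrite mulrC.
  rewrite sum_delta; under [X in _ = _ + (_ * X + _)]eq_bigr do rewrite -expr2.
  ring.
under eq_fun do rewrite /kernel2 mulr_suml.
apply: iterated_sum => a _; under eq_fun do rewrite mulr_suml.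
apply: iterated_sum => b _; pose w x := psi a x * psi b x.
have i1 := iterated_pair (mg2 a b) (int1 a b); have i2 := iterated_pair (mg a b) (mg a b).
have i3 := iterated_pair (int1 a b) (mg2 a b).
have := iterated_add i1 (iterated_lin (-2) i2 i3); rewrite orth -val_eqE.
congr iterated; apply/funext => x /=; ring.
Qed.

Lemma kernel2_diag th : moment_fun th ->
  iterated mu 2 (fun x => kernel2 x * (th (x 0%N) + th (x 1%N))) (2 * \sum_(a < n) mxelt th a a).
Proof.
move=> mth.
have -> : 2 * \sum_(a < n) mxelt th a a = \sum_(a < n) \sum_(b < n)
    (mxelt th a b * (a == b)%:R + (a == b)%:R * mxelt th a b).
  rewrite mulr_sumr; apply: eq_bigr => a _.
  rewrite big_split/= sum_delta; under [X in _ = _ + X]eq_bigr do rewrite mulrC.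
  by rewrite sum_delta; ring.
under eq_fun do rewrite /kernel2 mulr_suml.
apply: iterated_sum => a _; under eq_fun do rewrite mulr_suml.
apply: iterated_sum => b _.
have := iterated_add (iterated_pair (mth a b) (int1 a b)) (iterated_pair (int1 a b) (mth a b)).
rewrite orth -val_eqE; congr iterated; apply/funext => x /=; ring.
Qed.

Lemma linstat_var_le g q th c : moment_fun g -> moment_fun (fun x => g x ^+ 2) ->
  moment_fun q -> moment_fun (fun x => q x ^+ 2) -> moment_fun th ->
  (forall x y, (g x - g y) ^+ 2 <= c * (q x - q y) ^+ 2 + (th x + th y)) ->
  linstat_var g <= c * linstat_var q + \sum_(a < n) mxelt th a a.
Proof.
move=> mg mg2 mq mq2 mth h.
have hg := kernel2_difference mg mg2.
have hq := iterated_lin c (kernel2_difference mq mq2) (kernel2_diag mth).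
suff : 2 * linstat_var g <= c * (2 * linstat_var q) + 2 * \sum_(a < n) mxelt th a a by lra.
rewrite -lee_fin -(iint_iterated hg) -(iint_iterated hq); apply: iint_mono => x.
rewrite lee_fin (le_trans (ler_wpM2l (kernel2_ge0 x) (h (x 0%N) (x 1%N))))//.
by rewrite le_eqVlt; apply/orP; left; apply/eqP; ring.
Qed.

Lemma average_moment (F : nat -> nat -> R) B g m :
  (forall j x, g x * psi j x = \sum_(k < j + B + 1) F j k * psi k x) ->
  averages_to (fun x => (linstat n g x - \sum_(a < n) F a a) ^+ m)
    (vacuum_moment B F m (@nat_of_ord n)).
Proof.
move=> hF; set c := \sum_(a < n) F a a.
(* One factor of the power is applied to the right-hand determinant and changes its column labels,
   so the induction has to run over all [t]. *)
suff H : forall t : 'I_n -> nat,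
    iterated mu n (fun x => fdet psin x * ((linstat n g x - c) ^+ m * fdet (fun a => psi (t a)) x))
      (n`!%:R * vacuum_moment B F m t).
  by apply: averages_to_fdet; exact: H.
elim: m => [|m IH] t /=.
  have := @andreief _ mu n psin (fun a => psi (t a)) (fun a b => int1 a (t b)).
  rewrite (_ : \matrix_(a, b) _ = \matrix_(a < n, b < n) ((a : nat) == t b)%:R); last first.
    by apply/matrixP => a b; rewrite !mxE orth.
  by congr iterated; apply/funext => x; rewrite expr0 mul1r.
have hs := iterated_lin (- c) (IH t) (iterated_sum (index_enum 'I_n) (P := xpredT)
   (fun a _ => iterated_sum (index_enum 'I_(t a + B + 1)) (P := xpredT)
     (fun k _ => iterated_scale (F (t a) k) (IH (upd t a k))))).
move: hs; congr iterated.
  apply/funext => x; rewrite exprSr -!mulrA [(_ - c) * _]mulrBl linstat_fdet.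
  rewrite mulrBr mulrBr addrC; congr (_ + _); last by ring.
  rewrite !mulr_sumr; apply: eq_bigr => a _.
  have -> : updf (fun b => psi (t b)) a (fun y => g y * psi (t a) y) =
            updf (fun b => psi (t b)) a (fun y => \sum_(k < t a + B + 1) F (t a) k * psi k y).
    by congr updf; apply/funext => y; rewrite hF.
  rewrite fdet_updf_sum !mulr_sumr; apply: eq_bigr => k _.
  have -> : updf (fun b => psi (t b)) a (psi k) = fun b => psi (upd t a k b).
    by apply/funext => b; rewrite /updf /upd; case: eqP.
  by ring.
rewrite /centered_dop -/c mulNr addrC mulrBr; congr (_ - _); last by ring.
rewrite /dop mulr_sumr; apply: eq_bigr => a _; rewrite mulr_sumr.
by apply: eq_bigr => k _; rewrite mulrCA.
Qed.

End Ensemble.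

(** * Integrability, and matrices of multiplication operators under the recurrence *)

Section Admissible.
Variable R : realType.

(** A class stable under sums and products whose members are integrable both against [psi j * psi k]
    and against the Gaussian density. *)
Definition admissible (u : R -> R) :=
  measurable_fun setT u /\ exists r : {poly R}, forall x, `|u x| <= r.[x].

Lemma admissible_poly (r : {poly R}) : admissible (fun x => r.[x]).
Proof.
split; first by apply: continuous_measurable_fun; exact: continuous_horner.
exists (1 + r ^+ 2) => x; rewrite !hornerE ler_norml.
set y := r.[x]; have := sqr_ge0 (y - 1); have := sqr_ge0 (y + 1); have := sqr_ge0 y; rewrite !expr2; nra.
Qed.

Lemma admissibleD u v : admissible u -> admissible v -> admissible (fun x => u x + v x).
Proof.
move=> [mu1 [r hr]] [mv [r' hr']]; split; first exact: measurable_funD.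
exists (r + r') => x; rewrite hornerE (le_trans (ler_normD _ _))// lerD//.
Qed.

Lemma admissibleM u v : admissible u -> admissible v -> admissible (fun x => u x * v x).
Proof.
move=> [mu1 [r hr]] [mv [r' hr']]; split; first exact: measurable_funM.
by exists (r * r') => x; rewrite hornerE normrM ler_pM.
Qed.

Lemma admissible_sqr u : admissible u -> admissible (fun x => u x ^+ 2).
Proof. by move=> h; have := admissibleM h h; congr admissible; apply/funext => x; rewrite expr2. Qed.

Lemma admissible_indic (A : set R) : measurable A -> admissible (\1_A : R -> R).
Proof.
move=> mA; split; first exact: measurable_indic.
by exists 1 => x; rewrite hornerE indicE; case: (_ \in _); rewrite ?normr1 ?normr0.
Qed.

End Admissible.

Section Recurrence.
Variables (R : realType) (mu : {measure set R -> \bar R}) (psi : nat -> R -> R).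
Local Notation integ g := (mu.-integrable setT (EFin \o g)).
Local Notation Rint g := (Rintegral mu setT g).
Variables (b : nat) (J : nat -> nat -> R).
Hypothesis int1 : forall j k, integ (fun x => psi j x * psi k x).
Hypothesis orth : forall j k, Rint (fun x => psi j x * psi k x) = (j == k)%:R.
Hypothesis Jband : forall j k, (b < absz (j%:Z - k%:Z))%N -> J j k = 0.
Hypothesis Jrec : forall j x, x * psi j x = \sum_(k < j + b + 1) J j k * psi k x.
Local Notation mxelt := (mxelt mu psi).
Local Notation moment_fun := (moment_fun mu psi).

Definition in_span (N : nat) (f : R -> R) :=
  exists c : nat -> R, forall x, f x = \sum_(k < N) c k * psi k x.

Lemma in_span_mono M N f : (M <= N)%N -> in_span M f -> in_span N f.
Proof.
move=> MN [c hc]; exists (fun k => if (k < M)%N then c k else 0) => x.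
rewrite hc -(sum_ord_widen (h := fun k => (if (k < M)%N then c k else 0) * psi k x) MN).
  by apply: eq_bigr => k _; rewrite ltn_ord.
by move=> k; rewrite ltnNge => ->; rewrite mul0r.
Qed.

Lemma in_span_sum M N (c : 'I_M -> R) (f : 'I_M -> R -> R) :
  (forall i, in_span N (f i)) -> in_span N (fun x => \sum_(i < M) c i * f i x).
Proof.
move=> /choice[d hd]; exists (fun k => \sum_(i < M) c i * d i k) => x.
under eq_bigr do rewrite hd mulr_sumr.
rewrite exchange_big; apply: eq_bigr => k _ /=; rewrite mulr_suml.
by apply: eq_bigr => i _; rewrite mulrA.
Qed.

Lemma in_span_Xn i j : in_span (j + b * i + 1) (fun x => x ^+ i * psi j x).
Proof.
elim: i j => [|i IH] j.
  apply: (in_span_mono (M := j.+1)); first by lia.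
  exists (fun k => (k == j)%:R) => x; rewrite expr0 mul1r big_ord_recr/= eqxx mul1r.
  by rewrite big1 ?add0r// => k _; rewrite ltn_eqF ?mul0r//.
have -> : (fun x => x ^+ i.+1 * psi j x) =
          (fun x => \sum_(k < j + b + 1) J j k * (x ^+ i * psi k x)).
  apply/funext => x; rewrite exprSr -mulrA Jrec mulr_sumr.
  by apply: eq_bigr => k _; rewrite mulrCA.
apply: in_span_sum => k; apply: in_span_mono (IH k).
by have := ltn_ord k; lia.
Qed.

Lemma in_span_poly (r : {poly R}) j : in_span (j + b * size r + 1) (fun x => r.[x] * psi j x).
Proof.
have -> : (fun x => r.[x] * psi j x) = (fun x => \sum_(i < size r) r`_i * (x ^+ i * psi j x)).
  apply/funext => x; rewrite horner_coef mulr_suml.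
  by apply: eq_bigr => i _; rewrite mulrA.
apply: in_span_sum => i; apply: in_span_mono (in_span_Xn i j).
by rewrite leq_add2r leq_add2l leq_mul2l (ltnW (ltn_ord i)) orbT.
Qed.

Lemma integrable_ordsum N (f : 'I_N -> R -> R) :
  (forall i, integ (f i)) -> integ (fun x => \sum_(i < N) f i x).
Proof.
move=> hf; have := @integrable_sum _ _ _ mu setT measurableT _ (index_enum 'I_N) xpredT
  (fun i => EFin \o f i) (fun i _ => hf i).
by congr integrable; apply/funext => x /=; rewrite sumEFin.
Qed.

Lemma Rintegral_ordsum N (f : 'I_N -> R -> R) : (forall i, integ (f i)) ->
  Rint (fun x => \sum_(i < N) f i x) = \sum_(i < N) Rint (f i).
Proof.
elim: N f => [|N IH] f hf.
  under eq_fun do rewrite big_ord0; rewrite big_ord0.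
  by rewrite Rintegral_cst// mul0r.
under eq_fun do rewrite big_ord_recr; rewrite big_ord_recr/= RintegralD//.
  by rewrite (IH (fun i => f (widen_ord (leqnSn N) i)))// => i; exact: hf.
by apply: integrable_ordsum => i; exact: hf.
Qed.

(** The recurrence writes [r * psi j] as a finite combination of the [psi l], which reduces
    polynomial moments to the integrability of the products [psi l * psi k]. *)
Lemma moment_poly (r : {poly R}) : moment_fun (fun x => r.[x]).
Proof.
move=> j k; have [c hc] := in_span_poly r j.
have -> : (fun x => r.[x] * (psi j x * psi k x)) =
    (fun x => \sum_(l < j + b * size r + 1) c l * (psi l x * psi k x)).
  apply/funext => x; rewrite mulrA hc mulr_suml.
  by apply: eq_bigr => l _; rewrite mulrA.
by apply: integrable_ordsum => l; exact: integrable_scale.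
Qed.

Lemma moment_admissible u : admissible u -> moment_fun u.
Proof.
move=> [mu1 [r hr]] j k.
apply: (le_integrable measurableT _ _ (moment_poly r j k)).
  apply/measurable_EFinP; apply: measurable_funM => //.
  by apply/measurable_EFinP; exact: measurable_int (int1 j k).
move=> x _ /=; rewrite lee_fin !normrM; apply: ler_wpM2r; first by rewrite mulr_ge0.
by apply: le_trans (hr x) _; exact: ler_norm.
Qed.

Lemma mxelt_lin (c : R) (u v : R -> R) j k : moment_fun u -> moment_fun v ->
  mxelt (fun x => c * u x + v x) j k = c * mxelt u j k + mxelt v j k.
Proof.
move=> mu1 mv; rewrite /mxelt -RintegralZl// -RintegralD//.
  by apply: eq_Rintegral => x _; ring.
exact: integrable_scale.
Qed.

(** The recurrence gives some coefficients and orthonormality identifies them. The identity holds at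
    every point, as needed for manipulating columns of a determinant pointwise. *)
Lemma poly_expansion (r : {poly R}) j N : (j + b * size r < N)%N ->
  forall x, r.[x] * psi j x = \sum_(k < N) mxelt (fun x => r.[x]) j k * psi k x.
Proof.
move=> jN x; have [c hc] : in_span N (fun x => r.[x] * psi j x).
  by apply: in_span_mono (in_span_poly r j); lia.
rewrite hc; apply: eq_bigr => k _; congr (_ * _); rewrite /mxelt.
have -> : (fun x => r.[x] * (psi j x * psi k x)) =
    (fun x => \sum_(l < N) c l * (psi l x * psi k x)).
  apply/funext => y; rewrite mulrA hc mulr_suml.
  by apply: eq_bigr => l _; rewrite mulrA.
rewrite Rintegral_ordsum => [|l]; last exact: integrable_scale.
under eq_bigr => l _ do rewrite RintegralZl// orth.
rewrite (bigD1 k)//= eqxx mulr1 big1 ?addr0// => l /negbTE lk.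
by rewrite -val_eqE in lk; rewrite lk mulr0.
Qed.

Lemma banded_mxelt (r : {poly R}) B : (b * size r <= B)%N -> banded B (mxelt (fun x => r.[x])).
Proof.
move=> rB; suff H j k : (j + B < k)%N -> mxelt (fun x => r.[x]) j k = 0.
  by move=> j k /orP[|] h; [|rewrite mxelt_sym]; exact: H.
move=> jk; rewrite /mxelt.
have -> : (fun x => r.[x] * (psi j x * psi k x)) =
   (fun x => \sum_(l < j + b * size r + 1) mxelt (fun x => r.[x]) j l * (psi l x * psi k x)).
  apply/funext => y; rewrite mulrA (@poly_expansion _ _ (j + b * size r + 1)) ?addn1// mulr_suml.
  by apply: eq_bigr => l _; rewrite mulrA.
rewrite Rintegral_ordsum => [|l]; last exact: integrable_scale.
rewrite big1// => l _; rewrite RintegralZl// orth ltn_eqF ?mulr0//.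
by have := ltn_ord l; lia.
Qed.

(** Exact without any completeness of the system, because the polynomial factor keeps [psi j] in a
    finite span; the other factor is arbitrary. *)
Lemma mxelt_mul (r1 : {poly R}) (u : R -> R) j k N : (j + b * size r1 < N)%N -> moment_fun u ->
  mxelt (fun x => r1.[x] * u x) j k = \sum_(l < N) mxelt (fun x => r1.[x]) j l * mxelt u l k.
Proof.
move=> jN mu1; rewrite {1}/mxelt.
have -> : (fun x => r1.[x] * u x * (psi j x * psi k x)) =
   (fun x => \sum_(l < N) mxelt (fun x => r1.[x]) j l * (u x * (psi l x * psi k x))).
  apply/funext => y; have -> : r1.[y] * u y * (psi j y * psi k y) =
    (r1.[y] * psi j y) * (u y * psi k y) by ring.
  rewrite (poly_expansion jN) mulr_suml; apply: eq_bigr => l _; ring.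
rewrite Rintegral_ordsum => [|l]; last exact: integrable_scale.
by apply: eq_bigr => l _; rewrite RintegralZl.
Qed.

Lemma mxelt_X j k : mxelt (fun x => 'X.[x]) j k = J j k.
Proof.
rewrite /mxelt; have -> : (fun x => 'X.[x] * (psi j x * psi k x)) =
   (fun x => \sum_(l < j + b + 1) J j l * (psi l x * psi k x)).
  apply/funext => y; rewrite hornerX mulrA Jrec mulr_suml.
  by apply: eq_bigr => l _; rewrite mulrA.
rewrite Rintegral_ordsum => [|l]; last exact: integrable_scale.
under eq_bigr => l _ do rewrite RintegralZl// orth.
have [jk|kj] := ltnP k (j + b + 1).
  rewrite (bigD1 (Ordinal jk))//= eqxx mulr1 big1 ?addr0// => l /negbTE lk.
  by rewrite -val_eqE/= in lk; rewrite lk mulr0.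
rewrite Jband; last by lia.
by rewrite big1// => l _; rewrite ltn_eqF ?mulr0// (leq_trans (ltn_ord l)).
Qed.

Lemma mxelt_Xn i j k : mxelt (fun x => x ^+ i) j k = bpow b J i j k.
Proof.
have mX m : moment_fun (fun x => x ^+ m).
  by have := moment_poly 'X^m; congr moment_fun; apply/funext => x; rewrite hornerXn.
elim: i j => [|i IH] j.
  by rewrite /= -orth /mxelt; apply: eq_Rintegral => x _; rewrite expr0 mul1r.
transitivity (mxelt (fun x => 'X.[x] * x ^+ i) j k).
  by rewrite /mxelt; apply: eq_Rintegral => x _; rewrite hornerX exprS.
rewrite (@mxelt_mul _ _ _ _ (j + b * 2 + 1))//; last by rewrite size_polyX addn1.
under eq_bigr => l _ do rewrite mxelt_X IH.
rewrite -(sum_ord_widen (h := fun l => J j l * bpow b J i l k) (M := j + b + 1))//; first by lia.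
by move=> l hl; rewrite Jband ?mul0r//; lia.
Qed.

Lemma mxelt_poly (Q : {poly R}) j k : mxelt (fun x => Q.[x]) j k = polyJ b Q J j k.
Proof.
have mX m : moment_fun (fun x => x ^+ m).
  by have := moment_poly 'X^m; congr moment_fun; apply/funext => x; rewrite hornerXn.
rewrite /polyJ /mxelt.
have -> : (fun x => Q.[x] * (psi j x * psi k x)) =
   (fun x => \sum_(i < size Q) Q`_i * (x ^+ i * (psi j x * psi k x))).
  apply/funext => y; rewrite horner_coef mulr_suml.
  by apply: eq_bigr => i _; rewrite mulrA.
rewrite Rintegral_ordsum => [|l]; last by apply: integrable_scale; exact: mX.
by apply: eq_bigr => l _; rewrite RintegralZl -?mxelt_Xn//; exact: mX.
Qed.

Lemma average_poly_moment n (r : {poly R}) B m : (b * size r <= B)%N ->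
  averages_to mu psi n (fun x => (linstat n (fun y => r.[y]) x -
      linstat_mean mu psi n (fun y => r.[y])) ^+ m)
    (vacuum_moment B (mxelt (fun y => r.[y])) m (@nat_of_ord n)).
Proof.
move=> rB; apply: average_moment => // j x; apply: poly_expansion; lia.
Qed.

End Recurrence.

(** * Right limits that are Laurent matrices, their products and powers *)

Section LaurentLimits.
Variables (R : realType) (Nn : nat -> nat).
Hypothesis leNn : forall j, (j <= Nn j)%N.
Implicit Types (F G : nat -> nat -> nat -> R) (u w : int -> R).

Definition laurent_limit F u :=
  forall r t : int, (fun j => shifted (F j) (Nn j) r t) @ \oo --> u (r - t).

Lemma cvg_ordsum N (f : 'I_N -> nat -> R) (l : 'I_N -> R) :
  (forall i, f i @ \oo --> l i) -> (fun j => \sum_(i < N) f i j) @ \oo --> \sum_(i < N) l i.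
Proof.
elim: N f l => [|N IH] f l fl.
  under eq_fun do rewrite big_ord0; rewrite big_ord0; exact: cvg_cst.
under eq_fun do rewrite big_ord_recr; rewrite big_ord_recr.
by apply: cvgD; [exact: (IH (fun i => f (widen_ord (leqnSn N) i)))|exact: fl].
Qed.

(** Only [2 * r] rows and columns are near the edge, so entrywise convergence is uniform there. *)
Lemma near_laurent_eventually F u : laurent_limit F u -> forall r eps, 0 < eps ->
  \forall j \near \oo, near_laurent u (Nn j) (F j) r eps.
Proof.
move=> Fu r eps e0.
have H : \forall j \near \oo, forall i k : 'I_(2 * r),
    `|shifted (F j) (Nn j) (i%:Z - r%:Z) (k%:Z - r%:Z) - u (i%:Z - k%:Z)| <= eps.
  apply: filter_forall => i; apply: filter_forall => k.
  have := Fu (i%:Z - r%:Z) (k%:Z - r%:Z).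
  have -> : (i%:Z - r%:Z - (k%:Z - r%:Z) = i%:Z - k%:Z)%R by lia.
  move=> /cvgrPdist_le /(_ _ e0); apply: filterS => j; by rewrite distrC.
near=> j; move=> x y; rewrite /near_edge => hx hy.
have rj : (r <= Nn j)%N by apply: leq_trans (leNn j); near: j; exists r.
have xi : (x + r - Nn j < 2 * r)%N by lia.
have yi : (y + r - Nn j < 2 * r)%N by lia.
have Hj : forall i k : 'I_(2 * r),
    `|shifted (F j) (Nn j) (i%:Z - r%:Z) (k%:Z - r%:Z) - u (i%:Z - k%:Z)| <= eps by near: j.
have := Hj (Ordinal xi) (Ordinal yi); rewrite /shifted /=.
have -> : absz ((Nn j)%:Z + ((x + r - Nn j)%N%:Z - r%:Z)) = x by lia.
have -> : absz ((Nn j)%:Z + ((y + r - Nn j)%N%:Z - r%:Z)) = y by lia.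
by have -> : ((x + r - Nn j)%N%:Z - (y + r - Nn j)%N%:Z = x%:Z - y%:Z)%R by lia.
Unshelve. all: by end_near. Qed.

(** Convolution of symbol coefficients, with the offsets of [u] restricted to -B, ..., B. *)
Definition laurent_mul (B : nat) (u w : int -> R) (d : int) : R :=
  \sum_(e < 2 * B + 1) u (e%:Z - B%:Z) * w (d - (e%:Z - B%:Z)).

Lemma laurent_limit_mul B F G H u w : (forall j, banded B (F j)) ->
  (forall j x y, H j x y = \sum_(l < x + B + 1) F j x l * G j l y) ->
  laurent_limit F u -> laurent_limit G w -> laurent_limit H (laurent_mul B u w).
Proof.
move=> bF HE Fu Gw r t.
have hc : (fun j => \sum_(e < 2 * B + 1) shifted (F j) (Nn j) r (r - (e%:Z - B%:Z)) *
   shifted (G j) (Nn j) (r - (e%:Z - B%:Z)) t) @ \oo --> laurent_mul B u w (r - t).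
  apply: cvg_ordsum => e.
  have -> : u (e%:Z - B%:Z) = u (r - (r - (e%:Z - B%:Z))) by congr u; lia.
  have -> : r - t - (e%:Z - B%:Z) = r - (e%:Z - B%:Z) - t by lia.
  by apply: cvgM.
apply: cvg_trans hc; apply: near_eq_cvg; near=> j.
have big : (absz r + B < Nn j)%N.
  by apply: leq_trans (leNn j); near: j; exists (absz r + B).+1.
rewrite /shifted HE; set x := absz _.
have xE : x%:Z = (Nn j)%:Z + r by rewrite /x; lia.
clearbody x.
pose h l := F j x l * G j l (absz ((Nn j)%:Z + t)).
have Bx : (B < x)%N by lia.
have -> : \sum_(l < x + B + 1) F j x l * G j l (absz ((Nn j)%:Z + t)) =
          \sum_(e < 2 * B + 1) h (x + B - e)%N.
  rewrite (reindex_inj rev_ord_inj)/=.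
  rewrite (sum_ord_widen (h := fun e => h (x + B - e)%N) (N := x + B + 1)).
  - by apply: eq_bigr => e _; rewrite /h; have -> : (x + B + 1 - e.+1 = x + B - e)%N by lia.
  - lia.
  - move=> k hk; rewrite /h bF ?mul0r//; apply/orP; right; lia.
apply: eq_bigr => e _; rewrite /h; have := ltn_ord e => ee.
by have -> : absz ((Nn j)%:Z + (r - (e%:Z - B%:Z))) = (x + B - e)%N by lia.
Unshelve. all: by end_near. Qed.

Lemma laurent_limit_sym F u : (forall j x y, F j x y = F j y x) ->
  laurent_limit F u -> forall d, u (- d) = u d.
Proof.
move=> Fs Fu d; have h1 := Fu d 0; have := Fu 0 d; rewrite sub0r.
have -> : (fun j => shifted (F j) (Nn j) 0 d) = (fun j => shifted (F j) (Nn j) d 0).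
  by apply/funext => j; rewrite /shifted Fs.
rewrite subr0 in h1; move=> h2.
exact: cvg_unique h2 h1.
Qed.

Lemma laurent_limit_sum M (F : 'I_M -> nat -> nat -> nat -> R)
    (u : 'I_M -> int -> R) (c : 'I_M -> R) :
  (forall i, laurent_limit (F i) (u i)) ->
  laurent_limit (fun j x y => \sum_(i < M) c i * F i j x y) (fun d => \sum_(i < M) c i * u i d).
Proof.
move=> h r t; apply: cvg_ordsum => i; apply: cvgM; [exact: cvg_cst|exact: h].
Qed.

Lemma laurent_limit1 (F : nat -> nat -> nat -> R) : (forall j x y, F j x y = (x == y)%:R) ->
  laurent_limit F (fun d => (d == 0)%:R).
Proof.
move=> FE r t; apply: cvg_near_cst; near=> j.
have big : (absz r + absz t <= Nn j)%N.
  by apply: leq_trans (leNn j); near: j; exists (absz r + absz t)%N.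
by rewrite /shifted FE; congr (_%:R); congr nat_of_bool; apply/eqP/eqP; lia.
Unshelve. all: by end_near. Qed.

End LaurentLimits.

Section LaurentPowers.
Variables (R : realType) (B : nat) (s : int -> R).

Fixpoint laurent_pow (i : nat) : int -> R :=
  if i is i'.+1 then laurent_mul B s (laurent_pow i') else fun d => (d == 0)%:R.

Definition laurent_poly (p : {poly R}) (d : int) : R := \sum_(i < size p) p`_i * laurent_pow i d.

Lemma laurent_pow_supp i d : (i * B < absz d)%N -> laurent_pow i d = 0.
Proof.
elim: i d => [|i IH] d /=; first by case: eqP => // ->.
by move=> hd; apply: big1 => e _; rewrite IH ?mulr0//; have := ltn_ord e; lia.
Qed.

Lemma laurent_poly_supp (p : {poly R}) d : (size p * B < absz d)%N -> laurent_poly p d = 0.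
Proof.
move=> hd; apply: big1 => i _; rewrite laurent_pow_supp ?mulr0//.
by apply: leq_ltn_trans hd; rewrite leq_mul2r (ltnW (ltn_ord i)) orbT.
Qed.

(** There are m + 1 pairs (c, i) with c + i = m; this count is the weight. *)
Lemma laurent_variance_sum (u : int -> R) M : (forall d, (M < absz d)%N -> u d = 0) ->
  laurent_variance M u = \sum_(l < M) l.+1%:R * (u (- l.+1%:Z) * u l.+1%:Z).
Proof.
move=> u0; rewrite /laurent_variance.
pose h m := u (- m.+1%:Z) * u m.+1%:Z.
transitivity (\sum_(c < M) \sum_(m < M) (c <= m)%N%:R * h m).
  apply: eq_bigr => c _; have cM := ltn_ord c.
  rewrite -(big_mkord xpredT (fun m => (c <= m)%N%:R * h m)) (big_cat_nat (n := c))/=; [|lia|lia].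
  rewrite big_nat_cond [X in X + _]big1 ?add0r; last by move=> i; rewrite andbT => /andP[_ ic]; rewrite leqNgt ic mul0r.
  have -> : \sum_(c <= i < M) (c <= i)%N%:R * h i =
      \sum_(i < M - c) (c <= i + c)%N%:R * h (i + c)%N.
    by rewrite -{1}[nat_of_ord c]add0n big_addn big_mkord.
  rewrite (sum_ord_widen (h := fun i => (c <= i + c)%N%:R * h (i + c)%N) (N := M.+1)).
  - apply: eq_bigr => i _; rewrite leq_addl mul1r /h addnC.
    by congr (u _ * u _); lia.
  - lia.
  - by move=> k hk; rewrite /h u0 ?mul0r ?mulr0//; lia.
rewrite exchange_big; apply: eq_bigr => m _ /=; rewrite -mulr_suml; congr (_ * _).
rewrite -natr_sum; congr (_%:R).
have mM := ltn_ord m.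
rewrite -(big_mkord xpredT (fun i => (i <= m)%N : nat)) (big_cat_nat (n := m.+1))//=.
rewrite [X in (_ + X)%N]big_nat_cond [X in (_ + X)%N]big1 ?addn0.
  rewrite big_nat_cond (eq_bigr (fun=> 1%N)); first by rewrite -big_nat_cond sum_nat_const_nat subn0 muln1.
  by move=> i; rewrite andbT => /andP[_ im]; rewrite -ltnS im.
by move=> i; rewrite andbT => /andP[im _]; rewrite leqNgt im.
Qed.

End LaurentPowers.

Fixpoint gaussian_moment (R : pzSemiRingType) (v : R) (m : nat) : R :=
  match m with
  | 0 => 1
  | 1 => 0
  | m'.+2 => m'.+1%:R * v * gaussian_moment v m'
  end.

Lemma int_support_bounded (R : realType) (u : int -> R) M :
  (forall d, (M < absz d)%N -> u d = 0) -> exists S, forall d, `|u d| <= S.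
Proof.
move=> u0; exists (\sum_(i < 2 * M + 1) `|u (i%:Z - M%:Z)|) => d.
have [dM|dM] := ltnP M (absz d); first by rewrite u0// normr0 sumr_ge0.
have dlt : (absz (d + M%:Z)%R < 2 * M + 1)%N by lia.
rewrite (bigD1 (Ordinal dlt))//=.
have -> : (absz (d + M%:Z))%:Z - M%:Z = d by lia.
by rewrite lerDl sumr_ge0.
Qed.

(** * Fourier coefficients of functions of the symbol *)

Section TrigonometricMeans.
Variable R : realType.
Implicit Types (G H : R -> R).
Local Notation I2pi := (`[0, 2 * pi]%classic).

Definition circle_mean H : R := (2 * pi)^-1 * Rintegral lebesgue_measure I2pi H.

Lemma circle_integrable H : continuous H -> lebesgue_measure.-integrable I2pi (EFin \o H).
Proof.
move=> cH; apply: continuous_compact_integrable; first exact: segment_compact.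
exact: continuous_subspaceT.
Qed.

Lemma circle_mean_lin c G H : continuous G -> continuous H ->
  circle_mean (fun t => c * G t + H t) = c * circle_mean G + circle_mean H.
Proof.
move=> cG cH; rewrite /circle_mean RintegralD//; last 2 first.
- by apply: circle_integrable => x; apply: cvgM; [exact: cvg_cst|exact: cG].
- exact: circle_integrable.
by rewrite RintegralZl//; [ring|exact: circle_integrable].
Qed.

Lemma continuous_ordsum N (F : 'I_N -> R -> R) : (forall i, continuous (F i)) ->
  continuous (fun t => \sum_(i < N) F i t).
Proof.
elim: N F => [|N IH] F cF x.
  under eq_fun do rewrite big_ord0; exact: cvg_cst.
under eq_fun do rewrite big_ord_recr.
by apply: cvgD; [exact: (IH (fun i => F (widen_ord (leqnSn N) i)))|exact: cF].
Qed.

Lemma circle_mean_sum N (c : 'I_N -> R) (F : 'I_N -> R -> R) : (forall i, continuous (F i)) ->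
  circle_mean (fun t => \sum_(i < N) c i * F i t) = \sum_(i < N) c i * circle_mean (F i).
Proof.
elim: N c F => [|N IH] c F cF.
  under eq_fun do rewrite big_ord0; rewrite big_ord0 /circle_mean.
  by rewrite Rintegral_cst// mul0r mulr0.
under eq_fun do rewrite big_ord_recr/= addrC; rewrite big_ord_recr/= addrC.
rewrite circle_mean_lin//; last first.
  apply: continuous_ordsum => i x; apply: cvgM; [exact: cvg_cst|exact: cF].
by rewrite (IH (fun i => c (widen_ord (leqnSn N) i)) (fun i => F (widen_ord (leqnSn N) i)))// => i.
Qed.

Lemma pi2_gt0 : 0 < 2 * pi :> R.
Proof. by rewrite mulr_gt0// pi_gt0. Qed.

Lemma circle_mean_cst c : circle_mean (fun=> c) = c.
Proof.
have len : lebesgue_measure (`[0, 2 * pi]%classic : set R) = (2 * pi)%:E.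
  by rewrite lebesgue_measure_itv/= lte_fin pi2_gt0 -EFinB subr0.
rewrite /circle_mean Rintegral_cst// [X in fine X]len /=.
by rewrite mulrC mulfK// gt_eqF// pi2_gt0.
Qed.

Lemma circle_mean_le H c : continuous H -> (forall t, H t <= c) -> circle_mean H <= c.
Proof.
move=> cH Hc; rewrite -[leRHS](circle_mean_cst c) /circle_mean.
rewrite ler_pM2l ?invr_gt0 ?pi2_gt0//; apply: le_Rintegral => //.
  exact: circle_integrable.
by apply: circle_integrable => x; exact: cvg_cst.
Qed.

Lemma circle_mean_norm H c : continuous H -> (forall t, `|H t| <= c) -> `|circle_mean H| <= c.
Proof.
move=> cH Hc; rewrite ler_norml; apply/andP; split.
  have cN : continuous (fun t => -1 * H t).
    by move=> x; apply: cvgM; [exact: cvg_cst|exact: cH].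
  have := @circle_mean_le (fun t => -1 * H t + 0) c.
  rewrite circle_mean_lin//; last by move=> x; exact: cvg_cst.
  rewrite circle_mean_cst => h; suff : -1 * circle_mean H + 0 <= c by lra.
  apply: h => [x|t]; first by apply: cvgD; [exact: cN|exact: cvg_cst].
  by have := Hc t; rewrite ler_norml => /andP[]; lra.
apply: circle_mean_le => // t; exact: le_trans (ler_norm _) (Hc t).
Qed.

Lemma continuous_wave (k ph : R) : continuous (fun t => cos (k * t + ph)).
Proof.
move=> x; apply: continuous_comp; last exact: continuous_cos.
by apply: cvgD; [apply: cvgM; [exact: cvg_cst|exact: cvg_id]|exact: cvg_cst].
Qed.

Lemma sin_period (k : int) (x : R) : sin (k%:~R * (2 * pi) + x) = sin x.
Proof.
have e : 2 * pi = pi *+ 2 :> R by rewrite mulr_natl.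
have P n y : sin (n%:R * (2 * pi) + y) = sin y :> R.
  by rewrite addrC e mulr_natl (periodicn (@sinD2pi R)).
case: k => n; first exact: P.
by rewrite NegzE mulrNz mulNr -[LHS](P n.+1) addrA subrr add0r.
Qed.

Lemma is_derive_affine (k ph x : R) : is_derive x 1 (fun t => k * t + ph) k.
Proof.
have h : is_derive x 1 ((k \*: id) + cst ph) (k *: 1 + 0).
  by apply: is_deriveD; apply: is_deriveZ.
by apply: is_derive_eq; rewrite ?addr0 /GRing.scale/= mulr1.
Qed.

Lemma FTC_is_derive (f F : R -> R) (a b : R) : a < b -> (forall x : R, is_derive x 1 F (f x)) ->
  continuous f -> Rintegral lebesgue_measure `[a, b] f = F b - F a.
Proof.
move=> ab dF cf; have dF1 x : derivable F x 1 by have [] := dF x.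
have cF x : {for x, continuous F}.
  by apply: differentiable_continuous; apply/derivable1_diffP.
rewrite /Rintegral (@continuous_FTC2 _ _ F)//.
- exact: continuous_subspaceT.
- split; [by []|apply: cvg_at_right_filter; exact: cF|apply: cvg_at_left_filter; exact: cF].
- by move=> x _; rewrite derive1E; case: (dF x).
Qed.

Lemma circle_mean_wave (k : int) ph :
  circle_mean (fun t => cos (k%:~R * t + ph)) = (k == 0)%:R * cos ph.
Proof.
have [->|k0] := eqVneq k 0.
  by under eq_fun do rewrite mul0r add0r; rewrite circle_mean_cst mul1r.
rewrite mul0r /circle_mean.
have kn : k%:~R != 0 :> R by rewrite intr_eq0.
pose F t := (k%:~R)^-1 * sin (k%:~R * t + ph) : R.
have dF (x : R) : is_derive x 1 F (cos (k%:~R * x + ph)).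
  have hs := @is_derive1_comp R sin (fun t => k%:~R * t + ph) x _ _
    (is_derive_sin (k%:~R * x + ph)) (is_derive_affine k%:~R ph x).
  have h := is_deriveZ (k%:~R)^-1 hs.
  apply: is_derive_eq h _.
  by rewrite /GRing.scale/= mulrC mulfK.
rewrite (FTC_is_derive pi2_gt0 dF); last exact: continuous_wave.
by rewrite /F mulr0 sin_period add0r subrr mulr0.
Qed.

(** The phase handles both parts of a Fourier coefficient at once: [0] gives the cosine integral,
    [- (pi / 2)] the sine integral. *)
Definition wave_mean G (k : int) ph := circle_mean (fun t => G t * cos (k%:~R * t + ph)).

Lemma continuous_mul G H : continuous G -> continuous H -> continuous (fun t => G t * H t).
Proof. by move=> cG cH x; apply: cvgM; [exact: cG|exact: cH]. Qed.

Lemma continuous_mul_wave G (k ph : R) : continuous G -> continuous (fun t => G t * cos (k * t + ph)).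
Proof. by move=> cG; apply: continuous_mul => //; exact: continuous_wave. Qed.

Lemma wave_mean_lin c G H k ph : continuous G -> continuous H ->
  wave_mean (fun t => c * G t + H t) k ph = c * wave_mean G k ph + wave_mean H k ph.
Proof.
move=> cG cH; rewrite /wave_mean -circle_mean_lin; last 2 first.
- exact: continuous_mul_wave.
- exact: continuous_mul_wave.
by congr circle_mean; apply/funext => t; ring.
Qed.

Lemma wave_mean_norm G c k ph : continuous G -> (forall t, `|G t| <= c) -> `|wave_mean G k ph| <= c.
Proof.
move=> cG Gc; apply: circle_mean_norm; first exact: continuous_mul_wave.
move=> t; rewrite normrM -[leRHS]mulr1 ler_pM// ler_norml; apply/andP; split.
  exact: cos_geN1.
exact: cos_le1.
Qed.

Lemma fourier_coefE G k :
  fourier_coef G k = complex.Complex (wave_mean G k 0) (wave_mean G k (- (pi / 2))).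
Proof.
rewrite /fourier_coef /wave_mean /circle_mean; congr (complex.Complex (_ * _) (_ * _)).
  by apply: eq_Rintegral => t _; rewrite addr0.
by apply: eq_Rintegral => t _; rewrite cosBpihalf.
Qed.

(** [G] is real, so the coefficients at k and -k are conjugate and their product is a squared
    modulus. *)
Lemma fourier_term G k : continuous G ->
  complex.Re (fourier_coef G k * fourier_coef G (- k)) =
  wave_mean G k 0 ^+ 2 + wave_mean G k (- (pi / 2)) ^+ 2.
Proof.
move=> cG; have -> : fourier_coef G (- k) =
    complex.Complex (wave_mean G k 0) (-1 * wave_mean G k (- (pi / 2)) + 0).
  rewrite -[X in _ + X](circle_mean_cst 0) -circle_mean_lin; last 2 first.
  - exact: continuous_mul_wave.
  - by move=> x; exact: cvg_cst.
  rewrite /fourier_coef /wave_mean /circle_mean; congr (complex.Complex (_ * _) (_ * _)).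
    by apply: eq_Rintegral => t _; rewrite addr0 mulrNz mulNr cosN.
  by apply: eq_Rintegral => t _; rewrite cosBpihalf mulrNz mulNr sinN; ring.
rewrite fourier_coefE /=; ring.
Qed.

Section Symbol.
Variables (B : nat) (s : int -> R).
Hypothesis s_even : forall d, s (- d) = s d.

Definition symbol t : R := \sum_(e < 2 * B + 1) s (e%:Z - B%:Z) * cos ((e%:Z - B%:Z)%:~R * t).

Lemma continuous_symbol : continuous symbol.
Proof.
apply: continuous_ordsum => e; apply: continuous_mul => [x|]; first exact: cvg_cst.
have -> : (fun t : R => cos ((e%:Z - B%:Z)%:~R * t)) = (fun t => cos ((e%:Z - B%:Z)%:~R * t + 0)).
  by apply/funext => t; rewrite addr0.
exact: continuous_wave.
Qed.

(** The product of cos(d t) with the wave of frequency k is half the sum of the waves of frequencies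
    k - d and k + d; evenness of [s] merges the two halves into one convolution. *)
Lemma wave_mean_symbol_mul G k ph : continuous G ->
  wave_mean (fun t => symbol t * G t) k ph =
  \sum_(e < 2 * B + 1) s (e%:Z - B%:Z) * wave_mean G (k - (e%:Z - B%:Z)) ph.
Proof.
move=> cG.
pose W d t := G t * cos (d%:~R * t + ph).
have cW d : continuous (W d) by exact: continuous_mul_wave.
rewrite -circle_mean_sum; last by move=> e; exact: cW.
rewrite /wave_mean; congr circle_mean; apply/funext => t.
pose V d := s d * (G t * cos ((k - d)%:~R * t + ph)).
have cosM (x y : R) : cos x * cos y = (cos (y - x) + cos (y + x)) / 2.
  by rewrite !cosD cosN sinN; field.
transitivity (\sum_(e < 2 * B + 1) (V (e%:Z - B%:Z) + V (- (e%:Z - B%:Z))) / 2).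
  rewrite /symbol !mulr_suml; apply: eq_bigr => e _; rewrite /V s_even.
  set d := e%:Z - B%:Z.
  have -> : s d * cos (d%:~R * t) * G t * cos (k%:~R * t + ph) =
     s d * G t * (cos (d%:~R * t) * cos (k%:~R * t + ph)) by ring.
  rewrite cosM.
  have -> : (k - d)%:~R * t + ph = k%:~R * t + ph - d%:~R * t by rewrite intrB; ring.
  have -> : (k - - d)%:~R * t + ph = k%:~R * t + ph + d%:~R * t by rewrite opprK intrD; ring.
  by field.
rewrite -mulr_suml big_split/=.
have -> : \sum_(e < 2 * B + 1) V (- (e%:Z - B%:Z)) = \sum_(e < 2 * B + 1) V (e%:Z - B%:Z).
  rewrite (reindex_inj rev_ord_inj)/=; apply: eq_bigr => e _; congr V.
  by have := ltn_ord e; lia.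
by rewrite -/(V _); field.
Qed.

Lemma wave_mean_symbol_pow i k ph :
  wave_mean (fun t => symbol t ^+ i) k ph = laurent_pow B s i k * cos ph.
Proof.
have cS := continuous_symbol.
elim: i k => [|i IH] k.
  rewrite /= -circle_mean_wave /wave_mean; congr circle_mean.
  by apply/funext => t; rewrite expr0 mul1r.
have -> : (fun t => symbol t ^+ i.+1) = (fun t => symbol t * symbol t ^+ i).
  by apply/funext => t; rewrite exprS.
rewrite wave_mean_symbol_mul; last first.
  by move=> x; apply: (@continuous_comp _ _ _ symbol (fun y => y ^+ i)); [exact: cS|exact: exprn_continuous].
rewrite /= /laurent_mul mulr_suml; apply: eq_bigr => e _.
by rewrite IH mulrA.
Qed.

(** This identifies the Fourier coefficients of p(s_Q) with the diagonals of the limit of p(Q(J)).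
    The factor [cos ph] is 1 for the cosine part and 0 for the sine part. *)
Lemma wave_mean_symbol_poly (p : {poly R}) k ph :
  wave_mean (fun t => p.[symbol t]) k ph = laurent_poly B s p k * cos ph.
Proof.
have cS := continuous_symbol.
have -> : wave_mean (fun t => p.[symbol t]) k ph =
   circle_mean (fun t => \sum_(i < size p) p`_i * (symbol t ^+ i * cos (k%:~R * t + ph))).
  congr circle_mean; apply/funext => t; rewrite horner_coef mulr_suml.
  by apply: eq_bigr => i _; rewrite mulrA.
rewrite circle_mean_sum => [|i]; last first.
  apply: continuous_mul_wave => x.
  by apply: (@continuous_comp _ _ _ symbol (fun y => y ^+ i)); [exact: cS|exact: exprn_continuous].
rewrite /laurent_poly mulr_suml; apply: eq_bigr => i _.
by rewrite -mulrA -wave_mean_symbol_pow.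
Qed.

End Symbol.
End TrigonometricMeans.

(** * Polynomial approximation in the uniform and the C^1 norm on an interval *)

Section Weierstrass.
Variable R : realType.
Implicit Types (f : R -> R).

(** Only [x] is confined to the compact interval and [y] is free, since the lemma will compare a
    bounded variable with an uncontrolled one. *)
Lemma heine f (L e : R) : continuous f -> 0 < e ->
  exists2 d, 0 < d & forall x y, `|x| <= L -> `|x - y| < d -> `|f x - f y| <= e.
Proof.
move=> cf e0; have e2 : 0 < e / 2 by rewrite divr_gt0.
have cK : compact (`[- L, L]%classic : set R) by exact: segment_compact.
pose P (d : R) x := forall y, `|x - y| < d -> `|f x - f y| <= e.
have : \forall d \near (0 : R)^'+, (`[- L, L]%classic : set R) `<=` P d.
  apply: (compact_near_coveringP _).1 => // x _.
  have /cvgrPdist_le/(_ _ e2)/nbhs_ballP[r /= r0 hr] := cf x.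
  have r2 : 0 < r / 2 by rewrite divr_gt0.
  exists ((ball x (r / 2)), [set d | d < r / 2]).
    split => /=; first exact: nbhsx_ballx.
    exact: nbhs_right_lt.
  move=> [x' d] [/= xx' dr] y x'y.
  rewrite -[f x' - f y](subrKA (f x)) (splitr e).
  apply: le_trans (ler_normD _ _) _; apply: lerD.
    rewrite distrC; apply: hr; rewrite /ball/=; apply: lt_le_trans xx' _; lra.
  apply: hr; rewrite /ball/=; apply: le_lt_trans (ler_distD x' _ _) _.
  by have : `|x - x'| < r / 2 by []; have := lt_trans x'y dr; lra.
move=> H; have : \forall d \near (0 : R)^'+, 0 < d /\ (`[- L, L]%classic : set R) `<=` P d.
  by near=> d; split => //; near: d.
move=> /filter_ex[d [d0 hd]]; exists d => // x y xL xy.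
by apply: hd => //=; rewrite in_itv/= -ler_norml.
Unshelve. all: by end_near. Qed.

Lemma bounded_on f (L : R) : continuous f -> exists M, forall x, `|x| <= L -> `|f x| <= M.
Proof.
move=> cf; have [L0|L0] := leP 0 L; last first.
  by exists 0 => x xL; have := le_lt_trans (normr_ge0 x) (le_lt_trans xL L0); rewrite ltxx.
have LL : - L <= L by lra.
have cn : {within `[- L, L], continuous (fun x => `|f x|)}.
  apply: continuous_subspaceT => x.
  by apply: continuous_comp; [exact: cf|exact: norm_continuous].
have [c _ hc] := EVT_max LL cn.
by exists `|f c| => x xL; apply: hc; rewrite in_itv/= -ler_norml.
Qed.

(* Bernstein's operator: the mean of g under the binomial law (n, x), built one trial at a time. *)
Fixpoint bernstein (n : nat) (g : nat -> R) (x : R) : R :=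
  if n is n'.+1 then (1 - x) * bernstein n' g x + x * bernstein n' (fun k => g k.+1) x else g 0%N.

Fixpoint bernstein_poly (n : nat) (g : nat -> R) : {poly R} :=
  if n is n'.+1 then (1 - 'X) * bernstein_poly n' g + 'X * bernstein_poly n' (fun k => g k.+1)
  else (g 0%N)%:P.

Lemma bernstein_polyE n g (x : R) : (bernstein_poly n g).[x] = bernstein n g x.
Proof. by elim: n g => [|n IH] g /=; rewrite !hornerE// !IH. Qed.

Lemma bernstein_le n g h x : 0 <= x <= 1 -> (forall k, (k <= n)%N -> g k <= h k) ->
  bernstein n g x <= bernstein n h x.
Proof.
move=> /andP[x0 x1]; elim: n g h => [|n IH] g h gh /=; first exact: gh.
apply: lerD; apply: ler_wpM2l; rewrite ?subr_ge0//; apply: IH => k kn; apply: gh => //.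
exact: leqW.
Qed.

Lemma bernstein_lin n c g h x :
  bernstein n (fun k => c * g k + h k) x = c * bernstein n g x + bernstein n h x.
Proof. by elim: n g h => [//|n IH] g h /=; rewrite !IH; ring. Qed.

Lemma bernstein_cst n c x : bernstein n (fun=> c) x = c.
Proof. by elim: n => //= n ->; ring. Qed.

(** Second moment of a binomial law about [c]: variance plus squared bias. A general [c] is needed
    because each success shifts it by one in the induction. *)
Lemma bernstein_sqr n c x : bernstein n (fun k => (k%:R - c) ^+ 2) x =
  n%:R * x * (1 - x) + (n%:R * x - c) ^+ 2.
Proof.
elim: n c => [|n IH] c /=; first by rewrite !mul0r !add0r.
have -> : (fun k => (k.+1%:R - c) ^+ 2) = (fun k => (k%:R - (c - 1)) ^+ 2) :> (nat -> R).
  by apply/funext => k; rewrite -natr1; congr (_ ^+ 2); ring.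
by rewrite !IH -natr1; ring.
Qed.

Lemma weierstrass01 f (e : R) : continuous f -> 0 < e ->
  exists p : {poly R}, forall x, 0 <= x <= 1 -> `|f x - p.[x]| <= e.
Proof.
move=> cf e0; have e2 : 0 < e / 2 by rewrite divr_gt0.
have [d d0 hd] := heine 1 cf e2.
have [M hM] := bounded_on 1 cf.
have M0 : 0 <= M by apply: le_trans (hM 0 _); rewrite ?normr0.
(* Chebyshev's inequality leaves an error of at most [2 * M / (d ^+ 2 * N)]; this [N] makes it at
   most [e / 2]. *)
pose N := (Num.truncn (4 * M / (d ^+ 2 * e))).+1.
have Nlt : 4 * M / (d ^+ 2 * e) < N%:R by exact: truncnS_gt.
have N0 : 0 < N%:R :> R by rewrite ltr0n.
exists (bernstein_poly N (fun k => f (k%:R / N%:R))) => x x01; rewrite bernstein_polyE.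
have d20 : 0 < d ^+ 2 by rewrite exprn_gt0.
have /andP[x0 x1] := x01.
have nx : `|x| <= 1 by rewrite ger0_norm.
pose K := 2 * M / d ^+ 2 / N%:R ^+ 2.
have A0 : 0 <= 2 * M / d ^+ 2 by apply: divr_ge0; [exact: mulr_ge0|exact: sqr_ge0].
have K0 : 0 <= K by apply: divr_ge0 => //; exact: sqr_ge0.
have pw k : (k <= N)%N -> `|f x - f (k%:R / N%:R)| <= K * (k%:R - N%:R * x) ^+ 2 + e / 2.
  move=> kN; set y := k%:R / N%:R.
  have ny : `|y| <= 1.
    by rewrite ger0_norm ?divr_ge0// ler_pdivrMr// mul1r ler_nat.
  have [h|h] := ltP `|x - y| d.
    apply: le_trans (hd _ _ nx h) _; rewrite lerDr mulr_ge0// sqr_ge0//.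
  apply: le_trans (_ : 2 * M <= _).
    apply: le_trans (ler_normB _ _) _; have := hM _ nx; have := hM _ ny; lra.
  have -> : K * (k%:R - N%:R * x) ^+ 2 = 2 * M * (`|x - y| ^+ 2 / d ^+ 2).
    rewrite real_normK ?num_real// /K /y; field.
    by rewrite !gt_eqF.
  have q : 1 <= `|x - y| ^+ 2 / d ^+ 2.
    by rewrite ler_pdivlMr// mul1r lerXn2r ?nnegrE// ltW.
  have : 2 * M * 1 <= 2 * M * (`|x - y| ^+ 2 / d ^+ 2) by apply: ler_wpM2l => //; rewrite mulr_ge0.
  lra.
have var : K * bernstein N (fun k => (k%:R - N%:R * x) ^+ 2) x <= e / 2.
  rewrite bernstein_sqr subrr expr0n/= addr0.
  have -> : K * (N%:R * x * (1 - x)) = 2 * M / d ^+ 2 / N%:R * (x * (1 - x)).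
    by rewrite /K; field; rewrite !gt_eqF.
  have xx : x * (1 - x) <= 1 by nra.
  have a0 : 0 <= 2 * M / d ^+ 2 / N%:R by exact: divr_ge0.
  apply: le_trans (ler_wpM2l a0 xx) _; rewrite mulr1 ler_pdivrMr//.
  move: Nlt; rewrite ltr_pdivrMr ?mulr_gt0// => Nlt.
  rewrite ler_pdivrMr//; move: Nlt; nra.
have up : bernstein N (fun k => f (k%:R / N%:R)) x <=
    bernstein N (fun k => K * (k%:R - N%:R * x) ^+ 2 + (f x + e / 2)) x.
  apply: bernstein_le => // k kN; have := pw k kN; rewrite ler_norml => /andP[]; lra.
have dn : bernstein N (fun k => (- K) * (k%:R - N%:R * x) ^+ 2 + (f x - e / 2)) x <=
    bernstein N (fun k => f (k%:R / N%:R)) x.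
  apply: bernstein_le => // k kN; have := pw k kN; rewrite ler_norml => /andP[]; lra.
rewrite bernstein_lin bernstein_cst in up; rewrite bernstein_lin bernstein_cst in dn.
by rewrite ler_norml; move: up dn var; lra.
Qed.

Lemma weierstrass f (L e : R) : continuous f -> 0 < L -> 0 < e ->
  exists p : {poly R}, forall x, `|x| <= L -> `|f x - p.[x]| <= e.
Proof.
move=> cf L0 e0; pose g (y : R) := f (L * (2 * y - 1)).
have cl : continuous (fun y : R => L * (2 * y - 1)).
  move=> y; apply: cvgM; first exact: cvg_cst.
  apply: cvgB; last exact: cvg_cst.
  by apply: cvgM; [exact: cvg_cst|exact: cvg_id].
have cg : continuous g by move=> y; exact: (continuous_comp (cl y) (cf _)).
have [p hp] := weierstrass01 cg e0.
exists (p \Po ((2 * L)^-1 *: 'X + 2^-1%:P)) => x; rewrite ler_norml => /andP[x1 x2].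
rewrite horner_comp !hornerE; set y := _ * x + _.
have -> : f x = g y by rewrite /g /y; congr f; field; rewrite gt_eqF.
have -> : y = (x + L) / (2 * L) by rewrite /y; field; rewrite gt_eqF.
apply: hp; rewrite divr_ge0 ?mulr_ge0//=; [|lra|lra].
by rewrite ler_pdivrMr ?mulr_gt0//; lra.
Qed.

Lemma lipschitz_of_derive f df (L e : R) : (forall x : R, is_derive x 1 f (df x)) -> 0 <= e ->
  (forall x, `|x| <= L -> `|df x| <= e) ->
  forall x y, `|x| <= L -> `|y| <= L -> `|f x - f y| <= e * `|x - y|.
Proof.
move=> dF e0 he.
have cf : continuous f.
  by move=> x; apply: differentiable_continuous; apply/derivable1_diffP; case: (dF x).
suff H (x y : R) : x < y -> `|x| <= L -> `|y| <= L -> `|f x - f y| <= e * `|x - y|.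
  move=> x y xL yL; have [xy|yx|->] := ltgtP x y; first exact: H.
    by rewrite distrC [X in _ * X]distrC; exact: H.
  by rewrite !subrr normr0 mulr0.
move=> xy xL yL; move: (xL) (yL); rewrite [`|x| <= _]ler_norml [`|y| <= _]ler_norml.
move=> /andP[x1 x2] /andP[y1 y2].
have [c] := MVT xy (fun z _ => dF z) (continuous_subspaceT cf).
rewrite in_itv/= => /andP[xc cy] fE.
rewrite distrC fE normrM [`|x - y|]distrC; apply: ler_wpM2r => //.
by apply: he; rewrite ler_norml; lra.
Qed.

Lemma poly_antiderivative (q : {poly R}) c : exists p : {poly R}, p^`() = q /\ p.[0] = c.
Proof.
pose p := \poly_(i < (size q).+1) (if i is i'.+1 then q`_i' / i'.+1%:R else c).
exists p; split; last by rewrite horner_coef0 coef_poly.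
apply/polyP => i; rewrite coef_deriv coef_poly ltnS.
case: ltnP => qi; last by rewrite mul0rn nth_default.
by rewrite -[LHS]mulr_natr divfK// pnatr_eq0.
Qed.

(** Approximate the derivative and integrate, with the constant chosen so that [p] and [f] agree at
    0. The mean value theorem then gives the Lipschitz bound, and comparison with 0 the sup
    bound. *)
Lemma C1_approx f (L e : R) : (forall x : R, derivable f x 1) -> continuous (derive1 f) -> 0 < L -> 0 < e ->
  exists p : {poly R},
    (forall x y, `|x| <= L -> `|y| <= L -> `|(f x - p.[x]) - (f y - p.[y])| <= e * `|x - y|) /\
    (forall x, `|x| <= L -> `|f x - p.[x]| <= e * L).
Proof.
move=> df cf L0 e0; have [q hq] := weierstrass cf L0 e0.
have [p [pq p0]] := poly_antiderivative q (f 0).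
exists p.
have dd (x : R) : is_derive x 1 (fun x => f x - p.[x]) (derive1 f x - q.[x]).
  have h1 : is_derive x 1 f (derive1 f x) by rewrite derive1E; exact: derivableP.
  have := is_deriveB h1 (is_derive_poly p x); rewrite pq; exact.
have lip := lipschitz_of_derive dd (ltW e0) hq.
split => [//|x xL]; have := lip x 0 xL _; rewrite normr0 p0 subrr !subr0 => h.
by apply: le_trans (h (ltW L0)) _; rewrite ler_pM2l.
Qed.

Lemma lipschitz_C1 f (L : R) : (forall x : R, derivable f x 1) -> continuous (derive1 f) ->
  exists2 eta, 0 <= eta & forall x y, `|x| <= L -> `|y| <= L -> `|f x - f y| <= eta * `|x - y|.
Proof.
move=> df cf; have [M hM] := bounded_on L cf.
exists `|M|; first exact: normr_ge0.
apply: (lipschitz_of_derive (df := derive1 f)) => // x.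
  by rewrite derive1E; exact: derivableP.
by move=> xL; apply: le_trans (hM x xL) _; exact: ler_norm.
Qed.

End Weierstrass.

(** * Gaussian integrals of functions of polynomial growth *)

Section GaussianMeans.
Variable R : realType.
Implicit Types (u v : R -> R) (p : {poly R}) (c : R).
Local Notation leb := (@lebesgue_measure R).
Local Notation integ g := (leb.-integrable setT (EFin \o g)).
Local Notation gpdf := (@gauss_pdf R).

Lemma pow_le_expR k : exists2 c, 0 <= c & forall t : R, 0 <= t -> t ^+ k <= c * expR t.
Proof.
elim: k => [|k [c c0 hc]].
  by exists 1 => // t t0; rewrite mul1r expr0 -expR0 ler_expR.
exists (2 ^+ k.+1 * c) => [|t t0]; first by rewrite mulr_ge0// exprn_ge0.
have t2 : 0 <= t / 2 by rewrite divr_ge0.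
have h1 := hc _ t2; have h2 := expR_ge1Dx (t / 2).
have -> : t ^+ k.+1 = 2 ^+ k.+1 * ((t / 2) ^+ k * (t / 2)).
  by rewrite -exprSr expr_div_n mulrCA divff ?mulr1// expf_neq0// pnatr_eq0.
have -> : expR t = expR (t / 2) * expR (t / 2) by rewrite -expRD -splitr.
rewrite -mulrA ler_wpM2l ?exprn_ge0//.
rewrite [leRHS]mulrA; apply: ler_pM => //; first exact: exprn_ge0.
lra.
Qed.

Lemma poly_le_expR p : exists2 c, 0 <= c & forall y : R, `|p.[y]| <= c * expR (y ^+ 2 / 4).
Proof.
have mono k : exists2 c, 0 <= c & forall y : R, `|y| ^+ k <= c * expR (y ^+ 2 / 4).
  have [c c0 hc] := pow_le_expR k; exists (1 + 4 ^+ k * c).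
    by rewrite addr_ge0// mulr_ge0// exprn_ge0.
  move=> y; have t0 : 0 <= y ^+ 2 / 4 by rewrite divr_ge0// sqr_ge0.
  have h := hc _ t0; have e1 := expR_ge1Dx (y ^+ 2 / 4).
  have h' : (`|y| ^+ k) ^+ 2 <= 4 ^+ k * c * expR (y ^+ 2 / 4).
    rewrite -exprM mulnC exprM real_normK ?num_real//.
    have -> : (y ^+ 2) ^+ k = 4 ^+ k * (y ^+ 2 / 4) ^+ k.
      by rewrite expr_div_n mulrCA divff ?mulr1// expf_neq0// pnatr_eq0.
    by rewrite -mulrA ler_wpM2l// exprn_ge0.
  rewrite mulrDl mul1r; move: h'; set w := `|y| ^+ k => h'.
  have q : w <= 1 + w ^+ 2 by have := sqr_ge0 (w - 1); have := sqr_ge0 w; rewrite !expr2; nra.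
  by move: q h' e1 t0; lra.
have /choice[c hc] : forall k, exists c, 0 <= c /\ forall y : R, `|y| ^+ k <= c * expR (y ^+ 2 / 4).
  by move=> k; have [c c0 hc] := mono k; exists c.
exists (\sum_(i < size p) `|p`_i| * c i).
  by apply: sumr_ge0 => i _; rewrite mulr_ge0//; have [] := hc i.
move=> y; rewrite horner_coef mulr_suml; apply: le_trans (ler_norm_sum _ _ _) _.
apply: ler_sum => i _; rewrite normrM normrX -mulrA ler_wpM2l//.
by have [_] := hc i; exact.
Qed.

Lemma gauss_pdf_ge0 (y : R) : 0 <= gpdf y.
Proof. by rewrite /gauss_pdf mulr_ge0 ?expR_ge0// invr_ge0 sqrtr_ge0. Qed.

Lemma is_derive_gauss_pdf (y : R) : is_derive y 1 gpdf (- y * gpdf y).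
Proof.
have hq : is_derive y 1 (horner (- 2^-1 *: 'X^2 : {poly R})) (- y).
  apply: is_derive_eq (is_derive_poly _ y) _.
  by rewrite derivZ derivXn hornerZ hornerMn hornerXn expr1 -[y *+ 2]mulr_natr; field.
have he := is_derive1_comp (is_derive_expR _) hq.
have := is_deriveZ (Num.sqrt (2 * pi))^-1 he.
have -> : ((Num.sqrt (2 * pi))^-1 \*: (expR \o horner (- 2^-1 *: 'X^2 : {poly R})))%R = gpdf.
  apply/funext => x; rewrite /gauss_pdf /= /GRing.scale/= !hornerE/=.
  by congr (_ * expR _); field.
move=> h; apply: is_derive_eq h _.
rewrite /gauss_pdf /GRing.scale/= !hornerE/=.
have -> : - 2^-1 * y * y = - y ^+ 2 / 2 by ring.
ring.
Qed.

Lemma continuous_gauss_pdf : continuous gpdf.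
Proof.
move=> x; apply: differentiable_continuous; apply/derivable1_diffP.
by case: (is_derive_gauss_pdf x).
Qed.

Lemma gauss_pdf_normal : gpdf = normal_pdf 0 1.
Proof.
apply/funext => x; rewrite normal_pdfE ?oner_eq0// /gauss_pdf /normal_peak /normal_fun.
rewrite expr1n mul1r subr0; congr ((Num.sqrt _)^-1 * expR (_ / _)).
by rewrite mulr_natl.
Qed.

(** The factor [expR (y ^+ 2 / 4)] of [poly_le_expR] uses up half of the Gaussian exponent; what
    remains is a multiple of the normal density with standard deviation [Num.sqrt 2]. *)
Lemma gauss_integrable u : admissible u -> integ (fun y => u y * gpdf y).
Proof.
move=> [mu1 [r hr]]; have [c c0 hc] := poly_le_expR r.
have s2 : (Num.sqrt 2 : R) != 0 by rewrite sqrtr_eq0 -ltNge.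
pose K := c * ((Num.sqrt (2 * pi))^-1 / normal_peak (Num.sqrt 2 : R)).
have pk : normal_peak (Num.sqrt 2 : R) != 0.
  rewrite /normal_peak invr_eq0 sqrtr_eq0 -ltNge sqr_sqrtr//.
  by rewrite pmulrn_lgt0// mulr_gt0// pi_gt0.
have iN : integ (fun y => K * normal_pdf 0 (Num.sqrt 2) y).
  exact: (integrableZl measurableT K (integrable_normal_pdf 0 (Num.sqrt 2))).
apply: (le_integrable measurableT _ _ iN).
  apply/measurable_EFinP; apply: measurable_funM => //.
  by apply: continuous_measurable_fun; exact: continuous_gauss_pdf.
move=> y _ /=; rewrite lee_fin; apply: le_trans (ler_norm _).
rewrite normrM (ger0_norm (gauss_pdf_ge0 y)) normal_pdfE// /K /normal_fun.
have -> : c * ((Num.sqrt (2 * pi))^-1 / normal_peak (Num.sqrt 2)) *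
    (normal_peak (Num.sqrt 2) * expR (- (y - 0) ^+ 2 / (Num.sqrt 2 ^+ 2 *+ 2))) =
  c * expR (y ^+ 2 / 4) * ((Num.sqrt (2 * pi))^-1 * expR (- y ^+ 2 / 2)).
  rewrite subr0 sqr_sqrtr// (_ : 2 *+ 2 = 4 :> R); last by rewrite -mulrnA.
  have -> : expR (- y ^+ 2 / 4) = expR (y ^+ 2 / 4) * expR (- y ^+ 2 / 2).
    by rewrite -expRD; congr expR; field.
  by set a := (Num.sqrt (2 * pi))^-1; field.
rewrite ler_wpM2r ?gauss_pdf_ge0//.
apply: le_trans (hr y) _; apply: le_trans (hc y); exact: ler_norm.
Qed.

Definition gauss_mean u := Rintegral leb setT (fun y => u y * gpdf y).

Lemma gauss_mean1 : gauss_mean (fun=> 1) = 1.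
Proof.
rewrite /gauss_mean /Rintegral; under eq_integral do rewrite mul1r gauss_pdf_normal.
by rewrite integral_normal_pdf.
Qed.

Lemma gauss_mean_lin c u v : admissible u -> admissible v ->
  gauss_mean (fun y => c * u y + v y) = c * gauss_mean u + gauss_mean v.
Proof.
move=> au av; rewrite /gauss_mean -RintegralZl//; last exact: gauss_integrable.
rewrite -RintegralD//; last 2 first.
- exact: (integrableZl measurableT c (gauss_integrable au)).
- exact: gauss_integrable.
by apply: eq_Rintegral => x _; ring.
Qed.

Lemma gauss_mean_le u v : admissible u -> admissible v -> (forall x, u x <= v x) ->
  gauss_mean u <= gauss_mean v.
Proof.
move=> au av uv; apply: le_Rintegral => //; [exact: gauss_integrable|exact: gauss_integrable|].
by move=> x _; rewrite ler_wpM2r// gauss_pdf_ge0.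
Qed.

(** Stein's identity: the integrand is the derivative of [p] times the density. Integrate over
    growing intervals, let the boundary values vanish, and pass to the limit by dominated
    convergence. *)
Lemma gauss_mean_derive p : gauss_mean (fun y => (p^`() - 'X * p).[y]) = 0.
Proof.
set w := p^`() - 'X * p; pose f y := w.[y] * gpdf y; pose F y := p.[y] * gpdf y.
have dF (y : R) : is_derive y 1 F (f y).
  have h := is_deriveM (is_derive_poly p y) (is_derive_gauss_pdf y).
  apply: is_derive_eq h _; rewrite /f /w hornerD hornerN hornerM hornerX.
  set g := gpdf y; rewrite /GRing.scale /=; ring.
have cf : continuous f.
  by move=> x; apply: cvgM; [exact: continuous_horner|exact: continuous_gauss_pdf].
have intf : integ f by apply: gauss_integrable; exact: admissible_poly.
have mf : measurable_fun setT f by exact: continuous_measurable_fun.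
pose I (n : nat) : set R := `[- n.+1%:R, n.+1%:R]%classic.
have mI n : measurable (I n) by exact: measurable_itv.
have FI n : Rintegral leb setT (fun x => f x * \1_(I n) x) = F n.+1%:R - F (- n.+1%:R).
  rewrite -(FTC_is_derive _ dF cf); last by rewrite -subr_gt0 opprK addr_gt0.
  rewrite [RHS]Rintegral_mkcond; apply: eq_Rintegral => x _.
  by rewrite /patch indicE; case: (x \in _); rewrite ?mulr1 ?mulr0.
have mfn n : measurable_fun setT (fun x => (f x * \1_(I n) x)%:E).
  by apply/measurable_EFinP; apply: measurable_funM => //; exact: measurable_indic.
have mfE : measurable_fun setT (fun x => (f x)%:E) by exact/measurable_EFinP.
have fn_le n x : `|f x * \1_(I n) x| <= `|f x|.
  by rewrite normrM indicE; case: (x \in _); rewrite ?normr1 ?normr0 ?mulr1 ?mulr0.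
have cvn : {ae leb, forall x, setT x -> (fun n => (f x * \1_(I n) x)%:E) @ \oo --> (f x)%:E}.
  apply: aeW => x _; apply: cvg_near_cst; near=> n.
  rewrite indicE mem_set ?mulr1// /I /= in_itv/= -ler_norml.
  apply: (@le_trans _ _ (Num.truncn `|x|).+1%:R); first by rewrite ltW// truncnS_gt.
  by rewrite ler_nat ltnS; near: n; exists (Num.truncn `|x|).
have intn : leb.-integrable setT (fun x => `|f x|%:E) by exact: integrable_norm.
have dom : {ae leb, forall x n, setT x -> (`|(f x * \1_(I n) x)%:E| <= `|f x|%:E)%E}.
  by apply: aeW => x n _; rewrite /= lee_fin.
have [_ _ H] := @dominated_convergence _ _ R leb setT measurableT
  (fun n x => (f x * \1_(I n) x)%:E) (fun x => (f x)%:E) (fun x => `|f x|%:E) mfn mfE cvn intn dom.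
have intfn n : leb.-integrable setT (fun x => (f x * \1_(I n) x)%:E).
  apply: (le_integrable measurableT _ _ intf); first exact: mfn.
  by move=> x _; rewrite /= lee_fin.
have [c c0 hc] := poly_le_expR p.
pose a := (Num.sqrt (2 * pi))^-1 : R.
have a0 : 0 <= a by rewrite invr_ge0 sqrtr_ge0.
have Fbd (n : nat) y : `|y| = n.+1%:R -> `|F y| <= c * a * harmonic n.
  move=> yn; rewrite /F normrM (ger0_norm (gauss_pdf_ge0 _)) /gauss_pdf -/a /harmonic/=.
  have y2 : y ^+ 2 = n.+1%:R ^+ 2 by rewrite -yn real_normK ?num_real.
  set e := expR (y ^+ 2 / 4); have e0 : 0 < e by exact: expR_gt0.
  have -> : expR (- y ^+ 2 / 2) = e^-1 * e^-1.
    by rewrite /e -!expRN -expRD; congr expR; field.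
  have h1 : `|p.[y]| * (a * (e^-1 * e^-1)) <= c * e * (a * (e^-1 * e^-1)).
    by apply: ler_wpM2r; [rewrite !mulr_ge0// invr_ge0 ltW|exact: hc].
  apply: le_trans h1 _.
  have -> : c * e * (a * (e^-1 * e^-1)) = c * a * e^-1 by field; rewrite gt_eqF.
  apply: ler_wpM2l; first exact: mulr_ge0.
  rewrite lef_pV2 ?posrE//.
  (* At |y| = n + 1 one has e >= 1 + (n + 1)^2 / 4 >= n + 1, the last step being (x / 2 - 1)^2 >= 0;
     so the spare factor [e^-1] is at most [harmonic n]. *)
  have := expR_ge1Dx (y ^+ 2 / 4); rewrite -/e y2; have := sqr_ge0 (n.+1%:R / 2 - 1 : R).
  have -> : (n.+1%:R / 2 - 1) ^+ 2 = n.+1%:R ^+ 2 / 4 - n.+1%:R + 1 :> R by field.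
  lra.
have Flim : (fun n : nat => F n.+1%:R - F (- n.+1%:R)) @ \oo --> (0 : R).
  have hl : (fun n => 2 * (c * a) * harmonic n) @ \oo --> (0 : R).
    by rewrite -[X in _ --> X](mulr0 (2 * (c * a))); apply: cvgM; [exact: cvg_cst|exact: cvg_harmonic].
  apply/cvgrPdist_le => e e0; move/cvgrPdist_le/(_ _ e0) : hl.
  apply: filterS => n; rewrite !sub0r !normrN => hn.
  apply: le_trans (ler_normB _ _) _; apply: le_trans hn; apply: le_trans (ler_norm _).
  have h1 := @Fbd n n.+1%:R (ger0_norm (ler0n _ _)).
  have h2 := @Fbd n (- n.+1%:R); rewrite normrN in h2; have := h2 (ger0_norm (ler0n _ _)).
  lra.
have HF : (fun n => \int[leb]_x (f x * \1_(I n) x)%:E)%E = (fun n => (F n.+1%:R - F (- n.+1%:R))%:E).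
  by apply/funext => n; rewrite -FI /Rintegral fineK//; apply: integrable_fin_num.
rewrite HF in H.
have H0 : (fun n : nat => (F n.+1%:R - F (- n.+1%:R))%:E) @ \oo --> (0%R)%:E.
  by apply: cvg_EFin => //; exact: nearW.
by rewrite /gauss_mean /Rintegral -/f (cvg_unique _ H H0).
Unshelve. all: by end_near. Qed.

Fixpoint normal_moment (m : nat) : R :=
  match m with 0 => 1 | 1 => 0 | m'.+2 => m'.+1%:R * normal_moment m' end.

Lemma gauss_mean_pow m : gauss_mean (fun y => y ^+ m) = normal_moment m.
Proof.
elim/ltn_ind: m => -[|[|m]] IH /=.
- by rewrite -gauss_mean1; congr gauss_mean; apply/funext => x; rewrite expr0.
- have := gauss_mean_derive 1; rewrite derivC sub0r mulr1.
  have -> : (fun y : R => (- 'X : {poly R}).[y]) = (fun y => -1 * 'X.[y] + (0 : {poly R}).[y]).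
    by apply/funext => y; rewrite !hornerE mulN1r.
  rewrite gauss_mean_lin; try exact: admissible_poly.
  have -> : gauss_mean (fun y => (0 : {poly R}).[y]) = 0.
    rewrite /gauss_mean; under eq_Rintegral do rewrite horner0 mul0r.
    by rewrite Rintegral_cst// mul0r.
  have -> : (fun y : R => y ^+ 1) = (fun y => 'X.[y]) by apply/funext => y; rewrite hornerX.
  lra.
have := gauss_mean_derive 'X^(m.+1); rewrite derivXn/=.
have -> : (fun y : R => ('X^m *+ m.+1 - 'X * 'X^(m.+1) : {poly R}).[y]) =
    (fun y => -1 * ('X^(m.+2)).[y] + (m.+1%:R * ('X^m).[y] + (0 : {poly R}).[y])).
  apply/funext => y; rewrite -exprS !(hornerD, hornerN, hornerMn, hornerXn, horner0) addr0.
  by rewrite -[y ^+ m *+ _]mulr_natl; ring.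
have apm : admissible (fun y => m.+1%:R * ('X^m : {poly R}).[y] + (0 : {poly R}).[y]).
  have -> : (fun y => m.+1%:R * ('X^m : {poly R}).[y] + (0 : {poly R}).[y]) =
      (fun y => (m.+1%:R *: 'X^m : {poly R}).[y]).
    by apply/funext => y; rewrite hornerZ horner0 addr0.
  exact: admissible_poly.
rewrite gauss_mean_lin//; last exact: admissible_poly.
rewrite gauss_mean_lin; try exact: admissible_poly.
have -> : gauss_mean (fun y => (0 : {poly R}).[y]) = 0.
  rewrite /gauss_mean; under eq_Rintegral do rewrite horner0 mul0r.
  by rewrite Rintegral_cst// mul0r.
have e k : gauss_mean (fun y => ('X^k : {poly R}).[y]) = gauss_mean (fun y => y ^+ k).
  by congr gauss_mean; apply/funext => y; rewrite hornerXn.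
rewrite !e (IH m)//.
lra.
Qed.

End GaussianMeans.

(** * Taylor polynomials of waves *)

Section CosineTaylor.
Variable R : realType.
Implicit Types (x ph : R).

(** Taylor polynomial at 0 of x |-> cos(ph + x), of degree below [n]: each derivative of cosine
    advances the phase by pi / 2. *)
Definition cos_taylor (n : nat) ph : {poly R} :=
  \poly_(k < n) (cos (ph + k%:R * (pi / 2)) / k`!%:R).

Lemma deriv_cos_taylor n ph : (cos_taylor n.+1 ph)^`() = cos_taylor n (ph + pi / 2).
Proof.
apply/polyP => k; rewrite coef_deriv !coef_poly ltnS; case: ifP => _; last by rewrite mul0rn.
have -> : ph + k.+1%:R * (pi / 2) = ph + pi / 2 + k%:R * (pi / 2) by rewrite -natr1; ring.
rewrite -[LHS]mulr_natr factS natrM -mulrA; congr (_ * _).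
rewrite invfM mulrAC mulVf ?mul1r// pnatr_eq0//.
Qed.

Lemma derive_bound (g dg b db : R -> R) x : 0 <= x -> g 0 = 0 -> b 0 = 0 ->
  (forall y : R, is_derive y 1 g (dg y)) -> (forall y : R, is_derive y 1 b (db y)) ->
  (forall y, 0 <= y -> `|dg y| <= db y) -> `|g x| <= b x.
Proof.
move=> x0 g0 b0 Dg Db gb; move: x0; rewrite le_eqVlt => /predU1P[<-|x0].
  by rewrite g0 b0 normr0.
have up (w dw : R -> R) : (forall y : R, is_derive y 1 w (dw y)) -> w 0 = 0 ->
    (forall y, 0 <= y -> 0 <= dw y) -> 0 <= w x.
  move=> Dw w0 dw0.
  have cw : continuous w.
    by move=> y; apply: differentiable_continuous; apply/derivable1_diffP; case: (Dw y).
  have [c] := MVT x0 (fun z _ => Dw z) (continuous_subspaceT cw).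
  rewrite in_itv/= w0 !subr0 => /andP[c0 _] ->.
  by apply: mulr_ge0; [apply: dw0|]; exact: ltW.
have h1 : 0 <= b x - g x.
  have D1 (y : R) : is_derive y 1 (fun y => b y - g y) (db y - dg y).
    exact: is_deriveB (Db y) (Dg y).
  have z1 : b 0 - g 0 = 0 by rewrite b0 g0 subrr.
  apply: (up _ _ D1 z1) => y y0.
  by have := gb y y0; rewrite ler_norml => /andP[]; lra.
have h2 : 0 <= b x + g x.
  have D1 (y : R) : is_derive y 1 (fun y => b y + g y) (db y + dg y).
    exact: is_deriveD (Db y) (Dg y).
  have z1 : b 0 + g 0 = 0 by rewrite b0 g0 addr0.
  apply: (up _ _ D1 z1) => y y0.
  by have := gb y y0; rewrite ler_norml => /andP[]; lra.
by rewrite ler_norml; lra.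
Qed.

(** The derivative of the remainder of order [n.+1] at phase [ph] is the remainder of order [n] at
    phase [ph + pi / 2], so the bound integrates inductively; negative [x] is handled by
    reflection. *)
Lemma cos_taylorP n ph x : `|cos (ph + x) - (cos_taylor n ph).[x]| <= `|x| ^+ n / n`!%:R.
Proof.
elim: n ph x => [|n IH] ph x.
  rewrite /cos_taylor poly_def big_ord0 horner0 subr0 expr0 divr1.
  by rewrite ler_norml cos_geN1 cos_le1.
pose g y := cos (ph + y) - (cos_taylor n.+1 ph).[y].
pose dg y := cos (ph + pi / 2 + y) - (cos_taylor n (ph + pi / 2)).[y].
pose b y := y ^+ n.+1 / n.+1`!%:R : R; pose db y := y ^+ n / n`!%:R : R.
have Dg (y : R) : is_derive y 1 g (dg y).
  have h1 := @is_derive1_comp R cos (fun t => 1 * t + ph) y _ _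
    (is_derive_cos (1 * y + ph)) (is_derive_affine 1 ph y).
  have h2 := is_deriveB h1 (is_derive_poly (cos_taylor n.+1 ph) y).
  have -> : g = (cos \o (fun t => 1 * t + ph)) - horner (cos_taylor n.+1 ph).
    by apply/funext => t; rewrite /g [ph + t]addrC -{1}[t]mul1r.
  apply: is_derive_eq h2 _; rewrite deriv_cos_taylor /dg mulr1; congr (_ - _).
  by rewrite -cosDpihalf; congr cos; ring.
have Db (y : R) : is_derive y 1 b (db y).
  have -> : b = horner ((n.+1`!%:R)^-1 *: 'X^(n.+1)).
    by apply/funext => t; rewrite /b hornerZ hornerXn mulrC.
  apply: is_derive_eq (is_derive_poly _ y) _.
  rewrite derivZ derivXn hornerZ hornerMn hornerXn /db -[_ *+ _]mulr_natr factS natrM.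
  by field; rewrite nat1r !pnatr_eq0 -lt0n fact_gt0.
have g0 : g 0 = 0.
  by rewrite /g addr0 horner_coef0 coef_poly /= mul0r addr0 divr1 subrr.
have b0 : b 0 = 0 by rewrite /b expr0n/= mul0r.
have [x0|x0] := leP 0 x.
  rewrite (ger0_norm x0); apply: (derive_bound x0 g0 b0 Dg Db) => y y0.
  by rewrite /dg /db; apply: le_trans (IH _ _) _; rewrite (ger0_norm y0).
rewrite (ltr0_norm x0).
have Dg' (y : R) : is_derive y 1 (fun t => g (-1 * t + 0)) (dg (-1 * y + 0) * -1).
  exact: (@is_derive1_comp R g (fun t => -1 * t + 0) y _ _ (Dg _) (is_derive_affine (-1) 0 y)).
have g0' : g (-1 * 0 + 0) = 0 by rewrite mulr0 addr0.
have nx : 0 <= - x by lra.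
have := derive_bound nx g0' b0 Dg' Db; rewrite mulN1r opprK addr0; apply => y y0.
rewrite normrM normrN1 mulr1 addr0 mulN1r /dg; apply: le_trans (IH _ _) _.
by rewrite normrN (ger0_norm y0).
Qed.

End CosineTaylor.

(** * Polynomial majorants of bounded continuous functions in Gaussian mean *)

Section GaussianApproximation.
Variables (R : realType) (v : R).
Hypothesis v0 : 0 <= v.
Local Notation sd := (Num.sqrt v).
Implicit Types (u w h : R -> R) (p P D : {poly R}).

Definition gauss_poly P := gauss_mean (fun y => P.[sd * y]).

Lemma admissible_scaled P : admissible (fun y => P.[sd * y]).
Proof.
have -> : (fun y => P.[sd * y]) = (fun y => (P \Po (sd *: 'X)).[y]).
  by apply/funext => y; rewrite horner_comp hornerZ hornerX.
exact: admissible_poly.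
Qed.

Lemma gauss_poly_lin c P D : gauss_poly (c *: P + D) = c * gauss_poly P + gauss_poly D.
Proof.
rewrite -gauss_mean_lin; try exact: admissible_scaled.
by congr gauss_mean; apply/funext => y; rewrite !hornerE.
Qed.

Lemma gauss_poly0 : gauss_poly 0 = 0.
Proof. by have := gauss_poly_lin (-1) 0 0; rewrite scaler0 addr0; lra. Qed.

Lemma gauss_polyZ c P : gauss_poly (c *: P) = c * gauss_poly P.
Proof. by have := gauss_poly_lin c P 0; rewrite gauss_poly0 !addr0. Qed.

Lemma gauss_polyXn i : gauss_poly 'X^i = gaussian_moment v i.
Proof.
have -> : gauss_poly 'X^i = sd ^+ i * normal_moment R i.
  rewrite -gauss_mean_pow /gauss_poly.
  have -> : (fun y => 'X^i.[sd * y]) = (fun y => sd ^+ i * ('X^i).[y] + (0 : {poly R}).[y]).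
    by apply/funext => y; rewrite !hornerXn horner0 addr0 exprMn.
  rewrite gauss_mean_lin; try exact: admissible_poly.
  have -> : gauss_mean (fun y => (0 : {poly R}).[y]) = 0.
    rewrite /gauss_mean; under eq_Rintegral do rewrite horner0 mul0r.
    by rewrite Rintegral_cst// mul0r.
  rewrite addr0; congr (_ * gauss_mean _).
  by apply/funext => y; rewrite hornerXn.
elim/ltn_ind: i => -[|[|m]] IH /=; rewrite ?mulr0 ?expr0 ?mulr1//.
rewrite -(IH m)// -{2}(sqr_sqrtr v0) !exprS; ring.
Qed.

Lemma gauss_polyE P : gauss_poly P = \sum_(i < size P) P`_i * gaussian_moment v i.
Proof.
rewrite -[in LHS](coefK P) poly_def.
elim: (size P) => [|n IH]; first by rewrite !big_ord0 gauss_poly0.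
by rewrite !big_ord_recr/= addrC gauss_poly_lin IH gauss_polyXn addrC.
Qed.

(** Approximation on the whole line, with a polynomial error bound instead of a uniform one: [P + D]
    and [P - D] enclose [u], and their means depend on moments only. *)
Definition gauss_approximable u := forall e, 0 < e -> exists P D,
  (forall x, `|u x - P.[x]| <= D.[x]) /\ gauss_poly D <= e.

Lemma gauss_approximable0 : gauss_approximable (fun=> 0).
Proof.
move=> e e0; exists 0, 0; split; first by move=> x; rewrite horner0 subrr normr0.
by rewrite gauss_poly0 ltW.
Qed.

Lemma gauss_approximable_lin c u w : gauss_approximable u -> gauss_approximable w ->
  gauss_approximable (fun x => c * u x + w x).
Proof.
move=> hu hw e e0; have c0 : 0 < 2 * (`|c| + 1) by rewrite mulr_gt0// ltr_pwDr.
have [P1 [D1 [h1 g1]]] := hu _ (divr_gt0 e0 c0).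
have e2 : 0 < e / 2 by rewrite divr_gt0.
have [P2 [D2 [h2 g2]]] := hw _ e2.
exists (c *: P1 + P2), (`|c| *: D1 + D2); split => [x|].
  rewrite !(hornerD, hornerZ).
  have -> : c * u x + w x - (c * P1.[x] + P2.[x]) = c * (u x - P1.[x]) + (w x - P2.[x]) by ring.
  by apply: le_trans (ler_normD _ _) _; rewrite normrM lerD// ler_wpM2l.
rewrite gauss_poly_lin.
have : `|c| * gauss_poly D1 <= e / 2.
  apply: le_trans (ler_wpM2l (normr_ge0 c) g1) _.
  rewrite mulrCA ler_pM2l// ler_pdivrMr//; have := normr_ge0 c; lra.
lra.
Qed.

(** The right side is a term of the exponential series and tends to 0. This growth bound on the
    moments is what lets them control bounded functions. *)
Lemma gauss_moment_even N : gaussian_moment v (N.*2) / (N.*2)`!%:R = (v / 2) ^+ N / N`!%:R.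
Proof.
elim: N => [//|N IH]; rewrite doubleS [gaussian_moment _ _]/= !factS !natrM exprS.
have n0 : N.*2.+1%:R != 0 :> R by rewrite pnatr_eq0.
have n1 : N.+1%:R != 0 :> R by rewrite pnatr_eq0.
have f0 : N.*2`!%:R != 0 :> R by rewrite pnatr_eq0 -lt0n fact_gt0.
have f1 : N`!%:R != 0 :> R by rewrite pnatr_eq0 -lt0n fact_gt0.
have -> : N.*2.+2%:R = 2 * N.+1%:R :> R by rewrite -natrM -doubleS -muln2 mulnC.
have -> : v / 2 * (v / 2) ^+ N / (N.+1%:R * N`!%:R) = v / 2 / N.+1%:R * ((v / 2) ^+ N / N`!%:R).
  by field; rewrite ?nat1r f1 n1.
by rewrite -IH; field; rewrite ?nat1r f0 n0 n1.
Qed.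

(** An even order [N.*2] makes the Taylor error bound itself a polynomial, and its Gaussian mean is
    a term of the series of exp(a^2 v / 2). *)
Lemma gauss_approximable_wave (a ph : R) : gauss_approximable (fun x => cos (a * x + ph)).
Proof.
move=> e e0.
have := @cvg_exp_coeff R (a ^+ 2 * v / 2) => /cvgrPdist_le/(_ _ e0)[N _ /(_ N (leqnn N))].
rewrite sub0r normrN => hN.
exists (cos_taylor N.*2 ph \Po (a *: 'X)), ((a ^+ N.*2 / (N.*2)`!%:R) *: 'X^(N.*2)).
split => [x|].
  rewrite horner_comp !hornerZ hornerX hornerXn [a * x + ph]addrC; apply: le_trans (cos_taylorP _ _ _) _.
  have -> : `|a * x| ^+ N.*2 = a ^+ N.*2 * x ^+ N.*2.
    by rewrite -normrX ger0_norm ?exprn_even_ge0 ?odd_double// exprMn.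
  by rewrite mulrAC.
rewrite gauss_polyZ gauss_polyXn -mulrA [_^-1 * _]mulrC gauss_moment_even.
have -> : a ^+ N.*2 * ((v / 2) ^+ N / N`!%:R) = exp_coeff (a ^+ 2 * v / 2) N.
  have -> : a ^+ N.*2 = (a ^+ 2) ^+ N by rewrite -exprM mul2n.
  by rewrite mulrA -exprMn mulrA.
exact: le_trans (ler_norm _) hN.
Qed.

(** The extra cosine factor closes the induction: one sine times a wave splits into two waves of
    frequencies [a + b] and [a - b]. *)
Lemma gauss_approximable_sin_pow (b : R) k a ph :
  gauss_approximable (fun x => sin (b * x) ^+ k * cos (a * x + ph)).
Proof.
elim: k a ph => [|k IH] a ph.
  have := gauss_approximable_wave a ph; congr gauss_approximable.
  by apply/funext => x; rewrite expr0 mul1r.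
have h := gauss_approximable_lin (2^-1) (IH (a + b) (ph - pi / 2))
  (gauss_approximable_lin (- 2^-1) (IH (a - b) (ph - pi / 2)) gauss_approximable0).
move: h; congr gauss_approximable; apply/funext => x.
rewrite addr0 exprSr !addrA !cosBpihalf.
have -> : (a + b) * x + ph = (a * x + ph) + b * x by ring.
have -> : (a - b) * x + ph = (a * x + ph) - b * x by ring.
by rewrite !sinD cosN sinN; field.
Qed.

Lemma gauss_approximable_sin_poly (b : R) P : gauss_approximable (fun x => P.[sin (b * x)]).
Proof.
have -> : (fun x => P.[sin (b * x)]) = (fun x => \sum_(i < size P) P`_i * sin (b * x) ^+ i).
  by apply/funext => x; rewrite horner_coef.
elim: (size P) => [|n IH].
  by under eq_fun do rewrite big_ord0; exact: gauss_approximable0.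
under eq_fun do rewrite big_ord_recr/= addrC.
apply: gauss_approximable_lin => //.
have := gauss_approximable_sin_pow b n 0 0; congr gauss_approximable.
by apply/funext => x; rewrite mul0r addr0 cos0 mulr1.
Qed.

Lemma gauss_polyC c : gauss_poly (c%:P) = c.
Proof.
have -> : c%:P = c *: 'X^0 + 0 :> {poly R} by rewrite expr0 addr0 alg_polyC.
by rewrite gauss_poly_lin gauss_poly0 gauss_polyXn /= mulr1 addr0.
Qed.

Lemma gauss_poly_mono_fun P u : admissible (fun y => u (sd * y)) -> (forall x, P.[x] <= u x) ->
  gauss_poly P <= gauss_expect v u.
Proof.
move=> au Pu; apply: gauss_mean_le => //; exact: admissible_scaled.
Qed.

(* On [-L, L] the function h is a continuous function of sin (x pi / 4 L), hence uniformly
   close to a polynomial in that sine, which stays bounded on the whole line. *)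
Lemma sine_approximation h M e L : continuous h -> 0 < L -> 0 < e -> (forall x, `|h x| <= M) ->
  exists W b, (forall x, `|x| <= L -> `|h x - W.[sin (b * x)]| <= e) /\
              (forall x, `|W.[sin (b * x)]| <= M + e).
Proof.
move=> ch L0 e0 hM; have pi0 := pi_gt0 R.
pose k := sin (pi / 4) : R.
have k1 : k < 1.
  rewrite /k -[ltRHS](sin_pihalf R) ltr_sin ?in_itv/=; lra.
have k0 : 0 < k by apply: sin_gt0_pihalf; lra.
(* Projection onto [-k, k] with k = sin(pi / 4) < 1. It keeps [asin] where it is continuous, so [G]
   is continuous everywhere and bounded like [h]. *)
pose clamp (t : R) := (`|t + k| - `|t - k|) / 2.
have clampk t : `|t| <= k -> clamp t = t.
  rewrite ler_norml => /andP[t1 t2]; rewrite /clamp ger0_norm ?ler0_norm; lra.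
have clamp_le t : `|clamp t| <= k.
  rewrite /clamp normrM [`|2^-1|]ger0_norm ?invr_ge0//.
  have := ler_dist_dist (t + k) (t - k).
  have -> : t + k - (t - k) = 2 * k by ring.
  have k20 : 0 <= 2 * k by lra.
  by rewrite (ger0_norm k20) => hh; rewrite ler_pdivrMr// mulrC.
pose G t := h (4 * L / pi * asin (clamp t)).
have cG : continuous G.
  have cc : continuous clamp.
    move=> t; apply: cvgM; last exact: cvg_cst.
    apply: cvgB; apply: cvg_norm.
      by apply: cvgD; [exact: cvg_id|exact: cvg_cst].
    by apply: cvgB; [exact: cvg_id|exact: cvg_cst].
  have ca : continuous (fun t => 4 * L / pi * asin (clamp t)).
    move=> t; apply: cvgM; first exact: cvg_cst.
    apply: (continuous_comp (cc t)); apply: continuous_asin.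
    have := clamp_le t; rewrite ler_norml => /andP[]; lra.
  by move=> t; exact: (continuous_comp (ca t) (ch _)).
have [W hW] := weierstrass cG ltr01 e0.
have sin1 (x : R) : `|sin x| <= 1 by rewrite ler_norml sin_geN1 sin_le1.
exists W, (pi / (4 * L)); split => x.
  move=> xL; set th := pi / (4 * L) * x.
  have thL : `|th| <= pi / 4.
    have b0 : 0 <= pi / (4 * L) by rewrite divr_ge0 ?(ltW pi0)// mulr_ge0// ltW.
    rewrite /th normrM (ger0_norm b0).
    have -> : pi / (4 * L) * `|x| = pi / 4 * (`|x| / L) by field; rewrite gt_eqF.
    by rewrite -[leRHS]mulr1 ler_wpM2l ?(divr_ge0 (ltW pi0))// ler_pdivrMr// mul1r.
  have := thL; rewrite ler_norml => /andP[th1 th2].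
  have sk : `|sin th| <= k.
    rewrite ler_norml; apply/andP; split; last first.
      by rewrite /k leNgt ltr_sin ?in_itv/=; lra.
    rewrite /k -sinN leNgt ltr_sin ?in_itv/=; lra.
  have hG : G (sin th) = h x.
    rewrite /G clampk// sinK ?in_itv/=; last lra.
    congr h; rewrite /th; move: (pi : R) pi0 => c c0; field.
    by rewrite (gt_eqF L0) (gt_eqF c0).
  by rewrite -hG; exact: hW.
have h1 := hW _ (sin1 (pi / (4 * L) * x)).
have h2 := hM (4 * L / pi * asin (clamp (sin (pi / (4 * L) * x)))).
rewrite -/(G _) in h2; set w := W.[_] in h1 *; set gg := G _ in h1 h2.
have -> : w = gg - (gg - w) by ring.
by apply: le_trans (ler_normB _ _) _; exact: lerD.
Qed.

Lemma admissible_continuous u M : continuous u -> (forall x, `|u x| <= M) -> admissible u.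
Proof.
move=> cu uM; split; first exact: continuous_measurable_fun.
by exists M%:P => x; rewrite hornerC.
Qed.

Lemma gauss_upper_poly h M e : continuous h -> (forall x, `|h x| <= M) -> 0 < e ->
  exists P, (forall x, h x <= P.[x]) /\ gauss_poly P <= gauss_expect v h + e.
Proof.
move=> ch hM e0; have M0 : 0 <= M by apply: le_trans (hM 0); exact: normr_ge0.
pose d := Num.min 1 (e / 8); have d0 : 0 < d by rewrite lt_min ltr01 divr_gt0.
have d1 : d <= 1 by rewrite ge_min lexx.
have d8 : d <= e / 8 by rewrite ge_min lexx orbT.
(* Chosen so that [A * v <= e / 8]: outside [-L, L] the term [A * x ^+ 2] dominates
   [2 * M + 1 >= |h - u|], and its Gaussian mean [A * v] must stay small. *)
pose L := 1 + 8 * (2 * M + 1) * v / e.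
have M1 : 0 <= 2 * M + 1 by lra.
have L1 : 1 <= L.
  by rewrite lerDl; apply: divr_ge0; [apply: mulr_ge0 => //; exact: mulr_ge0|exact: ltW].
have L0 : 0 < L by lra.
pose A := (2 * M + 1) / L ^+ 2.
have A0 : 0 <= A by apply: divr_ge0 => //; exact: sqr_ge0.
have Av : A * v <= e / 8.
  rewrite /A mulrAC ler_pdivrMr ?exprn_gt0//.
  have h1 : (2 * M + 1) * v = e / 8 * (L - 1) by rewrite /L; field; rewrite gt_eqF.
  rewrite h1 ler_pM2l ?divr_gt0//; rewrite expr2; nra.
have [W [b [hW Wb]]] := sine_approximation ch L0 d0 hM.
pose u x := W.[sin (b * x)].
have out x : ~~ (`|x| <= L) -> 2 * M + 1 <= A * x ^+ 2.
  rewrite -ltNge => xL; rewrite /A mulrAC ler_pdivlMr ?exprn_gt0//.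
  apply: ler_wpM2l => //.
  by rewrite -[x ^+ 2]real_normK ?num_real// lerXn2r ?nnegrE// ltW.
have hu x : h x <= u x + d + A * x ^+ 2.
  have Ax : 0 <= A * x ^+ 2 by rewrite mulr_ge0// sqr_ge0.
  have [xL|/out xL] := boolP (`|x| <= L).
    by have := hW x xL; rewrite ler_norml => /andP[_]; rewrite -/(u x); lra.
  have := hM x; have := Wb x; rewrite -/(u x) !ler_norml => /andP[? ?] /andP[? ?]; lra.
have uh x : u x <= h x + d + A * x ^+ 2.
  have Ax : 0 <= A * x ^+ 2 by rewrite mulr_ge0// sqr_ge0.
  have [xL|/out xL] := boolP (`|x| <= L).
    by have := hW x xL; rewrite ler_norml => /andP[+ _]; rewrite -/(u x); lra.
  have := hM x; have := Wb x; rewrite -/(u x) !ler_norml => /andP[? ?] /andP[? ?]; lra.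
have e8 : 0 < e / 8 by rewrite divr_gt0.
have [P [D [PD gD]]] := gauss_approximable_sin_poly b W e8.
pose q : {poly R} := A *: 'X^2 + d%:P.
have qE x : q.[x] = A * x ^+ 2 + d by rewrite /q !hornerE.
have gq : gauss_poly q <= e / 4.
  by rewrite /q gauss_poly_lin gauss_polyXn /= mul1r mulr1 gauss_polyC; lra.
clearbody q.
exists (1 *: P + (1 *: D + q)); split => [x|].
  have := PD x; rewrite !(hornerD, hornerZ) qE !mul1r ler_norml => /andP[_].
  by have := hu x; rewrite /u; lra.
have ah : admissible (fun y => h (sd * y)).
  apply: (@admissible_continuous _ M) => [x|x]; last exact: hM.
  apply: (@continuous_comp _ _ _ (fun y => sd * y) h); last exact: ch.
  by apply: cvgM; [exact: cvg_cst|exact: cvg_id].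
(* The minorant P - D - q of [h] bounds the mean of [P] from above, so the majorant P + D + q loses
   at most twice the mean of D + q. *)
have lo : gauss_poly (1 *: P + -1 *: (1 *: D + q)) <= gauss_expect v h.
  apply: gauss_poly_mono_fun => // x; rewrite !(hornerD, hornerZ) qE.
  have := PD x; rewrite ler_norml => /andP[+ _]; have := uh x; rewrite /u; lra.
move: lo; rewrite !gauss_poly_lin gauss_polyZ gauss_poly_lin; lra.
Qed.

End GaussianApproximation.

(** * Limits along the subsequence: moments, variances and the convergence in law *)

Section Asymptotics.
Variables (R : realType) (mu : nat -> {measure set R -> \bar R}) (psi : nat -> nat -> R -> R).
Variables (Nn : nat -> nat) (J : nat -> nat -> nat -> R) (b B : nat) (Q : {poly R}) (s : int -> R).
Local Notation integ j g := ((mu j).-integrable setT (EFin \o g)).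
Hypothesis leNn : forall j, (j <= Nn j)%N.
Hypothesis int1 : forall n j k, integ n (fun x => psi n j x * psi n k x).
Hypothesis orth : forall n j k, Rintegral (mu n) setT (fun x => psi n j x * psi n k x) = (j == k)%:R.
Hypothesis Jband : forall n j k, (b < absz (j%:Z - k%:Z))%N -> J n j k = 0.
Hypothesis Jrec : forall n j x, x * psi n j x = \sum_(k < j + b + 1) J n j k * psi n k x.
Hypothesis bQ : (b * size Q <= B)%N.
Hypothesis J_lim : laurent_limit Nn (fun n => polyJ b Q (J n)) s.

Local Notation entry n g := (mxelt (mu n) (psi n) g).
Local Notation mean n g := (linstat_mean (mu n) (psi n) (Nn n) g).
Local Notation var n g := (linstat_var (mu n) (psi n) (Nn n) g).
Local Notation averages n := (averages_to (mu n) (psi n) (Nn n)).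
Local Notation sp := (laurent_poly B s).

Lemma moment_adm n g : admissible g -> moment_fun (mu n) (psi n) g.
Proof. by move=> h; apply: (moment_admissible (b := b) (J := J n)). Qed.

Lemma entry_lim_pow i : laurent_limit Nn (fun n => entry n (fun x => Q.[x] ^+ i)) (laurent_pow B s i).
Proof.
have Q_lim : laurent_limit Nn (fun n => entry n (fun x => Q.[x])) s.
  have -> : (fun n => entry n (fun x => Q.[x])) = (fun n => polyJ b Q (J n)).
    apply/funext => n; apply/funext => j; apply/funext => k.
    exact: (mxelt_poly (int1 n) (orth n) (@Jband n) (Jrec n)).
  exact: J_lim.
elim: i => [|i IH].
  apply: (laurent_limit1 leNn) => n x y; rewrite -(orth n) /mxelt.
  by apply: eq_Rintegral => z _; rewrite expr0 mul1r.
apply: (laurent_limit_mul leNn _ _ Q_lim IH) => n.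
  exact: (banded_mxelt (int1 n) (orth n) (Jrec n)).
move=> x y; rewrite -(mxelt_mul (int1 n) (orth n) (Jrec n) y); last 2 first.
- by lia.
- by have := moment_adm n (admissible_poly (Q ^+ i)); congr moment_fun; apply/funext => z; rewrite horner_exp.
by rewrite /mxelt; apply: eq_Rintegral => z _; rewrite exprS.
Qed.

Lemma entry_lim_poly (p : {poly R}) :
  laurent_limit Nn (fun n => entry n (fun x => (p \Po Q).[x])) (sp p).
Proof.
have -> : (fun n => entry n (fun x => (p \Po Q).[x])) =
   (fun n j k => \sum_(i < size p) p`_i * entry n (fun x => Q.[x] ^+ i) j k).
  apply/funext => n; apply/funext => j; apply/funext => k; rewrite /mxelt.
  have mX i : integ n (fun x => Q.[x] ^+ i * (psi n j x * psi n k x)).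
    have := moment_adm n (admissible_poly (Q ^+ i)) j k.
    by congr integrable; apply/funext => z /=; rewrite horner_exp.
  have -> : (fun x => (p \Po Q).[x] * (psi n j x * psi n k x)) =
     (fun x => \sum_(i < size p) p`_i * (Q.[x] ^+ i * (psi n j x * psi n k x))).
    apply/funext => y; rewrite horner_comp horner_coef mulr_suml.
    by apply: eq_bigr => i _; rewrite mulrA.
  rewrite Rintegral_ordsum => [|l]; last exact: integrable_scale.
  by apply: eq_bigr => l _; rewrite RintegralZl.
by apply: laurent_limit_sum => i; exact: entry_lim_pow.
Qed.

Lemma sp_even p (d : int) : sp p (- d) = sp p d.
Proof.
have sym n x y : entry n (fun x => (p \Po Q).[x]) x y = entry n (fun x => (p \Po Q).[x]) y x.
  exact: mxelt_sym.
exact: (laurent_limit_sym sym (@entry_lim_poly p)).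
Qed.

(** A common width for two objects: the first entry bounds the band of the finite matrix of
    [p \Po Q], the second the support of its limit symbol. *)
Definition band_of (p : {poly R}) := maxn (b * size (p \Po Q)) (size p * B).
Definition limit_var (p : {poly R}) := laurent_variance (band_of p) (sp p).

Lemma sp_supp p d : (band_of p < absz d)%N -> sp p d = 0.
Proof. by move=> hd; apply: laurent_poly_supp => //; apply: leq_ltn_trans hd; rewrite leq_maxr. Qed.

Definition nth_moment (p : {poly R}) (m n : nat) : R :=
  vacuum_moment (band_of p) (entry n (fun x => (p \Po Q).[x])) m (@nat_of_ord (Nn n)).

Lemma nth_moment_step p m :
  (fun n => nth_moment p m.+1 n - m%:R * limit_var p * nth_moment p m.-1 n) @ \oo --> (0 : R).
Proof.
have [S hS] := int_support_bounded (@sp_supp p).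
have [rr [K [K0 H]]] := vacuum_moment_rec (@sp_supp p) hS m.
apply/cvgrPdist_le => e e0; pose eps := Num.min 1 (e / (K + 1)).
have K1 : 0 < K + 1 by lra.
have eps0 : 0 < eps by rewrite lt_min ltr01 divr_gt0.
have nl := near_laurent_eventually leNn (@entry_lim_poly p) rr eps0.
near=> n; rewrite sub0r normrN.
apply: le_trans (H (Nn n) (entry n (fun x => (p \Po Q).[x])) eps _) _.
  split.
  - by apply: (banded_mxelt (int1 n) (orth n) (Jrec n)); rewrite leq_maxl.
  - exact: ltW.
  - by rewrite ge_min lexx.
  - by apply: leq_trans (leNn n); near: n; exists rr.
  - by near: n.
have h : eps <= e / (K + 1) by rewrite ge_min lexx orbT.
rewrite ler_pdivlMr// in h; apply: le_trans h; rewrite mulrC ler_pM2l//; lra.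
Unshelve. all: by end_near. Qed.

Lemma nth_moment_cvg p m : nth_moment p m n @[n --> \oo] --> gaussian_moment (limit_var p) m.
Proof.
have h0 : nth_moment p 0 n @[n --> \oo] --> (1 : R).
  by rewrite /nth_moment /=; under eq_fun do rewrite vacuum_id; exact: cvg_cst.
elim/ltn_ind: m => -[|[|m]] IH //.
  rewrite /= (_ : nth_moment p 1 = fun n => nth_moment p 1 n - 0%:R * limit_var p * nth_moment p 0 n).
    exact: nth_moment_step.
  by apply/funext => n; rewrite !mul0r subr0.
have h1 := nth_moment_step p m.+1.
have h2 : m.+1%:R * limit_var p * nth_moment p m n @[n --> \oo] -->
    m.+1%:R * limit_var p * gaussian_moment (limit_var p) m.
  by apply: cvgM; [exact: cvg_cst|exact: IH].
have h3 := cvgD h1 h2; rewrite add0r in h3.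
have -> : nth_moment p m.+2 = (fun n => nth_moment p m.+2 n -
    m.+1%:R * limit_var p * nth_moment p m.+1.-1 n) \+
    (fun n => m.+1%:R * limit_var p * nth_moment p m n).
  by apply/funext => n; rewrite /= subrK.
exact: h3.
Qed.

Lemma average_centered_pow (p : {poly R}) m n :
  averages n (fun x => (linstat (Nn n) (fun y => (p \Po Q).[y]) x - mean n (fun y => (p \Po Q).[y])) ^+ m)
    (nth_moment p m n).
Proof.
by apply: (average_poly_moment (int1 n) (orth n) (Jrec n)); rewrite leq_maxl.
Qed.

(** The variance and the second vacuum moment are certified averages of the same observable, hence
    equal. *)
Lemma var_poly_cvg (p : {poly R}) : var n (fun y => (p \Po Q).[y]) @[n --> \oo] --> limit_var p.
Proof.
have := @nth_moment_cvg p 2; rewrite /= mul1r mulr1.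
have -> : nth_moment p 2 = fun n => var n (fun y => (p \Po Q).[y]); last by [].
apply/funext => n.
have a := admissible_poly (p \Po Q).
have h := average_variance (int1 n) (orth n) (Nn n) (moment_adm n a) (moment_adm n (admissible_sqr a)).
rewrite -(averages_to_expect (int1 n) (orth n) h).
by rewrite -[LHS](averages_to_expect (int1 n) (orth n) (average_centered_pow p 2 n)).
Qed.

Lemma average_poly_centered (P p : {poly R}) n :
  averages n (fun x => P.[linstat (Nn n) (fun y => (p \Po Q).[y]) x - mean n (fun y => (p \Po Q).[y])])
    (\sum_(i < size P) P`_i * nth_moment p i n).
Proof.
under eq_fun do rewrite horner_coef.
apply: averages_to_sum => i; apply: averages_to_scale => //; exact: average_centered_pow.
Qed.

Variable E : set R.
Hypothesis compactE : compact E.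
Hypothesis tail0 : forall k : nat, (fun n => \sum_(j < Nn n)
   Rintegral (mu n) (~` E) (fun x => x ^+ k * psi n j x * psi n j x)) @ \oo --> (0 : R).

Lemma tail_poly_cvg (r : {poly R}) :
  \sum_(a < Nn n) entry n (fun x => \1_(~` E) x * r.[x]) a a @[n --> \oo] --> (0 : R).
Proof.
have mE : measurable (~` E) by apply: measurableC; exact: compact_measurable.
have -> : (fun n => \sum_(a < Nn n) entry n (fun x => \1_(~` E) x * r.[x]) a a) =
  (fun n => \sum_(i < size r) r`_i * \sum_(j < Nn n)
     Rintegral (mu n) (~` E) (fun x => x ^+ i * psi n j x * psi n j x)).
  apply/funext => n; under [RHS]eq_bigr do rewrite mulr_sumr.
  rewrite exchange_big; apply: eq_bigr => a _ /=.
  have iX i : integ n (fun x => \1_(~` E) x * x ^+ i * (psi n a x * psi n a x)).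
    apply: moment_adm; apply: admissibleM; first exact: admissible_indic.
    have -> : (fun x : R => x ^+ i) = (fun x => ('X^i).[x]).
      by apply/funext => x; rewrite hornerXn.
    exact: admissible_poly.
  rewrite /mxelt; have -> : (fun x => \1_(~` E) x * r.[x] * (psi n a x * psi n a x)) =
     (fun x => \sum_(i < size r) r`_i * (\1_(~` E) x * x ^+ i * (psi n a x * psi n a x))).
    apply/funext => x; rewrite horner_coef mulr_sumr mulr_suml.
    by apply: eq_bigr => i _; ring.
  rewrite Rintegral_ordsum => [|i]; last exact: integrable_scale.
  apply: eq_bigr => i _; rewrite RintegralZl//; congr (_ * _).
  rewrite [RHS]Rintegral_mkcond; apply: eq_Rintegral => x _.
  rewrite /patch indicE; case: (x \in _); last by rewrite !mul0r.
  by rewrite mul1r mulrA.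
have e0 : \sum_(i < size r) r`_i * 0 = 0 :> R by rewrite big1// => i _; rewrite mulr0.
rewrite -[X in _ --> X]e0.
by apply: cvg_ordsum => i; apply: cvgM; [exact: cvg_cst|exact: tail0].
Qed.

(** When both points lie in [E] the Lipschitz bound compares [g] with [Q] directly. The other pairs
    are charged to a function supported outside [E] and dominated by a polynomial, whose trace tends
    to 0. *)
Lemma var_lipschitz (g : R -> R) (eta L : R) : 0 <= eta -> 0 <= L ->
  admissible (fun x => g Q.[x]) ->
  (forall x, E x -> `|Q.[x]| <= L) ->
  (forall x y, `|x| <= L -> `|y| <= L -> `|g x - g y| <= eta * `|x - y|) ->
  forall e, 0 < e -> \forall n \near \oo, var n (fun x => g Q.[x]) <= eta ^+ 2 * limit_var 'X + e.
Proof.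
move=> eta0 L0 ag QL lip e e0.
have mE : measurable (~` E) by apply: measurableC; exact: compact_measurable.
pose C0 := (`|g 0| + eta * L) ^+ 2.
have gC y : `|y| <= L -> g y ^+ 2 <= C0.
  move=> yL; rewrite -(real_normK (num_real (g y))); apply: lerXn2r; rewrite ?nnegrE//.
    by rewrite addr_ge0// mulr_ge0.
  rewrite -[g y](subrK (g 0)) addrC; apply: le_trans (ler_normD _ _) _; rewrite lerD2l.
  apply: le_trans (lip y 0 yL _) _; first by rewrite normr0.
  by rewrite subr0 ler_wpM2l.
have C00 : 0 <= C0 by exact: sqr_ge0.
(* From (u - v)^2 <= 2 u^2 + 2 v^2; the constant [2 * C0] pays for the other point when that one
   lies in [E]. *)
pose w x := 2 * g Q.[x] ^+ 2 + 2 * C0.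
have aw : admissible w.
  have a2 := admissible_sqr ag; have a1 := admissible_poly (2 *: 1 : {poly R}).
  have a0 := admissible_poly (2 * C0)%:P.
  have := admissibleD (admissibleM a1 a2) a0.
  have -> // : (fun x => (2 *: 1 : {poly R}).[x] * g Q.[x] ^+ 2 + ((2 * C0)%:P).[x]) = w.
  by apply/funext => x; rewrite /w hornerZ !hornerC mulr1.
have [_ [r hr]] := aw.
pose th x := \1_(~` E) x * w x.
have ath : admissible th by apply: admissibleM => //; exact: admissible_indic.
have athr : admissible (fun x => \1_(~` E) x * r.[x]).
  by apply: admissibleM; [exact: admissible_indic|exact: admissible_poly].
have w0 x : 0 <= w x by rewrite addr_ge0// mulr_ge0// sqr_ge0.
have cmp x y : (g Q.[x] - g Q.[y]) ^+ 2 <= eta ^+ 2 * (Q.[x] - Q.[y]) ^+ 2 + (th x + th y).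
  have sq u v : (u - v) ^+ 2 <= 2 * u ^+ 2 + 2 * v ^+ 2 :> R.
    by have := sqr_ge0 (u + v); rewrite !expr2; nra.
  have q0 : 0 <= eta ^+ 2 * (Q.[x] - Q.[y]) ^+ 2 by rewrite mulr_ge0// sqr_ge0.
  have thE z : E z -> th z = 0.
    by move=> Ez; rewrite /th indicE memNset ?mul0r//= => /(_ Ez).
  have thN z : ~ E z -> th z = w z.
    by move=> Ez; rewrite /th indicE mem_set ?mul1r.
  have := sq (g Q.[x]) (g Q.[y]).
  have [Ex|Ex] := pselect (E x); have [Ey|Ey] := pselect (E y).
  - move=> _; rewrite !thE// !addr0 -exprMn -real_normK ?num_real// -[leRHS]real_normK ?num_real//.
    apply: lerXn2r; rewrite ?nnegrE// normrM (ger0_norm eta0); apply: lip; exact: QL.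
  - rewrite (thE x)// (thN y)// /w; have := gC _ (QL _ Ex); lra.
  - rewrite (thE y)// (thN x)// /w; have := gC _ (QL _ Ey); lra.
  - rewrite !thN// /w; lra.
have hQ : (fun x => ('X \Po Q).[x]) = (fun x => Q.[x]) by rewrite comp_polyX.
have varQ := @var_poly_cvg 'X; rewrite hQ in varQ.
have tl := @tail_poly_cvg r.
have hlim : eta ^+ 2 * var n (fun x => Q.[x]) +
    \sum_(a < Nn n) entry n (fun x => \1_(~` E) x * r.[x]) a a @[n --> \oo] --> eta ^+ 2 * limit_var 'X.
  by rewrite -[X in _ --> X]addr0; apply: cvgD tl; apply: cvgM varQ; exact: cvg_cst.
move/cvgrPdist_le/(_ _ e0) : hlim; apply: filterS => n /= hn.
have aQ := admissible_poly Q.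
have h1 := linstat_var_le (int1 n) (orth n) (Nn n) (moment_adm n ag) (moment_adm n (admissible_sqr ag))
  (moment_adm n aQ) (moment_adm n (admissible_sqr aQ)) (moment_adm n ath) cmp.
have h2 : \sum_(a < Nn n) entry n th a a <=
    \sum_(a < Nn n) entry n (fun x => \1_(~` E) x * r.[x]) a a.
  apply: ler_sum => a _; apply: le_Rintegral => //; [exact: moment_adm|exact: moment_adm|].
  move=> x _; apply: ler_wpM2r; first by rewrite -expr2 sqr_ge0.
  rewrite /th; apply: ler_wpM2l; first by rewrite indicE.
  by apply: le_trans (hr x); exact: ler_norm.
move: hn; rewrite ler_norml => /andP[hn _].
by move: h1 h2 hn; rewrite /GRing.mul/=; lra.
Qed.

Variable L : R.
Hypothesis L1 : 1 <= L.
Hypothesis QL : forall x, E x -> `|Q.[x]| <= L.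
Hypothesis symbolL : forall t, `|symbol B s t| <= L.
Hypothesis s_even : forall d, s (- d) = s d.
Local Notation V := (limit_var 'X).

Definition lip_on (eta : R) (g : R -> R) :=
  forall x y, `|x| <= L -> `|y| <= L -> `|g x - g y| <= eta * `|x - y|.

Definition partial_variance (g : R -> R) (K : nat) : R := \sum_(k < K) k.+1%:R *
  (wave_mean (fun t => g (symbol B s t)) k.+1%:Z 0 ^+ 2 +
   wave_mean (fun t => g (symbol B s t)) k.+1%:Z (- (pi / 2)) ^+ 2).

Lemma partial_variance_poly (p : {poly R}) K :
  partial_variance (fun x => p.[x]) K = \sum_(k < K) k.+1%:R * sp p k.+1%:Z ^+ 2.
Proof.
apply: eq_bigr => k _; rewrite !wave_mean_symbol_poly// cos0 mulr1 cosN cos_pihalf mulr0.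
by rewrite expr0n/= addr0.
Qed.

Lemma limit_varE (p : {poly R}) : limit_var p = partial_variance (fun x => p.[x]) (band_of p).
Proof.
rewrite partial_variance_poly /limit_var laurent_variance_sum => [|d]; last exact: sp_supp.
by apply: eq_bigr => l _; rewrite sp_even expr2.
Qed.

Lemma partial_variance_mono g M N : (M <= N)%N -> partial_variance g M <= partial_variance g N.
Proof.
move=> MN; rewrite /partial_variance.
rewrite -!(big_mkord xpredT (fun k => k.+1%:R *
  (wave_mean (fun t => g (symbol B s t)) k.+1%:Z 0 ^+ 2 +
   wave_mean (fun t => g (symbol B s t)) k.+1%:Z (- (pi / 2)) ^+ 2))).
rewrite (big_cat_nat (n := M) (p := N))//= lerDl sumr_ge0// => k _.
by rewrite mulr_ge0// addr_ge0// sqr_ge0.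
Qed.

Lemma partial_variance_ge0 g K : 0 <= partial_variance g K.
Proof. by apply: sumr_ge0 => k _; rewrite mulr_ge0// addr_ge0// sqr_ge0. Qed.

Lemma limit_var_ge0 p : 0 <= limit_var p.
Proof. by rewrite limit_varE partial_variance_ge0. Qed.

Lemma partial_variance_poly_le (p : {poly R}) K :
  partial_variance (fun x => p.[x]) K <= limit_var p.
Proof.
have [Kb|bK] := leqP K (band_of p); first by rewrite limit_varE partial_variance_mono.
rewrite limit_varE !partial_variance_poly.
rewrite (sum_ord_widen (h := fun k => k.+1%:R * sp p k.+1%:Z ^+ 2) (ltnW bK))// => k hk.
by rewrite sp_supp ?expr0n ?mulr0.
Qed.

Lemma limit_var_lip (p : {poly R}) eta : 0 <= eta -> lip_on eta (fun x => p.[x]) ->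
  limit_var p <= eta ^+ 2 * V.
Proof.
move=> eta0 lip; apply/ler_addgt0Pr => e e0.
have e2 : 0 < e / 2 by rewrite divr_gt0.
have ap : admissible (fun x => p.[Q.[x]]).
  have -> : (fun x => p.[Q.[x]]) = (fun x => (p \Po Q).[x]).
    by apply/funext => x; rewrite horner_comp.
  exact: admissible_poly.
have L0 : 0 <= L := le_trans ler01 L1.
have h1 := var_lipschitz eta0 L0 ap QL lip e2.
have /cvgrPdist_le/(_ _ e2) h2 := @var_poly_cvg p.
have [n [/= a1 a2]] := filter_ex (filterI h1 h2).
have e1 : (fun x => p.[Q.[x]]) = (fun x => (p \Po Q).[x]).
  by apply/funext => x; rewrite horner_comp.
rewrite e1 in a1; move: a2; rewrite ler_norml => /andP[_]; move: a1; lra.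
Qed.

(** Young's inequality (z + y)^2 <= (1 + 1/d) z^2 + (1 + d) y^2: the large factor 1/d falls on the
    part that will be of order d^2. *)
Lemma wave_mean_sq_le (g1 g2 : R -> R) k ph a d : continuous g1 -> continuous g2 -> 0 < d ->
  wave_mean (fun t => a * g1 (symbol B s t) + g2 (symbol B s t)) k ph ^+ 2 <=
  (1 + d^-1) * (a ^+ 2 * wave_mean (fun t => g1 (symbol B s t)) k ph ^+ 2) +
  (1 + d) * wave_mean (fun t => g2 (symbol B s t)) k ph ^+ 2.
Proof.
move=> c1 c2 d0.
have cs (g : R -> R) : continuous g -> continuous (fun t => g (symbol B s t)).
  by move=> cg t; exact: (continuous_comp (@continuous_symbol R B s t) (cg _)).
rewrite wave_mean_lin; [|exact: cs|exact: cs].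
set x := wave_mean _ _ _; set y := wave_mean _ _ _; rewrite -exprMn; set z := a * x.
have : 0 <= (z - d * y) ^+ 2 / d by rewrite divr_ge0 ?sqr_ge0// ltW.
have -> : (z - d * y) ^+ 2 / d = d^-1 * z ^+ 2 - 2 * z * y + d * y ^+ 2.
  by field; rewrite gt_eqF.
have -> : (z + y) ^+ 2 = z ^+ 2 + 2 * z * y + y ^+ 2 by ring.
lra.
Qed.

Lemma partial_variance_le (g1 g2 : R -> R) a d K : continuous g1 -> continuous g2 -> 0 < d ->
  partial_variance (fun x => a * g1 x + g2 x) K <=
  (1 + d^-1) * (a ^+ 2 * partial_variance g1 K) + (1 + d) * partial_variance g2 K.
Proof.
move=> c1 c2 d0; rewrite /partial_variance !mulr_sumr -big_split; apply: ler_sum => k _ /=.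
have h1 := wave_mean_sq_le k.+1%:Z 0 a c1 c2 d0.
have h2 := wave_mean_sq_le k.+1%:Z (- (pi / 2)) a c1 c2 d0.
have k0 : 0 <= k.+1%:R :> R by [].
apply: le_trans (ler_wpM2l k0 (lerD h1 h2)) _.
by rewrite le_eqVlt; apply/orP; left; apply/eqP; ring.
Qed.

Definition poly_approximable (g : R -> R) := forall d, 0 < d -> exists r : {poly R},
  lip_on d (fun x => g x - r.[x]) /\ forall x, `|x| <= L -> `|g x - r.[x]| <= d * L.

Lemma poly_approximable_sub g (p : {poly R}) : poly_approximable g ->
  poly_approximable (fun x => g x - p.[x]).
Proof.
move=> hg d d0; have [r [h1 h2]] := hg d d0; exists (r - p).
have e x : g x - p.[x] - (r - p).[x] = g x - r.[x] by rewrite hornerD hornerN; ring.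
by split => [x y xL yL|x xL]; rewrite !e; [exact: h1|exact: h2].
Qed.

Lemma small_bound (x y c : R) : 0 <= c -> (forall d, 0 < d -> d <= 1 -> x <= y + d * c) -> x <= y.
Proof.
move=> c0 h; apply/ler_addgt0Pr => e e0; pose d := Num.min 1 (e / (c + 1)).
have c1 : 0 < c + 1 by lra.
have d0 : 0 < d by rewrite lt_min ltr01 divr_gt0.
have d1 : d <= 1 by rewrite ge_min lexx.
have de : d <= e / (c + 1) by rewrite ge_min lexx orbT.
apply: le_trans (h d d0 d1) _; rewrite lerD2l.
rewrite ler_pdivlMr// in de; apply: le_trans de; rewrite ler_pM2l//; lra.
Qed.

(** With [K] fixed, the crude sup bound [d ^+ 2 * c1] on the remainder [g - r] suffices although
    [c1] grows with [K]; the polynomial [r] is covered by [limit_var_lip]. Letting d tend to 0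
    leaves a bound independent of [K]. *)
Lemma partial_variance_lip g eta K : continuous g -> 0 <= eta -> poly_approximable g ->
  lip_on eta g -> partial_variance g K <= eta ^+ 2 * V.
Proof.
move=> cg eta0 ag lip; have V0 := limit_var_ge0 'X.
pose c1 := \sum_(k < K) k.+1%:R * (2 * L ^+ 2) : R.
have c10 : 0 <= c1 
  by apply: sumr_ge0 => k _; apply: mulr_ge0 => //; apply: mulr_ge0 => //; exact: sqr_ge0.
(* For [d <= 1], (1 + d) (eta + d)^2 exceeds eta^2 by at most d times (eta^2 + 4 eta + 2), and (d^2
   + d) c1 is at most 2 d c1. *)
pose c := (eta ^+ 2 + 4 * eta + 2) * V + 2 * c1.
have eta2 := sqr_ge0 eta.
have c0 : 0 <= c by rewrite /c addr_ge0// mulr_ge0//; lra.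
apply: (small_bound c0) => d d0 d1; have [r [hl hr]] := ag d d0.
have cr : continuous (fun x => r.[x]) by exact: continuous_horner.
have cN : continuous (fun x => g x - r.[x]).
  by move=> x; apply: cvgB; [exact: cg|exact: cr].
have rlip : lip_on (eta + d) (fun x => r.[x]).
  move=> x y xL yL; have -> : r.[x] - r.[y] = (g x - g y) - ((g x - r.[x]) - (g y - r.[y])) by ring.
  by apply: le_trans (ler_normB _ _) _; rewrite mulrDl lerD// ?lip// hl.
have rV : limit_var r <= (eta + d) ^+ 2 * V by apply: limit_var_lip => //; lra.
have e1 : g = (fun x => 1 * (g x - r.[x]) + r.[x]) by apply/funext => x; ring.
rewrite {1}e1; apply: le_trans (partial_variance_le 1 K cN cr d0) _.
have hN : partial_variance (fun x => g x - r.[x]) K <= d ^+ 2 * c1.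
  rewrite /partial_variance /c1 mulr_sumr; apply: ler_sum => k _.
  have W ph : wave_mean (fun t => g (symbol B s t) - r.[symbol B s t]) k.+1%:Z ph ^+ 2 <= d ^+ 2 * L ^+ 2.
    rewrite -exprMn -real_normK ?num_real//; apply: lerXn2r; rewrite ?nnegrE//.
      by rewrite mulr_ge0//; [exact: ltW|exact: le_trans ler01 L1].
    apply: wave_mean_norm; last by move=> t; apply: hr; exact: symbolL.
    by move=> t; exact: (continuous_comp (@continuous_symbol R B s t) (cN _)).
  rewrite mulrCA ler_wpM2l//; have := W 0; have := W (- (pi / 2)); lra.
have rK := partial_variance_poly_le r K.
rewrite expr1n mul1r.
have t1 : (1 + d^-1) * partial_variance (fun x => g x - r.[x]) K <= (d ^+ 2 + d) * c1.
  have dV : 0 <= 1 + d^-1 by rewrite addr_ge0// invr_ge0 ltW.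
  apply: le_trans (ler_wpM2l dV hN) _.
  have -> // : (1 + d^-1) * (d ^+ 2 * c1) = (d ^+ 2 + d) * c1 by field; rewrite gt_eqF.
have t2 : (1 + d) * partial_variance (fun x => r.[x]) K <= (1 + d) * ((eta + d) ^+ 2 * V).
  by apply: ler_wpM2l; [lra|exact: le_trans rK rV].
have t3 : (1 + d) * (eta + d) ^+ 2 <= eta ^+ 2 + d * (eta ^+ 2 + 4 * eta + 2).
  have dd : d ^+ 2 <= d by rewrite expr2 ler_piMr// ltW.
  have -> : (1 + d) * (eta + d) ^+ 2 =
     eta ^+ 2 + d * eta ^+ 2 + 2 * eta * d + 2 * eta * d ^+ 2 + d ^+ 2 + d * d ^+ 2 by ring.
  have p1 : eta * d ^+ 2 <= eta * d by rewrite ler_wpM2l.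
  have p2 : d * d ^+ 2 <= d by apply: ler_piMr (ltW d0) _; exact: le_trans dd d1.
  lra.
have t4 : (1 + d) * ((eta + d) ^+ 2 * V) <= (eta ^+ 2 + d * (eta ^+ 2 + 4 * eta + 2)) * V.
  by rewrite mulrA ler_wpM2r.
have t5 : (d ^+ 2 + d) * c1 <= d * (2 * c1).
  have dd : d ^+ 2 <= d by rewrite expr2 ler_piMr// ltW.
  have -> : d * (2 * c1) = (d + d) * c1 by ring.
  by rewrite ler_wpM2r// lerD2r.
have -> : eta ^+ 2 * V + d * c = (eta ^+ 2 + d * (eta ^+ 2 + 4 * eta + 2)) * V + d * (2 * c1).
  by rewrite /c; ring.
by rewrite [leRHS]addrC; apply: lerD; [exact: le_trans t1 t5|exact: le_trans t2 t4].
Qed.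

Variable f : R -> R.
Hypothesis f_der : forall x : R, derivable f x 1.
Hypothesis f_C1 : continuous (derive1 f).
Hypothesis fQ_adm : admissible (fun x => f Q.[x]).
Local Notation sigma2 := (limn (partial_variance f)).

Lemma L_gt0 : 0 < L. Proof. exact: lt_le_trans ltr01 L1. Qed.

Lemma continuous_f : continuous f.
Proof. by move=> x; apply: differentiable_continuous; apply/derivable1_diffP. Qed.

Lemma approximable_f : poly_approximable f.
Proof.
by move=> d d0; have [r [h1 h2]] := C1_approx f_der f_C1 L_gt0 d0; exists r.
Qed.

Lemma partial_variance_bounded : exists2 W, 0 <= W & forall K, partial_variance f K <= W.
Proof.
have [eta eta0 lip] := lipschitz_C1 L f_der f_C1.
exists (eta ^+ 2 * V); first by rewrite mulr_ge0 ?sqr_ge0 ?limit_var_ge0.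
by move=> K; apply: partial_variance_lip => //; [exact: continuous_f|exact: approximable_f].
Qed.

Lemma partial_variance_cvg : cvgn (partial_variance f).
Proof.
have [W _ hW] := partial_variance_bounded.
apply: nondecreasing_is_cvgn; first by move=> M N; exact: partial_variance_mono.
by exists W => _ [K _ <-].
Qed.

Lemma partial_variance_le_sigma2 K : partial_variance f K <= sigma2.
Proof.
apply: nondecreasing_cvgn_le; last exact: partial_variance_cvg.
by move=> M N; exact: partial_variance_mono.
Qed.

Lemma sigma2_le W : (forall K, partial_variance f K <= W) -> sigma2 <= W.
Proof.
by move=> hW; apply: limr_le; [exact: partial_variance_cvg|exact: nearW].
Qed.

Lemma sigma2_ge0 : 0 <= sigma2.
Proof. exact: le_trans (partial_variance_ge0 f 0) (partial_variance_le_sigma2 0). Qed.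

(** Since [f - p] is [d]-Lipschitz on [-L, L], its partial variances are at most [d ^+ 2 * V] for
    all [K]. Young's inequality used in both directions then compares [sigma2] with [limit_var p],
    with an error linear in [d]. *)
Lemma sigma2_approx : exists2 c, 0 <= c & forall d, 0 < d -> d <= 1 ->
  exists2 p : {poly R}, lip_on d (fun x => f x - p.[x]) & `|limit_var p - sigma2| <= d * c.
Proof.
have V0 := limit_var_ge0 'X; have sg0 := sigma2_ge0.
have [eta eta0 flip] := lipschitz_C1 L f_der f_C1.
pose W := (eta + 1) ^+ 2 * V.
have W0 : 0 <= W by rewrite mulr_ge0// sqr_ge0.
exists (2 * V + W + sigma2); first by rewrite !addr_ge0// mulr_ge0.
move=> d d0 d1; have [p [hl _]] := approximable_f d0; exists p => //.
have cf := continuous_f; have cp : continuous (fun x => p.[x]) by exact: continuous_horner.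
have cN : continuous (fun x => f x - p.[x]).
  by move=> x; apply: cvgB; [exact: cf|exact: cp].
have dV : 0 <= 1 + d^-1 by rewrite addr_ge0// invr_ge0 ltW.
have hN K : (1 + d^-1) * partial_variance (fun x => f x - p.[x]) K <= d * (2 * V).
  have h := partial_variance_lip K cN (ltW d0) (poly_approximable_sub p approximable_f) hl.
  apply: le_trans (ler_wpM2l dV h) _.
  have -> : (1 + d^-1) * (d ^+ 2 * V) = (d ^+ 2 + d) * V by field; rewrite gt_eqF.
  have dd : d ^+ 2 <= d by rewrite expr2 ler_piMr// ltW.
  have -> : d * (2 * V) = (d + d) * V by ring.
  by rewrite ler_wpM2r// lerD2r.
have vpW : limit_var p <= W.
  have plip : lip_on (eta + d) (fun x => p.[x]).
    move=> x y xL yL; have -> : p.[x] - p.[y] = (f x - f y) - ((f x - p.[x]) - (f y - p.[y])) by ring.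
    by apply: le_trans (ler_normB _ _) _; rewrite mulrDl lerD// ?flip// hl.
  have ed0 : 0 <= eta + d by rewrite addr_ge0// ltW.
  apply: le_trans (limit_var_lip ed0 plip) _; apply: ler_wpM2r => //.
  by rewrite lerXn2r ?nnegrE// ?lerD2l// addr_ge0.
have e1 : f = (fun x => 1 * (f x - p.[x]) + p.[x]) by apply/funext => x; ring.
have up : sigma2 <= d * (2 * V) + (1 + d) * limit_var p.
  apply: sigma2_le => K; rewrite e1; apply: le_trans (partial_variance_le 1 K cN cp d0) _.
  rewrite expr1n mul1r; apply: lerD; first exact: hN.
  by apply: ler_wpM2l; [rewrite addr_ge0// ltW|exact: partial_variance_poly_le].
have e2 : (fun x => p.[x]) = (fun x => -1 * (f x - p.[x]) + f x) by apply/funext => x; ring.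
have dn : limit_var p <= d * (2 * V) + (1 + d) * sigma2.
  rewrite limit_varE e2; apply: le_trans (partial_variance_le (-1) _ cN cf d0) _.
  rewrite sqrrN expr1n mul1r; apply: lerD; first exact: hN.
  by apply: ler_wpM2l; [rewrite addr_ge0// ltW|exact: partial_variance_le_sigma2].
have q1 : d * limit_var p <= d * W by rewrite ler_wpM2l// ltW.
have q2 : 0 <= d * W by rewrite mulr_ge0// ltW.
have q3 : 0 <= d * sigma2 by rewrite mulr_ge0// ltW.
rewrite ler_norml; apply/andP; split; move: up dn; lra.
Qed.

Lemma continuous_gaussian_moment m : continuous (fun v : R => gaussian_moment v m).
Proof.
elim/ltn_ind: m => -[|[|m]] IH v /=; [exact: cvg_cst|exact: cvg_cst|].
apply: cvgM; last exact: (IH m).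
by apply: cvgM; [exact: cvg_cst|exact: cvg_id].
Qed.

Lemma linstat_mean_sub n g1 g2 : admissible g1 -> admissible g2 ->
  mean n (fun x => -1 * g2 x + g1 x) = - mean n g2 + mean n g1.
Proof.
move=> a1 a2; rewrite /linstat_mean -sumrN -big_split; apply: eq_bigr => a _ /=.
by rewrite mxelt_lin ?mulN1r//; exact: moment_adm.
Qed.

(** A majorant with a certified average is produced, instead of a bound on the expectation of [h].
    Such majorants for [h] and for [- h] together enclose [h], and only then is its expectation
    under control. *)
Lemma upper_average (h : R -> R) (M e : R) : continuous h -> (forall x, `|h x| <= M) -> 0 < e ->
  \forall n \near \oo, exists U u, [/\ averages n U u,
    (forall x, h (linstat (Nn n) (fun y => f Q.[y]) x - mean n (fun y => f Q.[y])) <= U x) &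
    u <= gauss_expect sigma2 h + e].
Proof.
move=> ch hM e0; have M0 : 0 <= M by apply: le_trans (hM 0); exact: normr_ge0.
have e8 : 0 < e / 8 by rewrite divr_gt0.
have sg0 := sigma2_ge0; have V0 := limit_var_ge0 'X.
have [P [hP gP]] := gauss_upper_poly sg0 ch hM e8.
rewrite gauss_polyE// in gP.
(* Beyond [w] the term [A * z ^+ 2] exceeds the oscillation [2 * M] of [h], while its average, about
   A times a variance at most sigma2 + 1, stays below e / 8 up to the convergence error. *)
pose w := 16 * M * (sigma2 + 1) / e + 1.
have w1 : 1 <= w.
  by rewrite lerDr; apply: divr_ge0; [apply: mulr_ge0; [exact: mulr_ge0|lra]|exact: ltW].
pose A := 2 * M / w ^+ 2.
have A0 : 0 <= A by apply: divr_ge0; [exact: mulr_ge0|exact: sqr_ge0].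
have Asg : A * (sigma2 + 1) <= e / 8.
  have w0 : 0 < w by exact: lt_le_trans ltr01 w1.
  rewrite /A mulrAC ler_pdivrMr ?exprn_gt0//.
  have h1 : 2 * M * (sigma2 + 1) = e / 8 * (w - 1) by rewrite /w; field; rewrite gt_eqF.
  rewrite h1 ler_pM2l//; rewrite expr2; nra.
have [r r0 hr] := heine w ch e8.
pose K := 2 * M / r ^+ 2.
have K0 : 0 <= K by apply: divr_ge0; [exact: mulr_ge0|exact: sqr_ge0].
have pw y z : h y <= P.[z] + e / 8 + A * z ^+ 2 + K * (y - z) ^+ 2.
  have hz := hP z; have q1 : 0 <= A * z ^+ 2 by rewrite mulr_ge0// sqr_ge0.
  have q2 : 0 <= K * (y - z) ^+ 2 by rewrite mulr_ge0// sqr_ge0.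
  have osc : h y - h z <= 2 * M.
    by have := hM y; have := hM z; rewrite !ler_norml => /andP[? ?] /andP[? ?]; lra.
  have [zw|zw] := leP `|z| w; last first.
    have : 2 * M <= A * z ^+ 2.
      rewrite /A mulrAC ler_pdivlMr ?exprn_gt0//; last exact: lt_le_trans ltr01 w1.
      apply: ler_wpM2l; first exact: mulr_ge0.
      rewrite -[z ^+ 2]real_normK ?num_real// lerXn2r ?nnegrE//; last exact: ltW.
      exact: le_trans ler01 w1.
    lra.
  have [yz|yz] := ltP `|z - y| r.
    by have := hr _ _ zw yz; rewrite ler_norml => /andP[? ?]; lra.
  have : 2 * M <= K * (y - z) ^+ 2.
    rewrite /K mulrAC ler_pdivlMr ?exprn_gt0//; apply: ler_wpM2l; first exact: mulr_ge0.
    rewrite -[(y - z) ^+ 2]real_normK ?num_real// distrC lerXn2r ?nnegrE//; exact: ltW.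
  lra.
have [c c0 hc] := sigma2_approx.
have cG : continuous (fun v : R => \sum_(i < size P) P`_i * gaussian_moment v i).
  apply: continuous_ordsum => i v; apply: cvgM; first exact: cvg_cst.
  exact: continuous_gaussian_moment.
have /cvgrPdist_le/(_ _ e8)/nbhs_ballP[rho /= rho0 hrho] := cG sigma2.
(* The four bounds serve, in order: [sigma2_approx]; moving the Gaussian mean of [P] from [sigma2]
   to [limit_var p] at cost e / 8; [limit_var p <= sigma2 + 1]; and [K] times the variance of the
   remainder being at most e / 8. *)
pose d := Num.min 1 (Num.min (rho / (2 * (c + 1))) (Num.min ((c + 1)^-1) (e / (8 * (K * (V + 1) + 1))))).
have c1 : 0 < c + 1 by rewrite ltr_wpDl.
have KV : 0 < K * (V + 1) + 1 by rewrite ltr_wpDl// mulr_ge0// addr_ge0.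
have p1 : 0 < 2 * (c + 1) by rewrite mulr_gt0.
have p2 : 0 < 8 * (K * (V + 1) + 1) by rewrite mulr_gt0.
have d0 : 0 < d by rewrite !lt_min ltr01 (divr_gt0 rho0 p1) invr_gt0 c1 (divr_gt0 e0 p2).
have [da db dc dd] : [/\ d <= 1, d <= rho / (2 * (c + 1)), d <= (c + 1)^-1 & d <= e / (8 * (K * (V + 1) + 1))].
  by split; rewrite !ge_min lexx ?orbT.
have [p hl vp] := hc d d0 da.
have dcrho : d * c < rho.
  rewrite ler_pdivlMr// in db.
  by have := mulr_ge0 (ltW d0) c0; move: db; rewrite mulrCA mulrDr mulr1; lra.
have dc1 : d * c <= 1.
  have := ler_wpM2r (ltW c1) dc; rewrite mulVf ?gt_eqF//.
  by have := mulr_ge0 (ltW d0) c0; rewrite mulrDr mulr1; lra.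
have vp1 : limit_var p <= sigma2 + 1.
  by move: vp; rewrite ler_norml => /andP[_]; lra.
have gp : \sum_(i < size P) P`_i * gaussian_moment (limit_var p) i <=
          \sum_(i < size P) P`_i * gaussian_moment sigma2 i + e / 8.
  have := hrho (limit_var p); rewrite /ball/= distrC => /(_ (le_lt_trans vp dcrho)).
  by rewrite ler_norml => /andP[+ _]; lra.
have KdV : K * (d ^+ 2 * V + d) <= e / 8.
  rewrite ler_pdivlMr// in dd.
  have d2 : d ^+ 2 * V <= d * V by apply: ler_wpM2r => //; rewrite expr2 ler_piMr// ltW.
  have h1 : K * (d ^+ 2 * V + d) <= K * (d * (V + 1)).
    by apply: ler_wpM2l => //; rewrite mulrDr mulr1 lerD2r.
  apply: le_trans h1 _; rewrite ler_pdivlMr//; move: dd.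
  have -> : d * (8 * (K * (V + 1) + 1)) = K * (d * (V + 1)) * 8 + 8 * d by ring.
  lra.
pose rem x := f Q.[x] - p.[Q.[x]].
have apQ : admissible (fun x => (p \Po Q).[x]) by exact: admissible_poly.
have remE : rem = (fun x => -1 * (p \Po Q).[x] + f Q.[x]).
  by apply/funext => x; rewrite /rem horner_comp mulN1r addrC.
have arem : admissible rem.
  have := admissibleD (admissibleM (admissible_poly (-1)%:P) apQ) fQ_adm.
  by rewrite remE; congr admissible; apply/funext => x; rewrite hornerC.
have hvar := var_lipschitz (g := fun x => f x - p.[x]) (ltW d0) (le_trans ler01 L1) arem QL hl d0.
have lim1 : (fun n => \sum_(i < size P) P`_i * nth_moment p i n) @ \oo -->
    \sum_(i < size P) P`_i * gaussian_moment (limit_var p) i.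
  apply: cvg_ordsum => i; apply: cvgM; first exact: cvg_cst.
  exact: nth_moment_cvg.
have lim2 := @nth_moment_cvg p 2; rewrite /= mul1r mulr1 in lim2.
move/cvgrPdist_le/(_ _ e8) : lim1 => lim1.
have e8A : 0 < e / 8 / (A + 1) by rewrite divr_gt0// ltr_wpDl.
move/cvgrPdist_le/(_ _ e8A) : lim2 => lim2.
apply: filterS (filterI hvar (filterI lim1 lim2)) => n /= [b1 [b2 b3]].
pose Z x := linstat (Nn n) (fun y => (p \Po Q).[y]) x - mean n (fun y => (p \Po Q).[y]).
have avg1 := average_poly_centered P p n.
have avg2 := average_centered_pow p 2 n.
have avg3 := average_variance (int1 n) (orth n) (Nn n) (moment_adm n arem)
  (moment_adm n (admissible_sqr arem)).
have avg := averages_to_lin A avg2 (averages_to_lin K avg3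
  (averages_to_add avg1 (averages_to_const (int1 n) (orth n) (Nn n) (e / 8)))).
eexists; eexists; split; first exact: avg.
  move=> x /=; rewrite -/(Z x).
  have YZ : linstat (Nn n) (fun y => f Q.[y]) x - mean n (fun y => f Q.[y]) - Z x =
            linstat (Nn n) rem x - mean n rem.
    rewrite /Z remE linstat_mean_sub//.
    have -> : linstat (Nn n) (fun x => -1 * (p \Po Q).[x] + f Q.[x]) x =
       - linstat (Nn n) (fun x => (p \Po Q).[x]) x + linstat (Nn n) (fun x => f Q.[x]) x.
      rewrite /linstat -sumrN -big_split; apply: eq_bigr => a _ /=.
      by rewrite mulN1r.
    ring.
  rewrite -YZ; apply: le_trans (pw _ (Z x)) _; lra.
have B2 : A * nth_moment p 2 n <= e / 4.
  have h1 : nth_moment p 2 n <= limit_var p + e / 8 / (A + 1).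
    by move: b3; rewrite ler_norml => /andP[+ _]; lra.
  apply: le_trans (ler_wpM2l A0 h1) _.
  have h2 : A * limit_var p <= A * (sigma2 + 1) by apply: ler_wpM2l.
  have h3 : A * (e / 8 / (A + 1)) <= e / 8.
    rewrite mulrA ler_pdivrMr; last by rewrite ltr_wpDl.
    by rewrite mulrC ler_pM2l//; lra.
  rewrite mulrDr; lra.
have B3 : K * var n rem <= e / 8.
  by apply: le_trans KdV; apply: ler_wpM2l.
have B1 : \sum_(i < size P) P`_i * nth_moment p i n <=
    \sum_(i < size P) P`_i * gaussian_moment (limit_var p) i + e / 8.
  by move: b2; rewrite ler_norml => /andP[+ _]; lra.
move: B1 B2 B3 gp gP; lra.
Qed.

Lemma admissible_bounded_scaled (h : R -> R) (M : R) : continuous h -> (forall x, `|h x| <= M) ->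
  admissible (fun y => h (Num.sqrt sigma2 * y)).
Proof.
move=> ch hM; apply: (@admissible_continuous _ _ M) => [x|x]; last exact: hM.
apply: (@continuous_comp _ _ _ (fun y => Num.sqrt sigma2 * y) h); last exact: ch.
by apply: cvgM; [exact: cvg_cst|exact: cvg_id].
Qed.

(** Apply [upper_average] to [h] and to [- h]; the negative of the second majorant is a minorant of
    [h]. *)
Lemma clt (h : R -> R) (M : R) : continuous h -> (forall x, `|h x| <= M) ->
  (fun n => ens_expect (mu n) (Nn n) (psi n)
    (fun x => h (linstat (Nn n) (fun y => f Q.[y]) x -
       ens_expect (mu n) (Nn n) (psi n) (linstat (Nn n) (fun y => f Q.[y])))))
  @ \oo --> gauss_expect sigma2 h.
Proof.
move=> ch hM; apply/cvgrPdist_le => e e0.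
have chN : continuous (fun x => - h x) by move=> x; apply: cvgN; exact: ch.
have hMN x : `|- h x| <= M by rewrite normrN.
have u1 := upper_average ch hM e0; have u2 := upper_average chN hMN e0.
apply: filterS (filterI u1 u2) => n [[U1 [v1 [a1 b1 c1]]] [U2 [v2 [a2 b2 c2]]]].
have aN := averages_to_scale (int1 n) (orth n) (-1) a2.
rewrite (averages_to_expect (int1 n) (orth n) (average_linstat (int1 n) (orth n) (Nn n) (moment_adm n fQ_adm))).
have lo x : -1 * U2 x <= h (linstat (Nn n) (fun y => f Q.[y]) x - mean n (fun y => f Q.[y])).
  by have := b2 x; lra.
have /andP[g1 g2] := ens_expect_between (int1 n) (orth n) aN a1 lo b1.
have gN : gauss_expect sigma2 (fun x => - h x) = - gauss_expect sigma2 h.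
  have ah := admissible_bounded_scaled ch hM.
  have a0 := admissible_poly (0 : {poly R}).
  have := gauss_mean_lin (-1) ah a0.
  have -> : gauss_mean (fun y => (0 : {poly R}).[y]) = 0.
    rewrite /gauss_mean; under eq_Rintegral do rewrite horner0 mul0r.
    by rewrite Rintegral_cst// mul0r.
  rewrite addr0 mulN1r => <-; congr gauss_mean; apply/funext => y.
  by rewrite horner0 addr0 mulN1r.
rewrite gN in c2; rewrite ler_norml; apply/andP; split.
  by move: g2 c1; rewrite /linstat_mean; lra.
by move: g1 c2; rewrite /linstat_mean; lra.
Qed.

End Asymptotics.

(** * Passage from the given data to the setting of the limit theorem *)

Lemma symbol_reE (R : realType) p q B (s : int -> R) t : (p + q <= B)%N ->
  (forall l : int, (l < - q%:Z)%R \/ (p%:Z < l)%R -> s l = 0) ->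
  symbol_re p q s t = symbol B s t.
Proof.
move=> pqB s0; pose h (d : int) := s d * cos (d%:~R * t).
have h0 d : (d < - q%:Z)%R \/ (p%:Z < d)%R -> h d = 0 by move=> /s0; rewrite /h => ->; rewrite mul0r.
rewrite /symbol_re /symbol big_mkord -/(h _).
rewrite -[RHS](big_mkord xpredT (fun e => h (e%:Z - B%:Z))).
rewrite (big_cat_nat (n := (B - q)%N))//=; last by lia.
rewrite big_nat_cond [X in _ = X + _]big1 ?add0r; last first.
  by move=> i; rewrite andbT => /andP[_ iB]; apply: h0; left; lia.
have -> : \sum_(B - q <= e < 2 * B + 1) h (e%:Z - B%:Z) =
    \sum_(i < 2 * B + 1 - (B - q)) h ((i + (B - q))%N%:Z - B%:Z).
  by rewrite -{1}[(B - q)%N]add0n big_addn big_mkord.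
rewrite (sum_ord_widen (h := fun i => h (i%:Z - q%:Z)) (N := 2 * B + 1 - (B - q))).
- by apply: eq_bigr => i _; congr h; lia.
- lia.
- by move=> k hk; apply: h0; right; lia.
Qed.

Unset Implicit Arguments. Set Strict Implicit. Set Printing Implicit Defensive.

Theorem theorem2p3 (R : realType)
  (mu : nat -> {measure set R -> \bar R})
  (psi : nat -> nat -> R -> R)          (* psi n j = psi_j^{(n)} = phi_j^{(n)} *)
  (J : nat -> nat -> nat -> R)          (* J n = J^{(n)} *)
  (b : nat)                             (* band width, independent of n *)
  (Horth_int : forall n j k,
      (mu n).-integrable setT (fun x => (psi n j x * psi n k x)%:E))
  (Horth : forall n j k,
      (\int[mu n]_x (psi n j x * psi n k x)%:E = ((j == k)%:R)%:E)%E)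
  (Hband : forall n j k, (b < `|(j%:Z - k%:Z)%R|)%N -> J n j k = 0)
  (Hrec : forall n j x,
      x * psi n j x = \sum_(k < j + b + 1) J n j k * psi n k x)
  (E : set R) (HEc : compact E)
  (HE : forall k : nat,
      (fun n : nat => n%:R * \sum_(j < n)
          Rintegral (mu n) (~` E) (fun x => x ^+ k * psi n j x * psi n j x))
        @ \oo --> (0 : R))
  (Q : {poly R}) (nj : nat -> nat) (Hnj : forall a c, (a < c)%N -> (nj a < nj c)%N)
  (p q : nat) (s : int -> R)
  (Hs : forall l : int, (l < - q%:Z)%R \/ (p%:Z < l)%R -> s l = 0)
  (Hlim : forall r t : int,
      (fun m => shifted (polyJ b Q (J (nj m))) (nj m) r t) @ \oo --> s (r - t)%R)
  (f : R -> R) (Hf_der : forall x, derivable f x 1) (Hf_C1 : continuous (derive1 f))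
  (C : R) (m : nat) (HC : 0 < C) (Hgrowth : forall x, `|f x| <= C * (1 + `|x|) ^+ m) :
  let g := fun theta => f (symbol_re p q s theta) in
  let term := fun k : nat =>
      k%:R * complex.Re (fourier_coef g k%:Z * fourier_coef g (- k%:Z)) in
  let sigma2 := limn (series (fun k => term k.+1)) in
  cvgn (series (fun k => term k.+1)) /\
  forall h : R -> R, continuous h -> (exists M, forall y, `|h y| <= M) ->
    (fun j => let n := nj j in
       ens_expect (mu n) n (psi n)
         (fun x => h (linstat n (fun y => f Q.[y]) x
                      - ens_expect (mu n) n (psi n) (linstat n (fun y => f Q.[y]))))
    ) @ \oo --> gauss_expect sigma2 h.
Proof.
move=> g term sigma2.
have leNn j : (j <= nj j)%N by elim: j => // j IH; exact: leq_ltn_trans IH (Hnj _ _ (ltnSn j)).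
(* One width for the band of Q(J) and for the support of [s]: [p + q] makes the symmetric range -B,
   ..., B contain -q, ..., p. *)
pose B := maxn (b * size Q) (p + q).
have bQ : (b * size Q <= B)%N by rewrite leq_maxl.
have pqB : (p + q <= B)%N by rewrite leq_maxr.
have orth n j k : Rintegral (mu n) setT (fun x => psi n j x * psi n k x) = (j == k)%:R.
  by rewrite /Rintegral Horth.
have int1' n := Horth_int (nj n); have orth' n := orth (nj n).
have band' n := Hband (nj n); have rec' n := Hrec (nj n).
(* Q(J) is the symmetric matrix of multiplication by [Q], so its Laurent limit is symmetric and the
   symbol is real on the circle. *)
have s_even d : s (- d) = s d.
  have sym n x y : polyJ b Q (J (nj n)) x y = polyJ b Q (J (nj n)) y x.
    rewrite -!(mxelt_poly (int1' n) (orth' n) (@band' n) (rec' n)); exact: mxelt_sym.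
  exact: (laurent_limit_sym sym Hlim).
have tail0 k : (fun n => \sum_(j < nj n) Rintegral (mu (nj n)) (~` E)
    (fun x => x ^+ k * psi (nj n) j x * psi (nj n) j x)) @ \oo --> (0 : R).
  apply/cvgrPdist_le => e e0; have /cvgrPdist_le/(_ _ e0)[N _ hN] := HE k.
  exists N.+1 => // n /= Nn; have nn := leNn n.
  have := hN (nj n) (leq_trans (ltnW Nn) nn); rewrite !sub0r !normrN normrM => h.
  apply: le_trans h; rewrite ler_peMl// ger0_norm// ler1n.
  by apply: leq_trans nn; apply: leq_trans Nn.
have sE : symbol_re p q s = symbol B s.
  by apply/funext => t; exact: symbol_reE.
have cQ : continuous (fun x => Q.[x]) by exact: continuous_horner.
have [M HM] : exists M, forall x, E x -> `|x| <= M.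
  have [M0 [_ hM0]] := compact_bounded HEc.
  by exists (M0 + 1) => x Ex; apply: (hM0 (M0 + 1)) => //; rewrite ltrDl.
have [L0 HL0] := bounded_on M cQ.
pose S0 := \sum_(e < 2 * B + 1) `|s (e%:Z - B%:Z)|.
(* [L] bounds both [Q] on [E] and the symbol on the circle, so approximating [f] on [-L, L] controls
   the ensembles and the limiting variance together. *)
pose L := 1 + `|L0| + S0.
have S00 : 0 <= S0 by exact: sumr_ge0.
have L1 : 1 <= L by rewrite /L -addrA lerDl addr_ge0.
have QL x : E x -> `|Q.[x]| <= L.
  move=> /HM/HL0 h; apply: le_trans h _; apply: le_trans (ler_norm _) _.
  by rewrite /L; lra.
have symbolL t : `|symbol B s t| <= L.
  apply: (@le_trans _ _ S0); last by rewrite /L; have := normr_ge0 L0; lra.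
  apply: le_trans (ler_norm_sum _ _ _) _; apply: ler_sum => e _.
  by rewrite normrM ler_piMr// ler_norml cos_geN1 cos_le1.
have cf : continuous f by move=> x; apply: differentiable_continuous; apply/derivable1_diffP.
have fQ_adm : admissible (fun x => f Q.[x]).
  split; first by apply: continuous_measurable_fun => x; exact: (continuous_comp (cQ x) (cf _)).
  (* The absolute value in the growth bound is removed by 1 + |y| <= 2 + y^2. *)
  exists (C%:P * (2%:P + Q ^+ 2) ^+ m) => x; apply: le_trans (Hgrowth _) _.
  rewrite hornerM hornerC horner_exp hornerD hornerC horner_exp ler_pM2l//.
  apply: lerXn2r; rewrite ?nnegrE ?addr_ge0 ?sqr_ge0//.
  rewrite -[Q.[x] ^+ 2]real_normK ?num_real//.
  by have := sqr_ge0 (`|Q.[x]| - 1); have := sqr_ge0 `|Q.[x]|; rewrite !expr2; nra.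
have termE : series (fun k => term k.+1) = partial_variance B s f.
  apply/funext => K; rewrite /series /= big_mkord; apply: eq_bigr => k _.
  rewrite /term /g sE fourier_term// => t.
  exact: (continuous_comp (@continuous_symbol R B s t) (cf _)).
rewrite /sigma2 termE; split.
  exact: (partial_variance_cvg leNn int1' orth' (@band') rec' bQ Hlim HEc tail0 L1 QL symbolL s_even Hf_der Hf_C1).
move=> h ch [Mh hMh].
exact: (clt leNn int1' orth' (@band') rec' bQ Hlim HEc tail0 L1 QL symbolL s_even Hf_der Hf_C1 fQ_adm ch hMh).
Qed.
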